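(* Let $\{f_i\}_{i=1}^\ell$ be a $C^1$ iterated function system on $\mathbb{R}^d$, let $(\Sigma,\sigma)$ be the one-sided full shift over $\{1,\ldots,\ell\}$ and $\Pi$ the associated coding map. Let $m$ be an ergodic $\sigma$-invariant Borel probability measure on $\Sigma$. Then $$\overline{\dim}_P(m\circ\Pi^{-1})\le\dim_L m,$$ where $m\circ\Pi^{-1}$ is the push-forward of $m$ by $\Pi$, $\overline{\dim}_P$ is the upper packing dimension of a measure, and $\dim_Lm$ is the Lyapunov dimension of $m$ with respect to $\{f_i\}_{i=1}^\ell$.
   Context: $C^1$ IFS: let $Z\subset\mathbb{R}^d$ be compact. A finite family $\{f_i\}_{i=1}^\ell$ of contracting self maps of $Z$ is a $C^1$ iterated function system (IFS) if there is an open set $U\supset Z$ such that each $f_i$ extends to a contracting (i.e. Lipschitz with constant $<1$) $C^1$-diffeomorphism $f_i:U\to f_i(U)\subset U$. Its attractor $K$ is the unique non-empty compact set with $K=\bigcup_{i=1}^\ell f_i(K)$. Coding: $\Sigma=\{1,\ldots,\ell\}^{\mathbb{N}}$ with the product topology, $\sigma$ the left shift. For $x=(x_n)_{n=1}^\infty\in\Sigma$ write $x|n=x_1\ldots x_n$ and $f_{x|n}=f_{x_1}\circ\cdots\circ f_{x_n}$. The coding map $\Pi:\Sigma\to K$ is $\Pi(x)=\lim_{n\to\infty}f_{x_1}\circ\cdots\circ f_{x_n}(z)$, independent of $z\in U$. $D_zf$ is the differential of $f$ at $z$. Singular value function: for $T\in\mathbb{R}^{d\times d}$ let $\alpha_1(T)\ge\cdots\ge\alpha_d(T)$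 be the singular values; for $s\ge0$ set $\phi^s(T)=\alpha_1(T)\cdots\alpha_k(T)\alpha_{k+1}(T)^{s-k}$ with $k=[s]$ (integer part) if $0\le s\le d$ (for $s=d$ this is $\alpha_1(T)\cdots\alpha_d(T)$), and $\phi^s(T)=|\det(T)|^{s/d}$ if $s>d$. Lyapunov dimension: $\dim_Lm$ is the unique $s\ge0$ with $h_m(\sigma)+\mathcal{G}^s_*(m)=0$, where $h_m(\sigma)$ is the measure-theoretic entropy and $\mathcal{G}^s_*(m)=\lim_{n\to\infty}\frac1n\int g^s_n\,dm$ with $g_n^s(x)=\log\phi^s(D_{\Pi\sigma^nx}f_{x|n})$. Upper packing dimension of a Borel probability measure $\eta$: $\overline{\dim}_P\eta=\operatorname{ess\,sup}_{x\in\mathrm{supp}(\eta)}\overline{d}(\eta,x)$ (essential supremum with respect to $\eta$), where $\overline{d}(\eta,x)=\limsup_{r\to0}\frac{\log\eta(B(x,r))}{\log r}$ and $B(x,r)$ is the closed ball of radius $r$ centred at $x$. *)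

(* Defs.v *)
From HB Require Import structures.
From mathcomp Require Import all_boot all_order all_algebra.
From mathcomp Require Import all_classical all_reals all_analysis.

Set Implicit Arguments.
Unset Strict Implicit.
Unset Printing Implicit Defensive.

Import Order.TTheory GRing.Theory Num.Theory.
Import numFieldNormedType.Exports.

Local Open Scope classical_set_scope.
Local Open Scope ring_scope.

(* The topological space T equipped with its Borel sigma-algebra. *)
Notation borelType T := (g_sigma_algebraType (@open T)).

(* R^d is 'rV[R]_d. The library norm on matrices is the max norm, so the
   Euclidean norm, used for contractions and balls, is defined separately;
   both induce the same topology, differentials and Borel sets. *)
Section euclidean_space.
Variables (R : realType) (d : nat).
Implicit Types (U : set 'rV[R]_d) (f g : 'rV[R]_d -> 'rV[R]_d).

Definition enorm (x : 'rV[R]_d) : R := Num.sqrt (\sum_(i < d) x 0 i ^+ 2).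

Definition eclosed_ball (x : 'rV[R]_d) (r : R) : set 'rV[R]_d :=
  [set y | enorm (y - x) <= r].

Definition contracting_on U f : Prop :=
  exists c : R, [/\ 0 <= c, c < 1 &
    forall x y, U x -> U y -> enorm (f x - f y) <= c * enorm (x - y)].

(* Meant for open U. *)
Definition C1_on U f : Prop :=
  forall x, U x -> differentiable f x /\ {for x, continuous (jacobian f)}.

Definition C1_diffeo_on U f : Prop :=
  [/\ C1_on U f, open (f @` U) &
      exists g, C1_on (f @` U) g /\ forall x, U x -> g (f x) = x].

End euclidean_space.

(* The maps are total functions, of which only the values on U matter: f i
   stands for the extension to U of the i-th self map of Z. *)
Definition C1_IFS (R : realType) (d l : nat) (Z U : set 'rV[R]_d)
    (f : 'I_l.+1 -> 'rV[R]_d -> 'rV[R]_d) : Prop :=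
  [/\ compact Z, Z !=set0, open U, Z `<=` U &
      forall i, [/\ f i @` Z `<=` Z, f i @` U `<=` U,
                    contracting_on U (f i) & C1_diffeo_on U (f i)]].

Section singular_values.
Variables (R : realType) (d : nat).
Implicit Types (T : 'M[R]_d) (s : R).

(* a lists alpha_1(T) >= ... >= alpha_d(T) >= 0, whose squares are the
   eigenvalues of T^T T with multiplicity. *)
Definition is_singular_values T (a : seq R) : Prop :=
  [/\ sorted >=%R a, all (>= 0) a &
      char_poly (T^T *m T) = \prod_(x <- a) ('X - (x ^+ 2)%:P)].

Definition singular_values T : seq R := xget [::] (is_singular_values T).

(* alpha T i is alpha_(i+1)(T). *)
Definition alpha T (i : nat) : R := (singular_values T)`_i.

(* For s = d the last factor is 0 `^ 0 = 1. *)
Definition singular_value_fun s T : R :=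
  let k := Num.truncn s in
  if s <= d%:R then (\prod_(i < k) alpha T i) * alpha T k `^ (s - k%:R)
  else `|\det T| `^ (s / d%:R).

End singular_values.

(* The sequence space {1, ..., l+1}^N; x 0 is the first letter. *)
Definition Sigma (l : nat) : Type :=
  prod_topology (fun _ : nat => discrete_topology 'I_l.+1).

HB.instance Definition _ l := Topological.copy (Sigma l)
  (prod_topology (fun _ : nat => discrete_topology 'I_l.+1)).
HB.instance Definition _ l := isPointed.Build (Sigma l) (fun=> ord0).

Definition left_shift (l : nat) (x : Sigma l) : Sigma l := fun n => x n.+1.

Section coding.
Variables (R : realType) (d l : nat) (f : 'I_l.+1 -> 'rV[R]_d -> 'rV[R]_d).

(* f_(x|n) = f_(x_1) \o ... \o f_(x_n) *)
Definition fword (x : Sigma l) (n : nat) : 'rV[R]_d -> 'rV[R]_d :=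
  foldr (fun i g => f i \o g) id (mkseq x n).

Definition coding (z : 'rV[R]_d) (x : Sigma l) : 'rV[R]_d :=
  limn (fun n => fword x n z).

End coding.

Section entropy.
Context {disp : measure_display} {T : measurableType disp} {R : realType}.
Variables (m : probability T R) (S : T -> T).

Definition measure_preserving : Prop :=
  measurable_fun setT S /\ forall A, measurable A -> m (S @^-1` A) = m A.

Definition ergodic : Prop :=
  forall A, measurable A -> S @^-1` A = A -> m A = 0%E \/ m A = 1%E.

(* A finite measurable partition is given by its labelling xi : T -> 'I_k. *)
Definition measurable_partition (k : nat) (xi : T -> 'I_k) : Prop :=
  forall i, measurable (xi @^-1` [set i]).

(* Entropy of the join of S^-i(xi), i < n; note that ln 0 = 0. *)
Definition partition_entropy (k : nat) (xi : T -> 'I_k) (n : nat) : R :=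
  - \sum_(w : {ffun 'I_n -> 'I_k})
      let p := fine (m [set x | forall i : 'I_n, xi (iter i S x) = w i]) in
      p * ln p.

Definition entropy_wrt (k : nat) (xi : T -> 'I_k) : R :=
  limn (fun n => n%:R^-1 * partition_entropy xi n).

Definition entropy : \bar R :=
  ereal_sup [set h | exists k (xi : T -> 'I_k),
    measurable_partition xi /\ h = (entropy_wrt xi)%:E].

End entropy.

Section lyapunov_dimension.
Variables (R : realType) (d l : nat) (f : 'I_l.+1 -> 'rV[R]_d -> 'rV[R]_d).
Variables (z : 'rV[R]_d) (m : probability (borelType (Sigma l)) R).

(* jacobian is the matrix of the differential acting on row vectors, i.e. the
   transpose of the usual one; singular values do not see the difference. *)
Definition log_svf (s : R) (n : nat) (x : Sigma l) : R :=
  ln (singular_value_fun s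
        (jacobian (fword f x n) (coding f z (iter n (@left_shift l) x)))).

Definition svf_growth (s : R) : \bar R :=
  limn (fun n => (n%:R^-1)%:E * \int[m]_x (log_svf s n x)%:E)%E.

Definition lyapunov_dim : R :=
  xget 0 [set s | 0 <= s /\ (entropy m (@left_shift l) + svf_growth s = 0)%E].

End lyapunov_dimension.

Section packing_dimension.
Variables (R : realType) (d : nat) (eta : set (borelType 'rV[R]_d) -> \bar R).

Definition msupport : set 'rV[R]_d :=
  [set x | forall V : set 'rV[R]_d, open V -> V x -> (0 < eta V)%E].

Definition upper_local_dim (x : 'rV[R]_d) : \bar R :=
  limf_esup (fun r : R => (ln (fine (eta (eclosed_ball x r))) / ln r)%:E) 0^'+.

(* The essential supremum over the support of eta. *)
Definition upper_packing_dim : \bar R :=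
  ereal_inf [set y : \bar R |
    {ae eta, forall x, msupport x -> (upper_local_dim x <= y)%E}].

End packing_dimension.

(* Main.v *)
Require Import Defs.
From HB Require Import structures.
From mathcomp Require Import all_boot all_order all_algebra fingroup perm.
From mathcomp Require Import all_classical all_reals all_analysis.
From mathcomp Require Import measurable_realfun complex ring lra.

Set Implicit Arguments.
Unset Strict Implicit.
Unset Printing Implicit Defensive.

Import Order.TTheory GRing.Theory Num.Theory.
Import numFieldNormedType.Exports.

Local Open Scope classical_set_scope.
Local Open Scope ring_scope.

(* For t above the Lyapunov dimension fix n0 with
   H_n0 + (integral of log phi^t of the differential of f_{x|n0}) far below 0.
   The image under f_{x|n0} of a set of small diameter r is covered by M(x)
   sets of diameter rho(x) r, where rho is comparable to a singular value of
   the differential and log M + t log rho <= log phi^t + O(1).  Iterating over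
   N blocks, the points coded by a cylinder of N blocks are covered by
   prod M sets of diameter D prod rho.  Summing over all words, the
   codes x for which the ball of radius D prod rho about their image has mass
   below 2^-N prod (m[block] / M) have measure O(2^-N), so by Borel-Cantelli
   almost every code is eventually good.  By the ergodic theorem
   prod m[block] / M >= (prod rho)^t along almost every orbit, hence
   eta(B(p, r)) >= c r^t for almost every p and all small r.  The
   characterisation of the Lyapunov dimension is usable because G^s is
   piecewise linear and strictly decreasing in s and the entropy is finite. *)

(** * Singular values *)

(** The losses of a cover (the factors [4 ^+ d] and [d.+1], one unit for the oscillation of
    [log_svf] on a cylinder, [ln 2] for Borel-Cantelli) occur once per block and do not grow with
    the block length, whereas a block of length [n0] gains [gam * n0]; hence [n0] is fixed before
    the number N of blocks tends to infinity. The size of the pieces varies with the code, so radii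
    are treated as stopping scales: consecutive scales along an orbit differ by a bounded factor,
    and every small r lies between two of them. Blocks may be dependent under m: the product of
    block masses is used only as a weight, and its sum over all concatenations of blocks factorises
    into ones. The ergodic theorem is applied to a single bounded function of a block, whose
    integral combines the block entropy with the mean of log phi^t. *)

Section enorm.
Variables (R : realType) (d : nat).
Implicit Types (x y : 'rV[R]_d) (A P : 'M[R]_d).

Lemma enorm_ge0 x : 0 <= enorm x. Proof. exact: sqrtr_ge0. Qed.

Lemma enorm_sqr x : enorm x ^+ 2 = \sum_(i < d) x 0 i ^+ 2.
Proof. by rewrite sqr_sqrtr// sumr_ge0// => i _; exact: sqr_ge0. Qed.

Lemma enorm_sqrE x : enorm x ^+ 2 = (x *m x^T) 0 0.
Proof. by rewrite enorm_sqr !mxE; apply: eq_bigr => i _; rewrite mxE expr2. Qed.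

Lemma enormN x : enorm (- x) = enorm x.
Proof. by rewrite /enorm; congr Num.sqrt; apply: eq_bigr => i _; rewrite mxE sqrrN. Qed.

Lemma enormB x y : enorm (x - y) = enorm (y - x).
Proof. by rewrite -enormN opprB. Qed.

Lemma enorm_le x y : (enorm x <= enorm y) = (enorm x ^+ 2 <= enorm y ^+ 2).
Proof. by rewrite ler_pXn2r// nnegrE enorm_ge0. Qed.

Lemma enormZ a x : enorm (a *: x) = `|a| * enorm x.
Proof.
rewrite /enorm -sqrtr_sqr -sqrtrM ?sqr_ge0//; congr Num.sqrt.
by rewrite mulr_sumr; apply: eq_bigr => i _; rewrite mxE exprMn.
Qed.

Lemma enorm0 : enorm (0 : 'rV[R]_d) = 0.
Proof. by rewrite -(scale0r (0 : 'rV_d)) enormZ normr0 mul0r. Qed.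

Lemma coord_enorm x i : `|x 0 i| <= enorm x.
Proof.
rewrite -sqrtr_sqr ler_sqrt ?sumr_ge0//; last by move=> j _; exact: sqr_ge0.
by rewrite (bigD1 i)//= lerDl sumr_ge0// => j _; exact: sqr_ge0.
Qed.

Lemma enorm_eq0 x : enorm x = 0 -> x = 0.
Proof.
move=> x0; apply/rowP => i; rewrite mxE.
by apply/eqP; rewrite -normr_le0 -x0 coord_enorm.
Qed.

Lemma norm_le_enorm x : `|x| <= enorm x.
Proof.
have [->|xn0] := eqVneq x 0; first by rewrite normr0 enorm0.
rewrite [leLHS]/Num.norm/= mx_normrE; apply/bigmax_leP; split; first exact: enorm_ge0.
by move=> [i j] _ /=; rewrite ord1 coord_enorm.
Qed.

Lemma coord_norm x i : `|x 0 i| <= `|x|.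
Proof.
rewrite [leRHS]/Num.norm/= mx_normrE.
exact: (le_bigmax_cond (0:R) (fun ij : 'I_1 * 'I_d => `|x ij.1 ij.2|) (j := (0, i))).
Qed.

Lemma dot_le x y : \sum_(i < d) x 0 i * y 0 i <= enorm x * enorm y.
Proof.
have [x0|xn0] := eqVneq (enorm x) 0.
  by rewrite (enorm_eq0 x0) enorm0 mul0r big1// => i _; rewrite mxE mul0r.
have [y0|yn0] := eqVneq (enorm y) 0.
  by rewrite (enorm_eq0 y0) enorm0 mulr0 big1// => i _; rewrite mxE mulr0.
have a0 : 0 < enorm x by rewrite lt_neqAle eq_sym xn0 enorm_ge0.
have b0 : 0 < enorm y by rewrite lt_neqAle eq_sym yn0 enorm_ge0.
(* The arithmetic-geometric inequality, weighted so that after summation both halves equal half of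
   [enorm x * enorm y]. *)
have step i : x 0 i * y 0 i <= 2^-1 * (enorm y / enorm x * x 0 i ^+ 2) +
    2^-1 * (enorm x / enorm y * y 0 i ^+ 2).
  have := sqr_ge0 (enorm y * x 0 i - enorm x * y 0 i).
  rewrite -(@pmulr_rge0 _ ((enorm y)^-1 * (enorm x)^-1)) ?mulr_gt0 ?invr_gt0//.
  suff -> : (enorm y)^-1 * (enorm x)^-1 *
    (enorm y * x 0 i - enorm x * y 0 i) ^+ 2 =
    (enorm y / enorm x * x 0 i ^+ 2) + (enorm x / enorm y * y 0 i ^+ 2) -
    2 * (x 0 i * y 0 i) by lra.
  by field; rewrite xn0 yn0.
apply: (le_trans (ler_sum _ (fun i _ => step i))).
rewrite big_split/= -!mulr_sumr -!enorm_sqr.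
suff -> : 2^-1 * (enorm y / enorm x * enorm x ^+ 2) +
  2^-1 * (enorm x / enorm y * enorm y ^+ 2) = enorm x * enorm y by [].
by field; rewrite xn0 yn0.
Qed.

Lemma enormD x y : enorm (x + y) <= enorm x + enorm y.
Proof.
rewrite -(@ler_pXn2r _ 2)// ?nnegrE ?addr_ge0 ?enorm_ge0//.
have -> : enorm (x + y) ^+ 2 =
    enorm x ^+ 2 + enorm y ^+ 2 + 2 * \sum_(i < d) x 0 i * y 0 i.
  rewrite !enorm_sqr mulr_sumr -!big_split/=.
  by apply: eq_bigr => i _; rewrite mxE; ring.
by rewrite sqrrD; have := dot_le x y; lra.
Qed.

Lemma enorm_le_norm x : enorm x <= d%:R * `|x|.
Proof.
rewrite -(@ler_pXn2r _ 2)// ?nnegrE ?enorm_ge0 ?mulr_ge0//.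
rewrite enorm_sqr exprMn; apply: (@le_trans _ _ (d%:R * `|x| ^+ 2)).
  have -> : d%:R * `|x| ^+ 2 = \sum_(i < d) `|x| ^+ 2.
    by rewrite sumr_const card_ord mulr_natl.
  apply: ler_sum => i _.
  by rewrite -(real_normK (num_real (x 0 i))) ler_pXn2r ?nnegrE// coord_norm.
rewrite ler_wpM2r ?sqr_ge0// expr2 -natrM ler_nat.
by case: (d) => // n; rewrite leq_pmulr.
Qed.

Lemma enorm_orthogonal P x : P *m P^T = 1%:M -> enorm (x *m P) = enorm x.
Proof.
move=> PP; apply/eqP; rewrite eq_le !enorm_le !enorm_sqrE trmx_mul.
by rewrite mulmxA -(mulmxA x) PP mulmx1 lexx.
Qed.

End enorm.

(** * The spectral theorem for real symmetric matrices *)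

Section spectral.
Variable R : realType.

Lemma row_dotC n (u v : 'rV[R]_n) : u *m v^T = v *m u^T.
Proof. by rewrite -[RHS]trmxK trmx_mul trmxK; apply/rowP => i; rewrite ord1 [RHS]mxE. Qed.

(* Writing a complex eigenvector as u + iv with eigenvalue a + ib, symmetry
   gives b (|u|^2 + |v|^2) = 0, hence b = 0. *)
Lemma symmetric_eigenvalue n (S : 'M[R]_n.+1) : S^T = S ->
  exists a, exists2 v : 'rV[R]_n.+1, v != 0 & v *m S = a *: v.
Proof.
move=> Ssym.
have [[a b] /eigenvalueP[w wS w0]] :=
  @eigenvalue_closed R[i] n.+1 (map_mx (real_complex R) S) isT.
pose u := map_mx (@complex.Re R) w; pose v := map_mx (@complex.Im R) w.
have ReM (x : R[i]) y : complex.Re (x * real_complex R y) = complex.Re x * y.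
  by case: x => p q /=; rewrite mulr0 subr0.
have ImM (x : R[i]) y : complex.Im (x * real_complex R y) = complex.Im x * y.
  by case: x => p q /=; rewrite mulr0 add0r.
have ReD : {morph @complex.Re R : x y / x + y} by move=> [? ?] [? ?].
have ImD : {morph @complex.Im R : x y / x + y} by move=> [? ?] [? ?].
have uS : u *m S = a *: u - b *: v.
  apply/rowP => j; move/rowP: wS => /(_ j) /(congr1 (@complex.Re R)).
  rewrite !mxE (big_morph _ ReD erefl); under eq_bigr do rewrite mxE ReM.
  by case: (w 0 j) => p q /= <-; apply: eq_bigr => i _; rewrite mxE.
have vS : v *m S = b *: u + a *: v.
  apply/rowP => j; move/rowP: wS => /(_ j) /(congr1 (@complex.Im R)).
  rewrite !mxE (big_morph _ ImD erefl); under eq_bigr do rewrite mxE ImM.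
  case: (w 0 j) => p q /=; rewrite addrC => <-; by apply: eq_bigr => i _; rewrite mxE.
have : u *m S *m v^T = v *m S *m u^T.
  by rewrite row_dotC trmx_mul Ssym mulmxA.
rewrite uS vS mulmxBl mulmxDl -!scalemxAl (row_dotC v u) => /(congr1 (fun M : 'M[R]_1 => M 0 0)).
rewrite [in LHS]mxE [in RHS]mxE [X in _ + X = _]mxE.
have E c (M : 'M[R]_1) : (c *: M) 0 0 = c * M 0 0 by rewrite mxE.
rewrite !E -!enorm_sqrE => buv.
have {buv} : b * (enorm u ^+ 2 + enorm v ^+ 2) = 0 by lra.
have uv0 : (u != 0) || (v != 0).
  apply/negPn; rewrite negb_or !negbK; apply/negP => /andP[/eqP u0 /eqP v0].
  case/negP: w0; apply/eqP/rowP => j; rewrite mxE.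
  move/rowP : u0 => /(_ j); move/rowP : v0 => /(_ j); rewrite !mxE.
  by case: (w 0 j) => p q /= -> ->.
move/eqP; rewrite mulf_eq0 => /orP[/eqP b0|]; last first.
  rewrite paddr_eq0 ?sqr_ge0// !sqrf_eq0 => /andP[/eqP/enorm_eq0 u0 /eqP/enorm_eq0 v0].
  by rewrite u0 v0 eqxx in uv0.
exists a; case/orP: uv0 => ?.
  by exists u => //; rewrite uS b0 scale0r subr0.
by exists v => //; rewrite vS b0 scale0r add0r.
Qed.

Lemma row_sqr_gt0 n (v : 'rV[R]_n) : v != 0 -> 0 < (v *m v^T) 0 0.
Proof.
move=> v0; rewrite -enorm_sqrE lt_neqAle sqr_ge0 andbT eq_sym sqrf_eq0.
by apply: contra v0 => /eqP /enorm_eq0 ->.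
Qed.

Lemma mx11E (M : 'M[R]_1) : M = (M 0 0)%:M.
Proof. exact: mx11_scalar. Qed.

(** The reflection in the hyperplane orthogonal to [u = e - v]. Since [e] and [v] are unit vectors,
    the inner product of [e] and [u] is half of that of [u] with itself, so reflecting [e] subtracts
    exactly [u]. *)
Lemma householder n (e v : 'rV[R]_n) : e *m e^T = 1%:M -> v *m v^T = 1%:M ->
  exists H : 'M[R]_n, [/\ H^T = H, H *m H = 1%:M & e *m H = v].
Proof.
move=> ee vv; have [->|ev] := eqVneq e v.
  by exists 1%:M; rewrite trmx1 !mulmx1.
pose u := e - v; have u0 : u != 0 by rewrite subr_eq0.
pose q := (u *m u^T) 0 0; have q0 : 0 < q := row_sqr_gt0 u0.
pose H := 1%:M - (2 / q) *: (u^T *m u).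
have uu : u *m u^T = q%:M by rewrite [LHS]mx11E.
have euE : e *m u^T = (q / 2)%:M.
  have := uu; rewrite /u linearB/= mulmxBl !mulmxBr ee vv (row_dotC v e).
  rewrite (mx11E (e *m v^T)) => /(congr1 (fun M : 'M[R]_1 => M 0 0)).
  rewrite !mxE eqxx !mulr1n => qE; rewrite -raddfB; congr (_%:M); lra.
exists H; split.
- by rewrite /H linearB/= trmx1 linearZ/= trmx_mul trmxK.
- have XX : (u^T *m u) *m (u^T *m u) = q *: (u^T *m u).
    by rewrite mulmxA -(mulmxA _ u) uu mul_mx_scalar -scalemxAl.
  rewrite /H; move: (u^T *m u) XX => X XX.
  rewrite mulmxBl !mulmxBr !mul1mx mulmx1 -scalemxAl -scalemxAr XX !scalerA.
  by apply/matrixP => i j; rewrite !mxE; field; rewrite gt_eqF.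
- rewrite /H mulmxBr mulmx1 -scalemxAr mulmxA euE mul_scalar_mx scalerA.
  have -> : 2 / q * (q / 2) = 1 by field; rewrite gt_eqF.
  by rewrite scale1r /u opprB addrC subrK.
Qed.

(** Induction on the dimension: conjugating by a reflection that carries the first basis vector to a
    unit eigenvector splits off a one-dimensional block, and symmetry kills the other off-diagonal
    block. Vectors are rows, so the eigenvectors are the rows of [P]. *)
Lemma real_spectral n (S : 'M[R]_n) : S^T = S ->
  exists P (D : 'rV[R]_n), P *m P^T = 1%:M /\ S = P^T *m diag_mx D *m P.
Proof.
elim: n S => [|n IH] S Ssym.
  by exists 1%:M, 0; split; apply/matrixP => -[].
move: S Ssym; rewrite -[n.+1]/(1 + n)%N => S Ssym.
have [a [v v0 vS]] := symmetric_eigenvalue (Ssym : (S : 'M[R]_n.+1)^T = S).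
move: v v0 vS; rewrite -[n.+1]/(1 + n)%N => v v0 vS.
pose v1 := (enorm v)^-1 *: v.
have nv0 : enorm v != 0 by apply: contra v0 => /eqP /enorm_eq0 ->.
have v1v1 : v1 *m v1^T = 1%:M.
  rewrite [LHS]mx11E -enorm_sqrE enormZ ger0_norm ?invr_ge0 ?enorm_ge0//.
  by rewrite mulVf// expr1n.
have v1S : v1 *m S = a *: v1 by rewrite -scalemxAl vS !scalerA mulrC.
pose e : 'rV[R]_(1 + n) := delta_mx 0 0.
have ee : e *m e^T = 1%:M.
  by rewrite /e trmx_delta mul_delta_mx; apply/rowP => i; rewrite ord1 !mxE.
have [H [Hsym HH eH]] := householder ee v1v1.
have [S' S'def] : {S' : 'M[R]_(1 + n) | S' = H *m S *m H} by exists (H *m S *m H).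
have S'sym : S'^T = S' by rewrite S'def !trmx_mul Hsym Ssym mulmxA.
have eS' : e *m S' = a *: e.
  by rewrite S'def !mulmxA eH v1S -scalemxAl -eH -mulmxA HH mulmx1.
have S'E : S' = block_mx a%:M 0 0 (drsubmx S').
  rewrite -[LHS]submxK; have ur : ursubmx S' = 0.
    apply/rowP => j; rewrite !mxE/=; move/rowP: eS' => /(_ (rshift 1 j)).
    rewrite -rowE !mxE/= mulr0 => E0; rewrite -[RHS]E0.
    by congr (S' _ _); apply/val_inj.
  have ul : ulsubmx S' = a%:M.
    apply/rowP => j; rewrite ord1 !mxE/=; move/rowP: eS' => /(_ 0).
    rewrite -rowE !mxE/= mulr1 => E0; rewrite -[RHS]E0.
    by congr (S' _ _); apply/val_inj.
  congr block_mx => //; apply/trmx_inj.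
  by rewrite trmx_dlsub S'sym ur trmx0.
have [|Q [D [QQ dE]]] := IH (drsubmx S').
  by rewrite trmx_drsub S'sym.
pose P' : 'M[R]_(1 + n) := block_mx 1%:M 0 0 Q.
exists (P' *m H), (row_mx (a%:M : 'M[R]_1) D); split.
  rewrite trmx_mul Hsym mulmxA -(mulmxA _ H H) HH mulmx1.
  rewrite /P' tr_block_mx !trmx0 trmx1 mulmx_block !mul0mx !mulmx0 !mulmx1.
  by rewrite !addr0 !add0r QQ -scalar_mx_block.
rewrite trmx_mul Hsym -!mulmxA.
suff -> : S = H *m S' *m H.
  rewrite -!mulmxA; congr (_ *m _); rewrite !mulmxA; congr (_ *m _).
  rewrite S'E dE diag_mx_row /P' tr_block_mx !trmx0 trmx1.
  rewrite !mulmx_block !mul0mx !mulmx0 !mulmx1 !mul1mx !addr0 !add0r ?mul0mx ?mulmx0 ?addr0 ?add0r.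
  by congr block_mx; apply/rowP => i; rewrite ord1 !mxE.
by rewrite S'def !mulmxA HH mul1mx -mulmxA HH mulmx1.
Qed.

End spectral.

(** * Gram determinants and k-dimensional volumes *)

Section gram.
Variable R : realType.

(** Multilinearity in the rows. This is the Cauchy-Binet expansion before terms are grouped: the sum
    runs over all maps, the non-injective ones included. *)
Lemma det_mulmx_rect k n (A : 'M[R]_(k, n)) (B : 'M[R]_(n, k)) :
  \det (A *m B) = \sum_(f : {ffun 'I_k -> 'I_n})
    \det (\matrix_(i, j) B (f i) j) * \prod_i A i (f i).
Proof.
pose AB (s : 'S_k) i j := A i j * B j (s i).
transitivity (\sum_(f : {ffun 'I_k -> 'I_n}) \sum_(s : 'S_k)
    (-1) ^+ s * \prod_i AB s i (f i)).
  rewrite exchange_big; apply: eq_bigr => /= s _; rewrite -big_distrr /=.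
  congr (_ * _); rewrite -(bigA_distr_bigA (AB s)) /=.
  by apply: eq_bigr => x _; rewrite mxE.
apply: eq_bigr => f _; rewrite mulrC big_distrr /=; apply: eq_bigr => s _.
rewrite mulrCA big_split //=; congr (_ * (_ * _)).
by apply: eq_bigr => x _; rewrite mxE.
Qed.

(** Cauchy-Binet with every k-subset counted once per ordering, whence the factorial. Averaging over
    the relabellings [f \o s] leaves the sum unchanged and assembles the second determinant. For
    non-negative [D] all terms are non-negative, so Gram determinants can be compared term by
    term. *)
Lemma det_gram_diag k n (W : 'M[R]_(k, n)) (D : 'rV[R]_n) :
  k`!%:R * \det (W *m diag_mx D *m W^T) = \sum_(f : {ffun 'I_k -> 'I_n})
    (\prod_i D 0 (f i)) * \det (\matrix_(i, j) W j (f i)) ^+ 2.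
Proof.
rewrite det_mulmx_rect.
pose M (f : {ffun 'I_k -> 'I_n}) := \matrix_(i, j) W j (f i).
pose G f := \det (M f) * \prod_i (W i (f i) * D 0 (f i)).
transitivity (\sum_(s : 'S_k) \sum_(f : {ffun 'I_k -> 'I_n})
    G [ffun i => f (s i)]).
  rewrite [LHS](_ : _ = \sum_(s : 'S_k) \sum_(f : {ffun 'I_k -> 'I_n}) G f); last first.
    rewrite sumr_const card_Sn mulr_natl; congr (_ *+ _).
    apply: eq_bigr => f _; congr (\det _ * _).
      by apply/matrixP => i j; rewrite !mxE.
    by apply: eq_bigr => i _; rewrite mul_mx_diag mxE.
  apply: eq_bigr => s _.
  rewrite [RHS](reindex (fun f : {ffun 'I_k -> 'I_n} => [ffun i => f ((s^-1)%g i)]))/=; last first.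
    exists (fun f : {ffun 'I_k -> 'I_n} => [ffun i => f (s i)]) => f _.
      by apply/ffunP => i; rewrite !ffunE permK.
    by apply/ffunP => i; rewrite !ffunE permKV.
  apply: eq_bigr => f _; rewrite /G; congr (\det _ * _).
    by apply/matrixP => i j; rewrite !mxE !ffunE permK.
  by apply: eq_bigr => i _; rewrite !ffunE permK.
rewrite exchange_big; apply: eq_bigr => /= f _.
have detM (s : 'S_k) : \det (M [ffun i => f (s i)]) = (-1) ^+ s * \det (M f).
  rewrite -det_perm -det_mulmx -row_permE; congr (\det _).
  by apply/matrixP => i j; rewrite !mxE ffunE.
transitivity (\sum_(s : 'S_k) (\prod_i D 0 (f i) * \det (M f)) *
    ((-1) ^+ s * \prod_i W i (f (s i)))).
  apply: eq_bigr => s _; rewrite /G detM big_split/=.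
  under eq_bigr do rewrite ffunE.
  under [X in _ * (_ * X)]eq_bigr do rewrite ffunE.
  have arr (x y u v : R) : x * y * (u * v) = v * y * (x * u) by ring.
  by rewrite arr [in RHS](reindex_perm s).
rewrite -mulr_sumr -mulrA expr2; congr (_ * (_ * _)).
rewrite -det_tr; apply: eq_bigr => s _; congr (_ * _).
by apply: eq_bigr => i _; rewrite !mxE.
Qed.

(** Sorting the distinct values of [f] makes the i-th one at least i; monotonicity then applies
    factor by factor. *)
Lemma prod_injective_le (a : nat -> R) k n (f : 'I_k -> 'I_n) :
  (forall i, 0 <= a i) -> (forall i j, (i <= j)%N -> a j <= a i) ->
  injective f -> \prod_i a (f i) <= \prod_(i < k) a i.
Proof.
move=> a0 amono finj.
pose s := sort leq [seq (f i : nat) | i <- enum 'I_k].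
have us : uniq s.
  rewrite sort_uniq map_inj_uniq ?enum_uniq//.
  by move=> i j /val_inj /finj.
have ss : sorted ltn s.
  by rewrite ltn_sorted_uniq_leq us sort_sorted//; exact: leq_total.
have sz : size s = k by rewrite size_sort size_map size_enum_ord.
have -> : \prod_i a (f i) = \prod_(x <- s) a x.
  rewrite (perm_big [seq (f i : nat) | i <- enum 'I_k]); last by rewrite perm_sort.
  by rewrite big_map big_enum.
rewrite (big_nth 0%N) big_mkord sz; apply: ler_prod => i _.
rewrite a0/= amono//; have : (i < size s)%N by rewrite sz.
elim: (nat_of_ord i) => // j IH js; apply: (leq_ltn_trans (IH (ltnW js))).
by apply: (sorted_ltn_nth ltn_trans 0%N ss) => //; exact: ltnW js.
Qed.

(** Term by term: for injective [f] the product of weights is at most that of the k largest, and for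
    non-injective [f] two rows coincide and the determinant vanishes. *)
Lemma det_gram_le k n (W : 'M[R]_(k, n)) (a : nat -> R) :
  (forall i, 0 <= a i) -> (forall i j, (i <= j)%N -> a j <= a i) ->
  \det (W *m diag_mx (\row_(i < n) a i) *m W^T) <=
    (\prod_(i < k) a i) * \det (W *m W^T).
Proof.
move=> a0 amono.
have k0 : (0 : R) < k`!%:R by rewrite ltr0n fact_gt0.
rewrite -(ler_pM2l k0) det_gram_diag mulrCA.
have -> : W *m W^T = W *m diag_mx (const_mx 1) *m W^T.
  by rewrite diag_const_mx mulmx1.
rewrite det_gram_diag mulr_sumr; apply: ler_sum => f _.
rewrite [X in X * _](_ : _ = \prod_i a (f i)); last first.
  by apply: eq_bigr => i _; rewrite mxE.
rewrite [X in _ <= _ * (X * _)]big1 ?mul1r; last by move=> i _; rewrite mxE.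
have [/injectiveP finj|/injectivePn[i [j ij fij]]] := boolP (injectiveb f).
  by rewrite ler_wpM2r ?sqr_ge0// prod_injective_le.
rewrite (determinant_alternate ij) ?expr0n ?mulr0//.
by move=> x; rewrite !mxE fij.
Qed.

End gram.

Section singular_values.
Variables (R : realType) (d : nat).
Implicit Types (A B P : 'M[R]_d).

Lemma char_poly_conj A P Q : Q *m P = 1%:M ->
  char_poly (Q *m A *m P) = char_poly A.
Proof.
move=> QP; rewrite /char_poly.
have -> : char_poly_mx (Q *m A *m P) =
    map_mx polyC Q *m char_poly_mx A *m map_mx polyC P.
  rewrite /char_poly_mx mulmxBr mulmxBl -!map_mxM; congr (_ - _).
  by rewrite mul_mx_scalar -scalemxAl -map_mxM QP map_mx1 scalemx1.
rewrite !det_mulmx mulrAC -det_mulmx -map_mxM QP map_mx1.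
by rewrite det1 mul1r.
Qed.

Lemma char_poly_orthogonal P (D : 'rV[R]_d) : P *m P^T = 1%:M ->
  char_poly (P^T *m diag_mx D *m P) = \prod_(i < d) ('X - (D 0 i)%:P).
Proof.
move=> PP; rewrite char_poly_conj; last by rewrite mulmx1C.
rewrite char_poly_trig; first by apply: eq_bigr => i _; rewrite mxE eqxx.
by apply/is_trig_mxP => i j ij; rewrite mxE -val_eqE ltn_eqF.
Qed.

Lemma spectral_psd A P (D : 'rV[R]_d) : P *m P^T = 1%:M ->
  A *m A^T = P^T *m diag_mx D *m P ->
  forall i, D 0 i = enorm (row i P *m A) ^+ 2.
Proof.
move=> PP E i; rewrite enorm_sqrE trmx_mul mulmxA -(mulmxA (row i P)) E.
have vP : row i P *m P^T = delta_mx 0 i by rewrite -row_mul PP row1.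
rewrite !mulmxA vP -mulmxA (_ : P *m (row i P)^T = (row i P *m P^T)^T); last first.
  by rewrite trmx_mul trmxK.
by rewrite vP trmx_delta -colE -rowE !mxE eqxx.
Qed.

(** Ensures that [xget] in [singular_values] returns genuine singular values instead of its default,
    the empty list. *)
Lemma is_singular_values_exists A : exists a, is_singular_values A a.
Proof.
have [P [D [PP E]]] : exists P (D : 'rV[R]_d), P *m P^T = 1%:M /\
    A^T *m A = P^T *m diag_mx D *m P.
  by apply: real_spectral; rewrite trmx_mul trmxK.
have D0 i : 0 <= D 0 i.
  by rewrite (@spectral_psd A^T P D)// ?trmxK// sqr_ge0.
pose t := [seq Num.sqrt (D 0 i) | i <- enum 'I_d].
exists (sort >=%R t); split.
- by apply: sort_sorted => x y; exact: ge_total.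
- by rewrite all_sort; apply/allP => _ /mapP[i _ ->]; rewrite /= sqrtr_ge0.
- rewrite E char_poly_orthogonal// (perm_big t) ?perm_sort//= big_map big_enum/=.
  by apply: eq_bigr => i _; rewrite sqr_sqrtr.
Qed.

Lemma singular_valuesP A : is_singular_values A (singular_values A).
Proof. exact: (xgetPex [::] (is_singular_values_exists A)). Qed.

Lemma size_singular_values A : size (singular_values A) = d.
Proof.
have [_ _ /(congr1 (fun p : {poly R} => size p))] := singular_valuesP A.
by rewrite size_char_poly size_prod_XsubC => -[].
Qed.

Lemma alpha_ge0 A i : 0 <= alpha A i.
Proof.
rewrite /alpha; have [_ /allP a0 _] := singular_valuesP A.
have [isz|isz] := ltnP i (size (singular_values A)); last by rewrite nth_default.
exact/a0/mem_nth.
Qed.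

Lemma alpha_nincr A i j : (i <= j)%N -> alpha A j <= alpha A i.
Proof.
move=> ij; have [s_sorted _ _] := singular_valuesP A.
have [jsz|jsz] := ltnP j (size (singular_values A)); last first.
  by rewrite /alpha nth_default// alpha_ge0.
rewrite /alpha; apply: (sorted_leq_nth _ _ _ s_sorted) => //.
- by move=> x y z /= yx zx; exact: le_trans zx yx.
- by move=> x /=.
- exact: leq_ltn_trans ij jsz.
Qed.

(** [alpha] comes from A^T A, whereas lengths of row vectors [v *m A] are governed by A A^T; for
    invertible [A] the two are conjugate and have the same characteristic polynomial. Equal products
    of linear factors yield a permutation of the eigenvalues, by which the rows of [P] are put in
    decreasing order. *)
Lemma svd A : A \in unitmx -> exists2 P, P *m P^T = 1%:M &
  A *m A^T = P^T *m diag_mx (\row_(i < d) alpha A i ^+ 2) *m P.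
Proof.
move=> Au.
have [P [D [PP E]]] : exists P (D : 'rV[R]_d), P *m P^T = 1%:M /\
    A *m A^T = P^T *m diag_mx D *m P.
  by apply: real_spectral; rewrite trmx_mul trmxK.
have [_ _ a_char] := singular_valuesP A.
have cpE : char_poly (A^T *m A) = char_poly (A *m A^T).
  rewrite -(char_poly_conj (A *m A^T) (mulVmx Au)).
  by rewrite -!mulmxA mulKmx.
have : perm_eq [tuple D 0 i | i < d] [tuple alpha A i ^+ 2 | i < d].
  apply: prod_XsubC_eq; rewrite !big_tuple.
  transitivity (char_poly (A^T *m A)).
    rewrite cpE E (char_poly_orthogonal D PP).
    by apply: eq_bigr => i _; rewrite tnth_mktuple.
  rewrite a_char (big_nth 0) size_singular_values big_mkord.
  by apply: eq_bigr => i _; rewrite tnth_mktuple.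
case/tuple_permP => p DE.
have {}DE i : alpha A (p i) ^+ 2 = D 0 i.
  by have /val_inj/(congr1 (fun t => tnth t i)) := DE; rewrite !tnth_mktuple.
exists (\matrix_(i, j) P ((p^-1)%g i) j).
  apply/matrixP => i j; rewrite mxE.
  have /matrixP/(_ ((p^-1)%g i) ((p^-1)%g j)) := PP.
  rewrite !mxE (inj_eq perm_inj) => <-.
  by apply: eq_bigr => k _; rewrite !mxE.
rewrite E; apply/matrixP => i j; rewrite !mxE [RHS](reindex_perm p)/=.
apply: eq_bigr => k _; rewrite !mul_mx_diag !mxE permK DE.
by congr (_ * _).
Qed.


(** For [k <= d] this is the norm of [A] on the k-th exterior power. *)
Definition alpha_prod A k := \prod_(i < k) alpha A i.

Lemma alpha_prod_ge0 A k : 0 <= alpha_prod A k.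
Proof. by apply: prodr_ge0 => i _; exact: alpha_ge0. Qed.

(** The Gram determinant of [V] is the squared k-volume spanned by its rows; rotating by [P] reduces
    the claim to a diagonal matrix. *)
Lemma gram_le A k (V : 'M[R]_(k, d)) : A \in unitmx ->
  \det (V *m (A *m A^T) *m V^T) <= alpha_prod A k ^+ 2 * \det (V *m V^T).
Proof.
move=> /svd[P PP ->].
have := @det_gram_le R k d (V *m P^T) (fun i => alpha A i ^+ 2)
  (fun i => sqr_ge0 _).
rewrite prodrXl -/(alpha_prod A k) trmx_mul trmxK !mulmxA.
rewrite -(mulmxA V P^T P) (mulmx1C PP) mulmx1; apply => i j ij.
by rewrite ler_pXn2r ?nnegrE ?alpha_ge0// alpha_nincr.
Qed.

Lemma gram_attained A k : A \in unitmx -> (k <= d)%N ->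
  exists2 V : 'M[R]_(k, d), V *m V^T = 1%:M &
    \det (V *m (A *m A^T) *m V^T) = alpha_prod A k ^+ 2.
Proof.
move=> /svd[P PP ->] kd.
pose V : 'M[R]_(k, d) := \matrix_(i, j) P (widen_ord kd i) j.
have wi : injective (widen_ord kd) by move=> i j /(congr1 val) /= /val_inj.
have VP : V *m P^T = \matrix_(i, j) (widen_ord kd i == j)%:R.
  apply/matrixP => i j; move/matrixP: PP => /(_ (widen_ord kd i) j).
  by rewrite !mxE => <-; apply: eq_bigr => x _; rewrite !mxE.
have PV : P *m V^T = (V *m P^T)^T by rewrite trmx_mul trmxK.
exists V.
  apply/matrixP => i j; move/matrixP: PP => /(_ (widen_ord kd i) (widen_ord kd j)).
  rewrite !mxE (inj_eq wi) => <-.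
  by apply: eq_bigr => x _; rewrite !mxE.
rewrite !mulmxA -mulmxA PV VP.
have -> : (\matrix_(i < k, j < d) (widen_ord kd i == j)%:R) *m
    diag_mx (\row_(i < d) alpha A i ^+ 2) *m
    (\matrix_(i < k, j < d) (widen_ord kd i == j)%:R)^T =
    diag_mx (\row_(i < k) alpha A i ^+ 2) :> 'M[R]_k.
  apply/matrixP => i j; rewrite mxE (bigD1 (widen_ord kd i))//= big1 ?addr0.
    rewrite mul_mx_diag !mxE eqxx mul1r (inj_eq wi).
    by rewrite eq_sym; case: eqP => [->|]; rewrite ?mulr1 ?mulr0.
  by move=> x /negbTE xi; rewrite mul_mx_diag !mxE eq_sym xi !mul0r.
by rewrite det_diag /alpha_prod -prodrXl; apply: eq_bigr => i _; rewrite mxE.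
Qed.

(* Horn's inequality: alpha_prod A k is the largest factor by which A scales
   k-dimensional volumes. *)
Lemma alpha_prodM A B k : A \in unitmx -> B \in unitmx -> (k <= d)%N ->
  alpha_prod (A *m B) k <= alpha_prod A k * alpha_prod B k.
Proof.
move=> Au Bu kd.
have [|V VV VE] := @gram_attained (A *m B) k _ kd; first by rewrite unitmx_mul Au.
rewrite -(@ler_pXn2r _ 2)// ?nnegrE ?mulr_ge0 ?alpha_prod_ge0// -VE.
have -> : V *m (A *m B *m (A *m B)^T) *m V^T =
   (V *m A) *m (B *m B^T) *m (V *m A)^T by rewrite !trmx_mul !mulmxA.
apply: (le_trans (gram_le _ Bu)).
rewrite exprMn [leRHS]mulrC ler_wpM2l ?sqr_ge0//.
have := gram_le V Au; rewrite VV det1 mulr1.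
by rewrite trmx_mul !mulmxA.
Qed.

Lemma alpha_prod_full A : A \in unitmx -> alpha_prod A d = `|\det A|.
Proof.
move=> Au; have [P PP E] := svd Au.
apply/eqP; rewrite -(@eqrXn2 _ 2)// ?alpha_prod_ge0//.
rewrite real_normK ?num_real// [eqbRHS]expr2 -[X in _ == _ * X]det_tr.
rewrite -det_mulmx E !det_mulmx.
rewrite mulrAC -det_mulmx (mulmx1C PP) det1 mul1r det_diag -prodrXl.
by apply/eqP; apply: eq_bigr => i _; rewrite mxE.
Qed.

Lemma alpha_attained A (i : 'I_d) : A \in unitmx ->
  exists2 v : 'rV[R]_d, enorm v = 1 & enorm (v *m A) = alpha A i.
Proof.
move=> Au; have [P PP E] := svd Au; exists (row i P).
  apply/eqP; rewrite -(@eqrXn2 _ 2)// ?enorm_ge0// enorm_sqrE expr1n.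
  by rewrite tr_row; move/matrixP: PP => /(_ i i); rewrite !mxE eqxx mulr1n => <-;
    apply/eqP/eq_bigr => j _; rewrite !mxE.
apply/eqP; rewrite -(@eqrXn2 _ 2)// ?enorm_ge0 ?alpha_ge0//.
by rewrite -(spectral_psd PP E) mxE.
Qed.

Lemma enorm_mulmx_svd A P v : P *m P^T = 1%:M ->
  A *m A^T = P^T *m diag_mx (\row_(i < d) alpha A i ^+ 2) *m P ->
  enorm (v *m A) ^+ 2 = \sum_(i < d) (alpha A i * (v *m P^T) 0 i) ^+ 2.
Proof.
move=> PP E; rewrite enorm_sqrE trmx_mul !mulmxA -(mulmxA v) E !mulmxA.
have wT : P *m v^T = (v *m P^T)^T by rewrite trmx_mul trmxK.
rewrite -[_ *m P *m v^T]mulmxA wT.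
move: (v *m P^T) => w.
by rewrite mxE; apply: eq_bigr => i _; rewrite mul_mx_diag !mxE; ring.
Qed.

End singular_values.

(** * Covering the linear image of a small set *)

Section linear_cover.
Variables (R : realType) (d : nat).
Implicit Types (A P : 'M[R]_d).

Lemma alpha_ge A b (i : 'I_d) : A \in unitmx ->
  (forall v : 'rV[R]_d, b * enorm v <= enorm (v *m A)) -> b <= alpha A i.
Proof.
move=> Au bA; have [v v1 vA] := alpha_attained i Au.
by have := bA v; rewrite v1 vA mulr1.
Qed.

Lemma alpha_le A c (i : 'I_d) : A \in unitmx ->
  (forall v : 'rV[R]_d, enorm (v *m A) <= c * enorm v) -> alpha A i <= c.
Proof.
move=> Au Ac; have [v v1 vA] := alpha_attained i Au.
by have := Ac v; rewrite v1 vA mulr1.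
Qed.

Lemma alpha_gt0 A (i : 'I_d) : A \in unitmx -> 0 < alpha A i.
Proof.
move=> Au; have [v v1 vA] := alpha_attained i Au.
rewrite lt_neqAle alpha_ge0 andbT eq_sym -vA.
apply/eqP => /enorm_eq0 /(congr1 (fun w => w *m invmx A)).
rewrite mulmxK// mul0mx => v0.
by move: v1; rewrite v0 enorm0 => /esym/eqP; rewrite oner_eq0.
Qed.

Lemma truncn_eq_dist (a b : R) : 0 <= a -> 0 <= b ->
  Num.truncn a = Num.truncn b -> `|a - b| <= 1.
Proof.
move=> /truncn_itv /andP[a1 a2] /truncn_itv /andP[b1 b2] ab.
rewrite ab -natr1 in a1 a2; rewrite -natr1 in b2.
by rewrite ler_norml; apply/andP; split; lra.
Qed.

(* Cut the coordinates along the right singular directions i < k into pieces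
   of length alpha_k r / alpha_i, and leave the other coordinates uncut. *)
Lemma linear_cover A (k : 'I_d) (r : R) (S : set 'rV[R]_d) :
  A \in unitmx -> 0 < r ->
  (forall x y, S x -> S y -> enorm (x - y) <= r) ->
  exists (L : finType) (kappa : 'rV[R]_d -> L),
    #|L|%:R <= 4 ^+ d * alpha_prod A k / alpha A k ^+ k /\
    forall x y, S x -> S y -> kappa x = kappa y ->
      enorm ((x - y) *m A) <= d%:R * alpha A k * r.
Proof.
move=> Au r0 Sr.
have [P PP E] := svd Au.
have P'P : P^T *m P^T^T = 1%:M by rewrite trmxK mulmx1C.
(* A base point for the coordinates. For empty [S] it is a dummy, and [Sp] is only ever applied to a
   point of [S]. *)
have [p Sp] : exists p, S !=set0 -> S p.
  by have [[q Sq]|S0] := pselect (S !=set0); [exists q | exists 0].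
have ak : 0 < alpha A k := alpha_gt0 k Au.
have kd (i : 'I_k) : (i < d)%N := ltn_trans (ltn_ord i) (ltn_ord k).
have ai (i : 'I_k) : alpha A k <= alpha A i by rewrite alpha_nincr// ltnW.
have ai0 (i : 'I_k) : 0 < alpha A i := lt_le_trans ak (ai i).
pose q (i : 'I_k) : R := alpha A i / alpha A k.
have q1 i : 1 <= q i by rewrite /q ler_pdivlMr// mul1r.
(* Coordinates relative to [p] lie in [-r, r]; shifted and rescaled they lie in [0, 2 q], and a unit
   step there is a piece of length r / q. The number of pieces is at most 2 q + 1 <= 4 q because q
   >= 1. *)
pose n (i : 'I_k) := Num.truncn (2 * q i).
pose co (x : 'rV[R]_d) (i : 'I_k) : R :=
  (((x - p) *m P^T) 0 (Ordinal (kd i)) + r) / r * q i.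
pose kappa (x : 'rV[R]_d) : {dffun forall i : 'I_k, 'I_(n i).+1} :=
  [ffun i => inord (Num.truncn (co x i))].
exists {dffun forall i : 'I_k, 'I_(n i).+1}, kappa; split.
  rewrite card_dep_ffun.
  have -> : foldr muln 1%N [seq #|'I_(n x).+1| | x : 'I_k] = (\prod_(i < k) (n i).+1)%N.
    rewrite -[RHS]big_enum/= /image_mem.
    elim: (enum _) => [|x s IH] /=; first by rewrite big_nil.
    by rewrite big_cons IH card_ord.
  rewrite natr_prod -mulrA.
  have -> : alpha_prod A k / alpha A k ^+ k = \prod_(i < k) q i.
    rewrite big_split/= prodr_const card_ord exprVn.
    by [].
  apply: (@le_trans _ _ (\prod_(i < k) (4 * q i))).
    apply: ler_prod => i _; rewrite ler0n/= -natr1.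
    have /truncn_itv/andP[+ _] : 0 <= 2 * q i by have := q1 i; lra.
    by rewrite -/(n i); have := q1 i; lra.
  rewrite big_split/= prodr_const card_ord ler_wpM2r//.
    by apply: prodr_ge0 => i _; exact: le_trans (q1 i).
  by rewrite ler_eXn2l ?ltr1n// ltnW.
have coP x i : S x -> 0 <= co x i <= 2 * q i.
  move=> Sx; have := coord_enorm ((x - p) *m P^T) (Ordinal (kd i)).
  rewrite (enorm_orthogonal _ P'P) => /le_trans /(_ (Sr _ _ Sx (Sp (ex_intro _ x Sx)))).
  rewrite ler_norml => /andP[h1 h2]; have qi0 := lt_le_trans ltr01 (q1 i).
  rewrite /co mulr_ge0/=; [|by apply: divr_ge0; lra|exact: ltW].
  by rewrite ler_pM2r// ler_pdivrMr//; lra.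
move=> x y Sx Sy /(congr1 (fun f : {dffun forall i : 'I_k, 'I_(n i).+1} => fun i => f i)) kxy.
have cod i : `|co x i - co y i| <= 1.
  have := congr1 (fun f : forall i : 'I_k, 'I_(n i).+1 => val (f i)) kxy.
  rewrite /= !ffunE.
  have /andP[x0 x1] := coP x i Sx; have /andP[y0 y1] := coP y i Sy.
  rewrite !inordK ?ltnS ?le_truncn//.
  exact: truncn_eq_dist.
pose w := (x - y) *m P^T.
have wE j : w 0 j = ((x - p) *m P^T) 0 j - ((y - p) *m P^T) 0 j.
  have -> : w = (x - p) *m P^T - (y - p) *m P^T.
    by rewrite -mulmxBl; congr (_ *m _); rewrite opprB addrA subrK.
  by rewrite [in LHS]mxE [X in _ + X = _]mxE.
have wr (j : 'I_d) : alpha A j * `|w 0 j| <= alpha A k * r.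
  have [jk|kj] := ltnP j k; last first.
    rewrite ler_pM ?alpha_ge0// ?alpha_nincr//.
    apply: (le_trans (coord_enorm _ _)).
    by rewrite /w enorm_orthogonal// Sr.
  have := cod (Ordinal jk).
  have -> : co x (Ordinal jk) - co y (Ordinal jk) = w 0 j * (alpha A j / (alpha A k * r)).
    rewrite wE /co /q /=; have -> : Ordinal (kd (Ordinal jk)) = j by apply/val_inj.
    by field; rewrite !gt_eqF.
  rewrite normrM [X in _ * X]ger0_norm; last first.
    by rewrite divr_ge0 ?alpha_ge0// mulr_ge0// ltW.
  by rewrite mulrA ler_pdivrMr ?mulr_gt0// mul1r mulrC.
rewrite -(@ler_pXn2r _ 2)// ?nnegrE ?enorm_ge0//; last first.
  by rewrite !mulr_ge0// ltW.
(* The d coordinates, each at most [alpha A k * r], give a factor sqrt d, which is weakened to d. *)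
rewrite (enorm_mulmx_svd _ PP E) -/w.
apply: (@le_trans _ _ (\sum_(i < d) (alpha A k * r) ^+ 2)).
  apply: ler_sum => i _; rewrite -(real_normK (num_real (_ * _))).
  rewrite ler_pXn2r ?nnegrE ?normr_ge0//; last by rewrite mulr_ge0 ?ltW.
  by rewrite normrM ger0_norm ?alpha_ge0.
rewrite sumr_const card_ord -mulrA; move: (_ * r) => t.
rewrite exprMn -[leLHS]mulr_natl ler_wpM2r ?sqr_ge0//.
by rewrite -natrX ler_nat expnS expn1 leq_pmulr// (leq_ltn_trans _ (ltn_ord k)).
Qed.

End linear_cover.

(** * The logarithm of the singular value function as a weighted sum *)

Ltac minmax_cases := repeat match goal with
  | |- context [@Order.max _ _ ?a ?b] => case: (lerP a b) => ?
  | |- context [@Order.min _ _ ?a ?b] => case: (lerP a b) => ?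
  end.

Section weights.
Variable R : realType.

(* The exponent of alpha_(i+1) in the singular value function phi^s. *)
Definition svweight (d : nat) (s : R) (i : nat) : R :=
  Num.min 1 (Num.max 0 (s - i%:R)) + Num.max 0 (s - d%:R) / d%:R.

(** The first summands telescope to min(s, d), the second ones add the excess over d. That the total
    weight is s turns a uniform negative bound on the exponents into linear decay in s. *)
Lemma svweight_sum d s : (0 < d)%N -> 0 <= s ->
  \sum_(i < d) svweight d s i = s.
Proof.
move=> d0 s0; rewrite big_split/= sumr_const card_ord.
have -> : (Num.max 0 (s - d%:R) / d%:R) *+ d = Num.max 0 (s - d%:R).
  by rewrite -mulr_natr divfK// pnatr_eq0 -lt0n.
have -> n : \sum_(i < n) Num.min 1 (Num.max 0 (s - i%:R)) = Num.min s n%:R.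
  elim: n => [|n IH]; first by rewrite big_ord0 min_r.
  rewrite big_ord_recr/= IH -natr1; move: n%:R (ler0n R n) => t t0.
  by minmax_cases; lra.
by move: d%:R (ler0n R d) => t t0; minmax_cases; lra.
Qed.

Lemma svweight_ge0 d s i : 0 <= svweight d s i.
Proof. by rewrite addr_ge0 ?divr_ge0// ?le_min ?le_max ?lexx ?ler01. Qed.

Lemma svweight_nd d s t i : s <= t -> svweight d s i <= svweight d t i.
Proof.
move=> st; apply: lerD; last first.
  rewrite ler_wpM2r ?invr_ge0//.
  by minmax_cases; lra.
by minmax_cases; lra.
Qed.

Lemma svweight_gt d s i : s < d%:R -> 
  svweight d s i = Num.min 1 (Num.max 0 (s - i%:R)).
Proof.
by move=> sd; rewrite /svweight [X in _ + X / _]max_l ?mul0r ?addr0// subr_le0 ltW.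
Qed.

Lemma svweight_full d s i : (i < d)%N -> d%:R <= s -> svweight d s i = s / d%:R.
Proof.
move=> id ds; rewrite /svweight [X in _ + X / _]max_r ?subr_ge0//.
have i1d : i%:R + 1 <= d%:R :> R by rewrite natr1 ler_nat.
rewrite max_r; last lra.
rewrite min_l; last lra.
by field; rewrite pnatr_eq0 -lt0n (leq_trans _ id).
Qed.

Lemma continuous_svweight d i : continuous (fun s : R => svweight d s i).
Proof.
move=> s; rewrite /svweight; apply: cvgD.
  apply: (@continuous_min R R (fun=> 1) (fun s => Num.max 0 (s - i%:R))).
    exact: cvg_cst.
  apply: (@continuous_max R R (fun=> 0) (fun s => s - i%:R)).
    exact: cvg_cst.
  by apply: cvgB; [exact: cvg_id|exact: cvg_cst].
apply: cvgM; last exact: cvg_cst.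
apply: (@continuous_max R R (fun=> 0) (fun s => s - d%:R)).
  exact: cvg_cst.
by apply: cvgB; [exact: cvg_id|exact: cvg_cst].
Qed.

Lemma ln_prod n (a : nat -> R) : (forall i, (i < n)%N -> 0 < a i) ->
  ln (\prod_(i < n) a i) = \sum_(i < n) ln (a i).
Proof.
elim: n => [_|n IH a0]; first by rewrite !big_ord0 ln1.
have p0 : 0 < \prod_(i < n) a i by apply: prodr_gt0 => i _; exact/a0/leqW/ltn_ord.
rewrite !big_ord_recr/= lnM ?posrE//; last exact: a0.
by rewrite IH// => i /ltnW; exact: a0.
Qed.

End weights.

Section log_singular_value_fun.
Variables (R : realType) (d : nat) (A : 'M[R]_d).
Hypotheses (d0 : (0 < d)%N) (Au : A \in unitmx).

Lemma sum_svweight_lt (s : R) (k : nat) (b : nat -> R) : (k < d)%N ->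
  k%:R <= s < k.+1%:R ->
  \sum_(i < d) svweight d s i * b i = \sum_(i < k) b i + (s - k%:R) * b k.
Proof.
move=> kd /andP[ks sk].
have sd : s < d%:R by apply: (lt_le_trans sk); rewrite ler_nat.
under eq_bigr do rewrite svweight_gt//.
rewrite -(subnKC kd) big_split_ord/= addrC big1 ?add0r; last first.
  move=> i _; rewrite max_l ?min_r ?ler01 ?mul0r//.
  by rewrite subr_le0 (le_trans (ltW sk))// ler_nat leq_addr.
rewrite big_ord_recr/=; congr (_ + _ * _).
  apply: eq_bigr => i _.
  have ik : i%:R + 1 <= k%:R :> R by rewrite natr1 ler_nat.
  by rewrite min_l ?mul1r// le_max; apply/orP; right; lra.
rewrite -natr1 in sk.
by rewrite max_r ?subr_ge0// min_r//; lra.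
Qed.

Lemma ln_singular_value_fun s : 0 <= s ->
  ln (singular_value_fun s A) = \sum_(i < d) svweight d s i * ln (alpha A i).
Proof.
move=> s0; have /andP[ks sk] := truncn_itv s0.
rewrite /singular_value_fun; set k := Num.truncn s in ks sk *.
have a0 i : (i < d)%N -> 0 < alpha A i by move=> id; exact: (alpha_gt0 (Ordinal id)).
have lnprod n : (n <= d)%N -> ln (alpha_prod A n) = \sum_(i < n) ln (alpha A i).
  by move=> nd; apply: ln_prod => i ni; apply: a0; exact: leq_trans nd.
have full : d%:R <= s -> \sum_(i < d) svweight d s i * ln (alpha A i) =
    s / d%:R * ln (alpha_prod A d).
  move=> ds; rewrite lnprod// mulr_sumr; apply: eq_bigr => i _.
  by rewrite svweight_full.
case: ifPn => [sd|]; last first.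
  by rewrite -ltNge => /ltW sd; rewrite ln_powR -alpha_prod_full// full.
have [kd|dk] := ltnP k d.
  rewrite (@sum_svweight_lt s k (fun i => ln (alpha A i)))//; last by rewrite ks.
  have pk : 0 < alpha_prod A k.
    by apply: prodr_gt0 => i _; exact/a0/(ltn_trans (ltn_ord i) kd).
  rewrite -/(alpha_prod A k) lnM ?posrE ?powR_gt0 ?a0// ln_powR lnprod//.
  exact: ltnW.
(* The boundary case [s = d]: there [alpha A d] is the default 0 of [nth], raised to the power 0,
   which gives 1. *)
have ds : d%:R <= s by apply: le_trans ks; rewrite ler_nat.
have {sd ds} sE : s = d%:R by apply/eqP; rewrite eq_le sd.
have kE : k = d.
  by rewrite /k sE; apply: truncn_def; rewrite lexx ltr_nat ltnSn.
rewrite full ?sE// kE subrr powRr0 mulr1 divff ?mul1r//.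
by rewrite pnatr_eq0 -lt0n.
Qed.

(** Up to constants the left side is the logarithm of the number of pieces times the t-th power of
    their size. For [t < d] there is equality. For [t >= d] one takes k = d - 1, and the difference
    is (t / d - 1) times the sum over i < k of ln alpha_i - ln alpha_k, which is non-negative. *)
Lemma cover_exponent_le (t : R) (k : nat) : 0 <= t ->
  k = minn (Num.truncn t) d.-1 ->
  ln (alpha_prod A k) + (t - k%:R) * ln (alpha A k) <=
  \sum_(i < d) svweight d t i * ln (alpha A i).
Proof.
move=> t0 kE.
have a0 i : (i < d)%N -> 0 < alpha A i by move=> id; exact: (alpha_gt0 (Ordinal id)).
have kd : (k < d)%N by rewrite kE gtn_min orbC prednK// leqnn.
have -> : ln (alpha_prod A k) = \sum_(i < k) ln (alpha A i).
  by apply: ln_prod => i ik; rewrite a0// (ltn_trans ik).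
have [td|dt] := ltrP t d%:R.
  have kt : k = Num.truncn t.
    rewrite kE; apply/minn_idPl; rewrite -ltnS prednK//.
    by rewrite truncn_lt_nat.
  rewrite (@sum_svweight_lt t k (fun i => ln (alpha A i)))//.
  by rewrite kt; exact: truncn_itv.
have {}kE : k.+1 = d.
  rewrite kE (minn_idPr _) ?prednK// (leq_trans (leq_pred _))//.
  by rewrite truncn_ge_nat.
have -> : \sum_(i < d) svweight d t i * ln (alpha A i) =
   t / d%:R * \sum_(i < k.+1) ln (alpha A i).
  rewrite kE mulr_sumr; apply: eq_bigr => i _.
  by rewrite svweight_full.
rewrite big_ord_recr/=; set q := ln (alpha A k); set S := \sum_(i < k) _.
have qS : k%:R * q <= S.
  rewrite mulr_natl -[k in leLHS]card_ord -sumr_const; apply: ler_sum => i _.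
  have id : (i < d)%N := ltn_trans (ltn_ord i) kd.
  by rewrite ler_ln ?posrE ?a0// alpha_nincr// ltnW.
have dE : d%:R = k%:R + 1 :> R by rewrite natr1 kE.
have d1 : 0 < d%:R :> R by rewrite ltr0n.
have u1 : 1 <= t / d%:R by rewrite ler_pdivlMr// mul1r.
have tE : t = t / d%:R * (k%:R + 1) by rewrite -dE divfK// gt_eqF.
move: (t / d%:R) u1 tE => u u1 ->.
have H : 0 <= (u - 1) * (S - k%:R * q) by rewrite mulr_ge0 ?subr_ge0.
rewrite -subr_ge0; apply: (le_trans H); rewrite le_eqVlt; apply/orP; left.
by apply/eqP; ring.
Qed.

End log_singular_value_fun.

(** * Strict differentiability *)

Section strict_differentiability.
Variables (R : realType) (d : nat).
Implicit Types (A B : 'M[R]_d) (f g : 'rV[R]_d -> 'rV[R]_d) (x y v : 'rV[R]_d).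

Lemma nbhs_enormP y (P : set 'rV[R]_d) :
  nbhs y P <-> exists2 e, 0 < e & forall p, enorm (p - y) <= e -> P p.
Proof.
split=> [/nbhs_ballP[e /= e0 eP]|[e e0 eP]].
  exists (e / 2); first by rewrite divr_gt0.
  move=> p pe; apply: eP; rewrite -ball_normE/= distrC.
  apply: (le_lt_trans (norm_le_enorm _)); apply: (le_lt_trans pe).
  by rewrite ltr_pdivrMr// mulr2n mulrDr mulr1 ltrDl.
apply/nbhs_ballP; exists (e / d.+1%:R); first by rewrite /= divr_gt0.
move=> p; rewrite -ball_normE/= distrC => pe; apply: eP.
apply: (le_trans (enorm_le_norm _)).
apply: (@le_trans _ _ (d.+1%:R * (e / d.+1%:R))); last by rewrite mulrC divfK.
by rewrite ler_pM// ?ler_nat// ltW.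
Qed.

Definition mxbound A : R := d%:R * \sum_(i < d) \sum_(j < d) `|A i j|.

Lemma enorm_mulmx_le A v : enorm (v *m A) <= mxbound A * enorm v.
Proof.
apply: (le_trans (enorm_le_norm _)); rewrite -mulrA ler_wpM2l//.
rewrite [leLHS]/Num.norm/= mx_normrE; apply/bigmax_leP; split.
  by rewrite mulr_ge0 ?enorm_ge0// sumr_ge0// => i _; exact: sumr_ge0.
move=> [i j] _ /=; rewrite ord1 mxE; apply: (le_trans (ler_norm_sum _ _ _)).
rewrite mulr_suml; apply: ler_sum => k _; rewrite normrM mulrC.
apply: ler_pM => //; last exact: coord_enorm.
by rewrite (bigD1 j)//= lerDl sumr_ge0.
Qed.

Lemma mxbound_ge0 A : 0 <= mxbound A.
Proof. by rewrite mulr_ge0// sumr_ge0// => i _; exact: sumr_ge0. Qed.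

(** Strict differentiability: both points move, which is what comparing the images of two points of
    a small set requires. The notion is stable under composition and becomes uniform on compact
    sets. *)
Definition sdiff f y A := forall e, 0 < e -> exists2 r, 0 < r &
  forall p q, enorm (p - y) <= r -> enorm (q - y) <= r ->
    enorm (f p - f q - (p - q) *m A) <= e * enorm (p - q).

Lemma sdiff_lipschitz f y A : sdiff f y A -> exists2 r, 0 < r &
  forall p q, enorm (p - y) <= r -> enorm (q - y) <= r ->
    enorm (f p - f q) <= (mxbound A + 1) * enorm (p - q).
Proof.
move=> /(_ 1 ltr01)[r r0 fr]; exists r => // p q py qy.
rewrite -(subrK ((p - q) *m A) (f p - f q)); apply: (le_trans (enormD _ _)).
by rewrite mulrDl addrC lerD ?enorm_mulmx_le// (fr p q).
Qed.

Lemma sdiff_comp f g y A B : sdiff g y A -> sdiff f (g y) B ->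
  sdiff (f \o g) y (A *m B).
Proof.
move=> gA fB e e0; have [r1 r10 gL] := sdiff_lipschitz gA.
set L := mxbound A + 1 in gL; set K := mxbound B + 1.
have L0 : 0 < L by rewrite ltr_wpDl// mxbound_ge0.
have K0 : 0 < K by rewrite ltr_wpDl// mxbound_ge0.
(* The error of [f] is enlarged by the Lipschitz bound [L] of [g], the error of [g] by the bound [K]
   for [B]; each may use half of [e]. *)
have [r2 r20 fr] := fB (e / 2 / L) (divr_gt0 (divr_gt0 e0 (ltr0Sn _ 1)) L0).
have [r3 r30 gr] := gA (e / 2 / K) (divr_gt0 (divr_gt0 e0 (ltr0Sn _ 1)) K0).
exists (Num.min (Num.min r1 (r2 / L)) r3).
  by rewrite !lt_min r10 r30 divr_gt0.
have gy p : enorm (p - y) <= r1 -> enorm (p - y) <= r2 / L -> enorm (g p - g y) <= r2.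
  move=> p1 p2; apply: (le_trans (gL p y p1 _)); first by rewrite subrr enorm0 ltW.
  by rewrite mulrC -ler_pdivlMr.
move=> p q; rewrite !le_min => /andP[/andP[p1 p2] p3] /andP[/andP[q1 q2] q3].
rewrite (_ : _ - _ - _ = ((f \o g) p - (f \o g) q - (g p - g q) *m B) +
  (g p - g q - (p - q) *m A) *m B); last first.
  by rewrite [X in _ = _ + X]mulmxBl mulmxA addrA subrK.
apply: (le_trans (enormD _ _)).
rewrite [e in leRHS]splitr mulrDl; apply: lerD.
  apply: (le_trans (fr _ _ (gy _ p1 p2) (gy _ q1 q2))).
  rewrite -mulrA ler_wpM2l ?divr_ge0 ?(ltW e0)//.
  by rewrite ler_pdivrMl// gL.
apply: (le_trans (enorm_mulmx_le _ _)).
apply: (@le_trans _ _ (K * (e / 2 / K * enorm (p - q)))).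
  by rewrite ler_pM ?mxbound_ge0 ?enorm_ge0 ?lerDl// gr.
by rewrite mulrA (mulrC K) divfK// gt_eqF.
Qed.

Lemma enorm_small_dir v r : 0 < r -> exists2 h, 0 < h & enorm (h *: v) <= r.
Proof.
move=> r0; have v1 : 0 < enorm v + 1 by rewrite ltr_wpDl// enorm_ge0.
exists (r / (enorm v + 1)); first by rewrite divr_gt0.
have K0 : 0 <= r / (enorm v + 1) by rewrite divr_ge0 ?ltW.
rewrite enormZ (ger0_norm K0) -[leRHS](divfK (lt0r_neq0 v1)).
by rewrite ler_wpM2l// lerDl.
Qed.

Lemma enorm_le_epsilon v : (forall e, 0 < e -> enorm v <= e) -> v = 0.
Proof.
move=> v0; apply: enorm_eq0; apply/eqP; rewrite eq_le enorm_ge0 andbT.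
by apply/ler_addgt0Pr => e e0; rewrite add0r v0.
Qed.

(** Homogeneity: test on [h *: v] with h so small that both approximations hold, then divide by h.
    This is how differentials at nearby points are compared. *)
Lemma linear_approx_dist f x A B e1 e2 r : 0 < r ->
  (forall p, enorm (p - x) <= r ->
    enorm (f p - f x - (p - x) *m A) <= e1 * enorm (p - x)) ->
  (forall p, enorm (p - x) <= r ->
    enorm (f p - f x - (p - x) *m B) <= e2 * enorm (p - x)) ->
  forall v, enorm (v *m (A - B)) <= (e1 + e2) * enorm v.
Proof.
move=> r0 fA fB v; have [h h0 hv] := enorm_small_dir v r0.
have hx : x + h *: v - x = h *: v by rewrite addrAC subrr add0r.
have := fA (x + h *: v); have := fB (x + h *: v); rewrite hx => /(_ hv) B1 /(_ hv) A1.
have : enorm (h *: (v *m (A - B))) <= (e1 + e2) * enorm (h *: v).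
  rewrite mulrDl; apply: le_trans (lerD A1 B1).
  rewrite -[X in _ <= X + _]enormN [leRHS]addrC.
  apply: le_trans (enormD _ _); rewrite le_eqVlt; apply/orP; left; apply/eqP.
  congr enorm; rewrite scalemxAl mulmxBr opprB.
  by rewrite [RHS]addrC addrA subrK.
by rewrite !enormZ mulrCA ler_pM2l// normr_gt0 gt_eqF.
Qed.

Lemma mulmx_eq0P A : (forall v, v *m A = 0) -> A = 0.
Proof. by move=> A0; apply/row_matrixP => i; rewrite rowE A0 row0. Qed.

Lemma sdiff_unique f y A B : sdiff f y A -> sdiff f y B -> A = B.
Proof.
move=> fA fB; apply/subr0_eq/mulmx_eq0P => v; apply: enorm_le_epsilon => e e0.
have v1 : 0 < enorm v + 1 by rewrite ltr_wpDl// enorm_ge0.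
pose e' := e / 2 / (enorm v + 1).
have e'0 : 0 < e' by rewrite !divr_gt0.
have [r1 r10 f1] := fA _ e'0; have [r2 r20 f2] := fB _ e'0.
have r0 : 0 < Num.min r1 r2 by rewrite lt_min r10.
have yy r : 0 < r -> enorm (y - y) <= r by rewrite subrr enorm0 => /ltW.
have := linear_approx_dist (f := f) (x := y) (A := A) (B := B) (e1 := e') (e2 := e') r0.
move=> /(_ _ _ v) /le_trans; apply.
- by move=> p; rewrite le_min => /andP[p1 _]; apply: f1 => //; exact: yy.
- by move=> p; rewrite le_min => /andP[_ p2]; apply: f2 => //; exact: yy.
have -> : e = (e' + e') * (enorm v + 1).
  by rewrite /e' -mulrDl -splitr divfK// gt_eqF.
by rewrite ler_wpM2l// ?lerDl// addr_ge0// ltW.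
Qed.

Lemma sdiff_eq f g y A r : 0 < r -> (forall p, enorm (p - y) <= r -> f p = g p) ->
  sdiff f y A -> sdiff g y A.
Proof.
move=> r0 fg fA e e0; have [r1 r10 f1] := fA e e0.
exists (Num.min r r1); first by rewrite lt_min r0.
move=> p q; rewrite !le_min => /andP[p1 p2] /andP[q1 q2].
by rewrite -!fg//; exact: f1.
Qed.

Lemma sdiff_id y : sdiff id y 1%:M.
Proof.
move=> e e0; exists 1 => // p q _ _.
by rewrite mulmx1 subrr enorm0 mulr_ge0 ?enorm_ge0// ltW.
Qed.

Lemma continuous_mulmxr A : continuous (fun v : 'rV[R]_d => v *m A).
Proof.
move=> x; apply/(@cvgrPdist_le _ _ _ (nbhs x)) => e e0.
have K0 : 0 < mxbound A + 1 by rewrite ltr_wpDl// mxbound_ge0.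
apply/nbhs_enormP; exists (e / (mxbound A + 1)); first by rewrite divr_gt0.
move=> p px; apply: (le_trans (norm_le_enorm _)).
rewrite /= -mulmxBl -enormN -mulNmx opprB; apply: (le_trans (enorm_mulmx_le _ _)).
rewrite ler_pdivlMr// in px; apply: le_trans px; rewrite mulrC.
by rewrite ler_wpM2l ?enorm_ge0// lerDl.
Qed.

Lemma sdiff_jacobian f y A : sdiff f y A -> jacobian f y = A.
Proof.
move=> fA; rewrite /jacobian.
have E : 'd f y = mulmxr A :> ('rV[R]_d -> 'rV[R]_d).
  apply: diff_unique.
    exact: continuous_mulmxr.
  apply/eqaddoP => e e0.
  have d1 : 0 < d.+1%:R :> R by [].
  have [r r0 fr] := fA (e / d.+1%:R) (divr_gt0 e0 d1).
  apply/nbhs_enormP; exists r => // p; rewrite subr0 => pr.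
  rewrite /= opprD addrA; apply: (le_trans (norm_le_enorm _)).
  have := fr (p + y) y; rewrite addrK subrr enorm0 => /(_ pr (ltW r0)) /le_trans; apply.
  rewrite -mulrA ler_pM2l// ler_pdivrMl//.
  by apply: (le_trans (enorm_le_norm _)); rewrite ler_wpM2r// ler_nat.
apply/row_matrixP => i; rewrite !rowE mul_rV_lin1.
by rewrite E.
Qed.

End strict_differentiability.

(** * Uniform estimates for C^1 maps on compact sets *)

Section C1_maps.
Variables (R : realType) (d : nat).
Implicit Types (A B : 'M[R]_d) (f g : 'rV[R]_d -> 'rV[R]_d) (x y v : 'rV[R]_d).

Lemma entry_norm A i j : `|A i j| <= `|A|.
Proof.
rewrite [leRHS]/Num.norm/= mx_normrE.
exact: (le_bigmax_cond (0:R) (fun ij : 'I_d * 'I_d => `|A ij.1 ij.2|) (j := (i, j))).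
Qed.

Lemma is_derive_coord_line f q v t (j : 'I_d) : differentiable f (q + t *: v) ->
  is_derive t 1 (fun s : R => (f (q + s *: v)) 0 j)
    ((v *m jacobian f (q + t *: v)) 0 j).
Proof.
move=> df; set a := q + t *: v; set D := v *m jacobian f a.
have fv : (fun h : R => h^-1 *: (f (h *: v + a) - f a)) @ 0^' --> D.
  have -> : D = 'D_v f a by rewrite deriveEjacobian.
  have /cvg_ex[/= l fl] := diff_derivable (v := v) df.
  by rewrite /derive (cvg_lim _ fl).
have cv : (fun h : R => h^-1 *: ((fun s : R => (f (q + s *: v)) 0 j) (h *: 1 + t) -
    (fun s : R => (f (q + s *: v)) 0 j) t)) @ 0^' --> D 0 j.
  have -> : (fun h : R => h^-1 *: ((fun s : R => (f (q + s *: v)) 0 j) (h *: 1 + t) -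
    (fun s : R => (f (q + s *: v)) 0 j) t)) =
    (fun M : 'rV[R]_d => M 0 j) \o (fun h : R => h^-1 *: (f (h *: v + a) - f a)).
    apply/funext => h /=; rewrite !mxE /a; congr (_ * (f _ _ _ - _)).
    by rewrite [h *: 1]mulr1 scalerDl addrCA.
  apply: cvg_comp fv _; exact: coord_continuous.
by apply: DeriveDef; [exact: cvgP cv | exact: cvg_lim cv].
Qed.

(** The mean value theorem for each coordinate along the segment from q to p, which stays in a ball
    where the Jacobian is close to its value at y. *)
Lemma C1_sdiff U f y : open U -> C1_on U f -> U y -> sdiff f y (jacobian f y).
Proof.
move=> oU fC Uy e e0; set A := jacobian f y.
have d10 : 0 < d.+1%:R :> R by [].
(* One division by [d.+1] pays for the sum over the entries of a column, the other for passing from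
   the maximum norm to the Euclidean norm. *)
pose e' := e / d.+1%:R / d.+1%:R.
have e'0 : 0 < e' by rewrite !divr_gt0.
have [_ Jc] := fC y Uy.
have : nbhs y (U `&` [set u | `|A - jacobian f u| <= e']).
  apply: filterI; first exact: open_nbhs_nbhs.
  by move/cvgrPdist_le : Jc; exact.
move=> /nbhs_enormP[r r0 rP]; exists r => // p q py qy.
set v := p - q.
have seg t : 0 <= t -> t <= 1 -> enorm (q + t *: v - y) <= r.
  move=> t0 t1; have -> : q + t *: v - y = t *: (p - y) + (1 - t) *: (q - y).
    by apply/rowP => i; rewrite !mxE; ring.
  apply: (le_trans (enormD _ _)); rewrite !enormZ !ger0_norm ?subr_ge0//.
  apply: (@le_trans _ _ (t * r + (1 - t) * r)); last by rewrite -mulrDl addrC subrK mul1r.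
  by rewrite lerD// ler_wpM2l// subr_ge0.
have coordP (j : 'I_d) : `|(f p - f q - v *m A) 0 j| <= e / d.+1%:R * enorm v.
  pose h (t : R) := (f (q + t *: v)) 0 j.
  have hd (t : R) : 0 <= t -> t <= 1 ->
      is_derive t 1 h ((v *m jacobian f (q + t *: v)) 0 j).
    move=> t0 t1; apply: is_derive_coord_line.
    by have [Ut _] := rP _ (seg t t0 t1); have [] := fC _ Ut.
  have [||t] := @MVT R h (fun t => (v *m jacobian f (q + t *: v)) 0 j) 0 1 ltr01.
  - by move=> t; rewrite in_itv/= => /andP[t0 t1]; apply: hd; exact: ltW.
  - apply: derivable_within_continuous => t; rewrite in_itv/= => /andP[t0 t1].
    exact: (@ex_derive _ _ _ _ _ _ _ (hd t t0 t1)).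
  rewrite in_itv/= subr0 mulr1 => /andP[t0 t1] hE.
  have -> : (f p - f q - v *m A) 0 j = (v *m (jacobian f (q + t *: v) - A)) 0 j.
    rewrite mulmxBr; have -> : f p = f (q + 1 *: v) by rewrite scale1r /v addrC subrK.
    have -> : f q = f (q + 0 *: v) by rewrite scale0r addr0.
    rewrite [LHS]mxE [RHS]mxE; congr (_ + _); rewrite -hE /h.
    by rewrite [LHS]mxE [X in _ + X]mxE.
  have [_ /= dA] := rP _ (seg t (ltW t0) (ltW t1)).
  rewrite mxE; apply: (le_trans (ler_norm_sum _ _ _)).
  apply: (@le_trans _ _ (\sum_(i < d) enorm v * e')).
    apply: ler_sum => i _; rewrite normrM ler_pM ?coord_enorm//.
    by rewrite distrC in dA; exact: le_trans (entry_norm _ _ _) dA.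
  rewrite sumr_const card_ord -[leLHS]mulr_natl mulrCA [leRHS]mulrC ler_wpM2l ?enorm_ge0//.
  apply: (@le_trans _ _ (d.+1%:R * e')); last by rewrite mulrC divfK.
  by rewrite ler_wpM2r ?ler_nat// ltW.
apply: (le_trans (enorm_le_norm _)).
apply: (@le_trans _ _ (d.+1%:R * (e / d.+1%:R * enorm v))); last first.
  by rewrite mulrA (mulrC d.+1%:R) divfK.
rewrite ler_pM ?ler_nat//.
rewrite [leLHS]/Num.norm/= mx_normrE; apply/bigmax_leP; split.
  by rewrite mulr_ge0 ?enorm_ge0// ltW// divr_gt0.
by move=> [i j] _ /=; rewrite ord1.
Qed.

(** Compactness in its near-covering form, along the filter of small positive r. In [sdiff_uniform]
    r is a radius, in [compact_lower_bound] it is the expansion constant. *)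
Lemma compact_radius (Z : set 'rV[R]_d) (P : R -> 'rV[R]_d -> Prop) :
  compact Z -> (forall r s y, 0 < r -> r <= s -> P s y -> P r y) ->
  (forall y, Z y -> exists2 r, 0 < r &
    forall y', enorm (y' - y) <= r -> Z y' -> P r y') ->
  exists2 r, 0 < r & forall y, Z y -> P r y.
Proof.
move=> /compact_near_coveringP /near_covering_withinP Zc Pmono ZP.
have : \forall r \near 0^'+, Z `<=` P r.
  apply: Zc => y /ZP[r r0 rP].
  exists ([set y' | enorm (y' - y) <= r], [set s | 0 < s /\ s <= r]).
    split => /=; first by apply/nbhs_enormP; exists r.
    near=> s; split; near: s; first exact: nbhs_right_gt.
    exact: nbhs_right_le.
  by move=> [y' s] /= [y'r [s0 sr]] /(rP _ y'r); exact: Pmono.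
move=> ZP'; have [r [r0 rZ]] : exists r, 0 < r /\ Z `<=` P r.
  apply: (@filter_ex _ (0 : R)^'+); apply: filterI ZP'; exact: nbhs_right_gt.
by exists r.
Unshelve. all: end_near. Qed.

Lemma sdiff_uniform (Z : set 'rV[R]_d) f (A : 'rV[R]_d -> 'M[R]_d) e :
  compact Z -> (forall y, Z y -> sdiff f y (A y)) -> 0 < e ->
  exists2 r, 0 < r & forall y, Z y ->
   forall p q, enorm (p - y) <= r -> enorm (q - y) <= r ->
    enorm (f p - f q - (p - q) *m A y) <= e * enorm (p - q).
Proof.
move=> Zc fA e0.
have e30 : 0 < e / 3 by rewrite divr_gt0.
apply: (@compact_radius Z (fun r y => forall p q,
   enorm (p - y) <= r -> enorm (q - y) <= r ->
    enorm (f p - f q - (p - q) *m A y) <= e * enorm (p - q)) Zc).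
  by move=> r s y _ rs sP p q pr qr; apply: sP; [exact: le_trans rs|exact: le_trans rs].
move=> y Zy; have [r r0 rP] := fA y Zy _ e30.
have r20 : 0 < r / 2 by rewrite divr_gt0.
exists (r / 2) => // y' y'r Zy'.
have near_y p : enorm (p - y') <= r / 2 -> enorm (p - y) <= r.
  move=> py'; rewrite -(subrK y' p) -addrA; apply: (le_trans (enormD _ _)).
  by rewrite [leRHS]splitr lerD.
(* Near y' both matrices approximate f, each up to e / 3, so they differ by at most 2 e / 3; the
   remaining third is the error of [A y] itself. *)
have AA : forall v, enorm (v *m (A y - A y')) <= (e / 3 + e / 3) * enorm v.
  have [s s0 sP] := fA y' Zy' _ e30.
  have t0 : 0 < Num.min (r / 2) s by rewrite lt_min r20.
  have y'0 : enorm (y' - y') <= r / 2 by rewrite subrr enorm0 ltW.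
  have y'1 : enorm (y' - y') <= s by rewrite subrr enorm0 ltW.
  apply: (linear_approx_dist (f := f) (x := y') t0) => p; rewrite le_min => /andP[p1 p2].
    by apply: rP; exact: near_y.
  exact: sP.
move=> p q py' qy'.
rewrite (_ : _ - _ - _ = (f p - f q - (p - q) *m A y) + (p - q) *m (A y - A y')); last first.
  by rewrite mulmxBr addrA subrK.
apply: (le_trans (enormD _ _)).
have -> : e * enorm (p - q) = e / 3 * enorm (p - q) + (e / 3 + e / 3) * enorm (p - q).
  by field.
by rewrite lerD ?AA// rP// near_y.
Qed.

Lemma enorm_invmx_ge A : A \in unitmx ->
  exists2 b, 0 < b & forall v, b * enorm v <= enorm (v *m A).
Proof.
move=> Au; pose K := mxbound (invmx A) + 1.
have K0 : 0 < K by rewrite ltr_wpDl// mxbound_ge0.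
exists K^-1; first by rewrite invr_gt0.
move=> v; rewrite ler_pdivrMl//.
rewrite -{1}(mulmxK Au v); apply: (le_trans (enorm_mulmx_le _ _)).
by rewrite ler_wpM2r ?enorm_ge0// lerDl.
Qed.

Lemma compact_lower_bound (Z : set 'rV[R]_d) f (A : 'rV[R]_d -> 'M[R]_d) :
  compact Z -> (forall y, Z y -> sdiff f y (A y)) ->
  (forall y, Z y -> A y \in unitmx) ->
  exists2 b, 0 < b & forall y, Z y -> forall v, b * enorm v <= enorm (v *m A y).
Proof.
move=> Zc fA Au.
apply: (@compact_radius Z (fun b y => forall v, b * enorm v <= enorm (v *m A y)) Zc).
  by move=> r s y _ rs sP v; apply: le_trans (sP v); rewrite ler_wpM2r ?enorm_ge0.
move=> y Zy; have [b b0 bP] := enorm_invmx_ge (Au y Zy).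
(* [A y] and [A y'] will differ by at most b / 2, which leaves the lower bound b / 2 >= b / 4 at
   y'. *)
have b40 : 0 < b / 4 by rewrite divr_gt0.
have [r r0 rP] := sdiff_uniform Zc fA b40.
exists (Num.min (r / 2) (b / 4)); first by rewrite lt_min b40 divr_gt0.
move=> y'; rewrite le_min => /andP[y'r _] Zy' v.
have AA : enorm (v *m (A y - A y')) <= (b / 4 + b / 4) * enorm v.
  have r20 : 0 < r / 2 by rewrite divr_gt0.
  apply: (linear_approx_dist (f := f) (x := y') r20) => p pr.
    apply: rP => //; last by apply: (le_trans y'r); rewrite ler_pdivrMr// ler_pMr// ler1n.
    rewrite -(subrK y' p) -addrA; apply: (le_trans (enormD _ _)).
    by rewrite [leRHS]splitr lerD.
  apply: rP => //; last by rewrite subrr enorm0 ltW.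
  by apply: (le_trans pr); rewrite ler_pdivrMr// ler_pMr// ler1n.
have := bP v; have := enormD (v *m A y') (v *m (A y - A y')).
rewrite mulmxBr addrC subrK -mulmxBr => h1 h2.
apply: (@le_trans _ _ (b / 4 * enorm v)).
  by rewrite ler_wpM2r ?enorm_ge0// ge_min lexx orbT.
have := mulr_ge0 (ltW b0) (enorm_ge0 v); lra.
Qed.

Lemma contracting_jacobian U f y c A : open U -> U y -> sdiff f y A ->
  (forall p q, U p -> U q -> enorm (f p - f q) <= c * enorm (p - q)) ->
  forall v, enorm (v *m A) <= c * enorm v.
Proof.
move=> oU Uy fA fc v.
have [s s0 sU] : exists2 r, 0 < r & forall p, enorm (p - y) <= r -> U p.
  by apply/nbhs_enormP; exact: open_nbhs_nbhs.
have v1 : 0 < enorm v + 1 by rewrite ltr_wpDl// enorm_ge0.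
apply/ler_addgt0Pr => e e0.
have ev0 : 0 < e / (enorm v + 1) by rewrite divr_gt0.
have [r r0 rP] := fA _ ev0.
have [h h0 hv] : exists2 h, 0 < h & enorm (h *: v) <= Num.min s r.
  by apply: enorm_small_dir; rewrite lt_min s0.
move: hv; rewrite le_min => /andP[hs hr].
have hy : y + h *: v - y = h *: v by rewrite addrAC subrr add0r.
have Uh : U (y + h *: v) by apply: sU; rewrite hy.
have := rP (y + h *: v) y; rewrite hy subrr enorm0 => /(_ hr (ltW r0)) h1.
have := fc _ _ Uh Uy; rewrite hy => h2.
have := enormD (- (f (y + h *: v) - f y - (h *: v) *m A)) (f (y + h *: v) - f y).
rewrite enormN opprB subrK => h3.
have : enorm ((h *: v) *m A) <= (e / (enorm v + 1) + c) * enorm (h *: v) by lra.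
rewrite -scalemxAl !enormZ mulrCA ler_pM2l ?normr_gt0 ?gt_eqF//.
move=> /le_trans; apply; rewrite mulrDl addrC lerD2l.
by rewrite mulrAC ler_pdivrMr// ler_pM2l// lerDl.
Qed.

End C1_maps.

(** * Words, coding and the cocycle of differentials *)

Section finite_bounds.
Variables (R : realType) (T : finType) (P : R -> T -> Prop).

Lemma finite_min : (forall r s t, 0 < r -> r <= s -> P s t -> P r t) ->
  (forall t, exists2 r, 0 < r & P r t) -> exists2 r, 0 < r & forall t, P r t.
Proof.
move=> Pmono PT.
have : \forall r \near 0^'+, forall t, P r t.
  apply: filter_forall => t; have [r r0 Prt] := PT t.
  near=> s; apply: Pmono Prt; near: s; first exact: nbhs_right_gt.
  exact: nbhs_right_le.
move=> PT'; have [r [r0 rP]] : exists r, 0 < r /\ forall t, P r t.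
  by apply: (@filter_ex _ (0 : R)^'+); apply: filterI PT'; exact: nbhs_right_gt.
by exists r.
Unshelve. all: end_near. Qed.

End finite_bounds.

Section words.
Variables (l : nat).
Implicit Types (x y : Sigma l).

Definition agree n x y := forall i, (i < n)%N -> x i = y i.

Lemma agree_le m n x y : (m <= n)%N -> agree n x y -> agree m x y.
Proof. by move=> mn xy i im; apply: xy; exact: leq_trans mn. Qed.

Lemma iter_shiftE n x i : iter n (@left_shift l) x i = x (n + i)%N.
Proof. by elim: n i => // n IH i; rewrite iterS /left_shift IH addnS. Qed.

Lemma agree_shift m n x y : agree (m + n) x y ->
  agree n (iter m (@left_shift l) x) (iter m (@left_shift l) y).
Proof. by move=> xy i im; rewrite !iter_shiftE xy// ltn_add2l. Qed.

Lemma mkseq_addn x n m :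
  mkseq x (n + m) = mkseq x n ++ mkseq (iter n (@left_shift l) x) m.
Proof.
rewrite /mkseq iotaD map_cat add0n; congr (_ ++ _).
rewrite -[n in iota n]addn0 iotaDl -map_comp; apply: eq_map => i /=.
by rewrite iter_shiftE.
Qed.

Lemma agree_mkseq n x y : agree n x y -> mkseq x n = mkseq y n.
Proof.
by move=> xy; apply/eq_in_map => i; rewrite mem_iota => /andP[_ ?]; exact: xy.
Qed.

End words.

Section IFS.
Variables (R : realType) (d l : nat) (Z U : set 'rV[R]_d).
Variable f : 'I_l.+1 -> 'rV[R]_d -> 'rV[R]_d.
Hypothesis hf : C1_IFS Z U f.
Variable z : 'rV[R]_d.
Hypothesis hz : U z.
Implicit Types (x y : Sigma l) (w : seq 'I_l.+1).
Local Notation sh := (@left_shift l).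

Let Zc : compact Z. Proof. by case: hf. Qed.
Let oU : open U. Proof. by case: hf. Qed.
Let ZU : Z `<=` U. Proof. by case: hf. Qed.

Definition fseq w : 'rV[R]_d -> 'rV[R]_d := foldr (fun i g => f i \o g) id w.

Lemma fseq_cat u w : fseq (u ++ w) = fseq u \o fseq w.
Proof. by elim: u => //= i u IH; rewrite -/(fseq _) IH. Qed.

Lemma fword_fseq x n : fword f x n = fseq (mkseq x n). Proof. by []. Qed.

Lemma fword_addn x n m p :
  fword f x (n + m) p = fword f x n (fword f (iter n sh x) m p).
Proof. by rewrite !fword_fseq mkseq_addn fseq_cat. Qed.

Lemma agree_fword n x y : agree n x y -> fword f x n = fword f y n.
Proof. by move=> /agree_mkseq; rewrite !fword_fseq => ->. Qed.

Lemma fseq_U w p : U p -> U (fseq w p).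
Proof.
elim: w => //= i w IH Up; have [_ _ _ _ /(_ i)[_ fU _ _]] := hf.
by apply: fU; exists (fseq w p) => //; exact: IH.
Qed.

Lemma fseq_Z w p : Z p -> Z (fseq w p).
Proof.
elim: w => //= i w IH Zp; have [_ _ _ _ /(_ i)[fZ _ _ _]] := hf.
by apply: fZ; exists (fseq w p) => //; exact: IH.
Qed.

Lemma contraction_ratio : exists c, [/\ 0 < c, c < 1 &
  forall w p q, U p -> U q ->
    enorm (fseq w p - fseq w q) <= c ^+ size w * enorm (p - q)].
Proof.
(* Ratios are written [1 - e], so that a common ratio comes from a minimum over e. The choice (1 -
   c) / 2 keeps [1 - e] positive even if c is 0. *)
have [e e0 eP] : exists2 e : R, 0 < e & forall i, e < 1 /\
    forall p q, U p -> U q -> enorm (f i p - f i q) <= (1 - e) * enorm (p - q).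
  apply: finite_min => [r s i r0 rs [s1 sP]|i].
    split; first exact: le_lt_trans s1.
    move=> p q Up Uq; apply: (le_trans (sP _ _ Up Uq)).
    by rewrite ler_wpM2r ?enorm_ge0// lerD2l lerN2.
  have [_ _ _ _ /(_ i)[_ _ [c [c0 c1 cP]] _]] := hf.
  exists ((1 - c) / 2); first by rewrite divr_gt0// subr_gt0.
  split; first by lra.
  move=> p q Up Uq; apply: (le_trans (cP _ _ Up Uq)).
  by rewrite ler_wpM2r ?enorm_ge0//; lra.
have [e1 _] := eP ord0.
exists (1 - e); split; [lra|lra|].
elim=> [p q _ _|i w IH p q Up Uq] /=; first by rewrite expr0 mul1r.
have [_ /(_ _ _ (fseq_U w Up) (fseq_U w Uq)) fi] := eP i.
apply: (le_trans fi); rewrite exprS -mulrA ler_wpM2l ?IH//; lra.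
Qed.

(** Invertibility for one letter: the inverse of [f i] is also C^1, so by the chain rule the product
    of the two Jacobians is a differential of the identity, and differentials are unique. Words
    follow by composition. *)
Lemma fseq_sdiff w p : U p ->
  sdiff (fseq w) p (jacobian (fseq w) p) /\ jacobian (fseq w) p \in unitmx.
Proof.
have one i q : U q -> sdiff (f i) q (jacobian (f i) q) /\ jacobian (f i) q \in unitmx.
  move=> Uq; have [_ _ _ _ /(_ i)[_ _ _ [fC ofU [g [gC gf]]]]] := hf.
  have fq := C1_sdiff oU fC Uq; split => //.
  have fUq : (f i @` U) (f i q) by exists q.
  have gfq := C1_sdiff ofU gC fUq.
  have [r r0 rP] : exists2 r, 0 < r & forall p, enorm (p - q) <= r -> U p.
    by apply/nbhs_enormP; exact: open_nbhs_nbhs.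
  have := sdiff_eq (f := g \o f i) (g := id) r0 _ (sdiff_comp fq gfq).
  move=> /(_ (fun p pr => gf p (rP p pr))) E.
  have [Ju _] := mulmx1_unit (sdiff_unique E (sdiff_id q)).
  exact: Ju.
elim: w => [|i w IH] Up.
  have E := sdiff_id p; have -> : jacobian (fseq [::]) p = 1%:M := sdiff_jacobian E.
  by rewrite unitmx1.
have [w1 w2] := IH Up; have [i1 i2] := one i _ (fseq_U w Up).
have E : sdiff (fseq (i :: w)) p _ := sdiff_comp w1 i1.
rewrite (sdiff_jacobian E); split; first exact: E.
rewrite unitmx_mul; apply/andP; split; [exact: w2 | exact: i2].
Qed.

Lemma jacobian_fseq_cat u w p : U p ->
  jacobian (fseq (u ++ w)) p = jacobian (fseq w) p *m jacobian (fseq u) (fseq w p).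
Proof.
move=> Up; rewrite fseq_cat; apply: sdiff_jacobian.
apply: sdiff_comp; first by have [] := fseq_sdiff w Up.
by have [] := fseq_sdiff u (fseq_U w Up).
Qed.

Lemma fseq_lower_bound : exists2 b, 0 < b & forall w p, Z p -> forall v,
  b ^+ size w * enorm v <= enorm (v *m jacobian (fseq w) p).
Proof.
have [b b0 bP] : exists2 b : R, 0 < b & forall i p, Z p -> forall v,
    b * enorm v <= enorm (v *m jacobian (fseq [:: i]) p).
  apply: finite_min => [r s i r0 rs sP p Zp v|i].
    by apply: le_trans (sP p Zp v); rewrite ler_wpM2r ?enorm_ge0.
  apply: (compact_lower_bound (f := fseq [:: i]) Zc) => p /ZU Up.
    by have [] := fseq_sdiff [:: i] Up.
  by have [] := fseq_sdiff [:: i] Up.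
exists b => //; elim=> [p Zp v|i w IH p Zp v].
  have -> : jacobian (fseq [::]) p = 1%:M := sdiff_jacobian (sdiff_id p).
  by rewrite expr0 mul1r mulmx1.
have -> : jacobian (fseq (i :: w)) p = _ := jacobian_fseq_cat [:: i] w (ZU Zp).
have := bP i _ (fseq_Z w Zp) (v *m jacobian (fseq w) p).
rewrite -mulmxA; apply: le_trans.
by rewrite exprS -mulrA ler_pM2l// IH.
Qed.

Lemma Z_diameter : exists2 D, 0 < D & forall p q, Z p -> Z q -> enorm (p - q) <= D.
Proof.
have [M [Mr MP]] := compact_bounded Zc.
pose K := (`|M| + 1) * d%:R.
have K0 : 0 <= K by rewrite mulr_ge0// addr_ge0.
have KP p : Z p -> enorm p <= K.
  move=> Zp; apply: (le_trans (enorm_le_norm _)); rewrite mulrC ler_wpM2r//.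
  by apply: MP => //; rewrite (le_lt_trans (ler_norm M))// ltrDl.
exists (K + K + 1); first by rewrite ltr_wpDl// addr_ge0.
move=> p q Zp Zq; apply: (le_trans (enormD _ _)); rewrite enormN.
by have := KP _ Zp; have := KP _ Zq; lra.
Qed.

End IFS.

(** * Perturbation of singular values *)

Section perturbation.
Variables (R : realType) (d : nat).

Lemma ln_le_pos (p q : R) : 0 < p -> p <= q -> ln p <= ln q.
Proof. by move=> p0 pq; rewrite ler_ln ?posrE// (lt_le_trans p0). Qed.

Lemma lnM_pos (p q : R) : 0 < p -> 0 < q -> ln (p * q) = ln p + ln q.
Proof. by move=> p0 q0; rewrite lnM ?posrE. Qed.

Implicit Types (A B : 'M[R]_d).

Lemma alpha_prod_gt0 A k : A \in unitmx -> (k <= d)%N -> 0 < alpha_prod A k.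
Proof.
move=> Au kd; apply: prodr_gt0 => i _; exact: (alpha_gt0 (widen_ord kd i)).
Qed.

(** Write B = A M with M = 1 + A^-1 (B - A). The singular values of M are at most 1 + e / b, and
    Horn's inequality together with ln (1 + t) <= t gives the bound. Continuity of products of
    singular values is obtained in this way. *)
Lemma ln_alpha_prod_perturb A B (b e : R) k : A \in unitmx -> B \in unitmx ->
  0 < b -> (forall v, b * enorm v <= enorm (v *m A)) ->
  0 < e -> (forall v, enorm (v *m (B - A)) <= e * enorm v) -> (k <= d)%N ->
  ln (alpha_prod B k) <= ln (alpha_prod A k) + k%:R * (e / b).
Proof.
move=> Au Bu b0 bA e0 AB kd; set t := e / b; have t0 : 0 < t by rewrite divr_gt0.
have [M [MA BE]] : exists M, M = invmx A *m B /\ B = A *m M.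
  by exists (invmx A *m B); rewrite (mulKVmx Au).
have Mu : M \in unitmx.
  by rewrite MA unitmx_mul unitmx_inv; apply/andP; split.
have Mv v : enorm (v *m M) <= (1 + t) * enorm v.
  have [u uA] : exists u, u *m A = v by exists (v *m invmx A); rewrite (mulmxKV Au).
  have uv : enorm u <= b^-1 * enorm v by rewrite ler_pdivlMl// -uA.
  have -> : v *m M = v + u *m (B - A).
    by rewrite mulmxBr uA addrC subrK BE mulmxA uA.
  apply: (le_trans (enormD _ _)); rewrite mulrDl mul1r lerD2l.
  apply: (le_trans (AB u)).
  by rewrite /t -mulrA ler_pM2l.
have pA := alpha_prod_gt0 Au kd; have pB := alpha_prod_gt0 Bu kd.
have pM := alpha_prod_gt0 Mu kd.
have Mk : alpha_prod M k <= (1 + t) ^+ k.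
  have -> : (1 + t) ^+ k = \prod_(i < k) (1 + t) by rewrite prodr_const card_ord.
  apply: ler_prod => i _; rewrite alpha_ge0/=.
  exact: (alpha_le (widen_ord kd i) Mu Mv).
have BAM : alpha_prod B k <= alpha_prod A k * alpha_prod M k.
  by rewrite BE; exact: (alpha_prodM Au Mu kd).
apply: (le_trans (ln_le_pos pB BAM)); rewrite (lnM_pos pA pM) lerD2l.
apply: (le_trans (ln_le_pos pM Mk)).
rewrite lnXn; last by rewrite addr_gt0.
by rewrite -[leLHS]mulr_natl ler_wpM2l// le_ln1Dx// (lt_trans _ t0)// ltrN10.
Qed.

End perturbation.

(** * The coding map and differentials along codes *)

Section coding_map.
Variables (R : realType) (d l : nat) (Z U : set 'rV[R]_d).
Variable f : 'I_l.+1 -> 'rV[R]_d -> 'rV[R]_d.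
Hypothesis hf : C1_IFS Z U f.
Variable z : 'rV[R]_d.
Hypothesis hz : U z.
Implicit Types (x y : Sigma l) (w : seq 'I_l.+1).
Local Notation sh := (@left_shift l).
Local Notation X := (coding f z).

Let Zc : compact Z. Proof. by case: hf. Qed.
Let ZU : Z `<=` U. Proof. by case: hf. Qed.

Lemma geometric_le (c C e : R) : 0 < c -> c < 1 -> 0 < e ->
  exists N, forall n, (N <= n)%N -> C * c ^+ n <= e.
Proof.
move=> c0 c1 e0.
have : (fun n => C * c ^+ n) @ \oo --> C * 0.
  by apply: cvgM; [exact: cvg_cst | apply: cvg_expr; rewrite ger0_norm ?ltW].
rewrite mulr0 => /cvgrPdist_le /(_ e e0)[N _ NP]; exists N => n Nn.
have := NP n Nn; rewrite /= sub0r normrN; exact: le_trans (ler_norm _).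
Qed.

(** The base point [z] lies in [U], which may be unbounded; comparison with a point [p0] of the
    invariant compact set [Z] keeps its images bounded, so they form a Cauchy sequence. The images
    of [p0] have the same limit, which therefore lies in the closed set [Z]. *)
Lemma coding_approx : exists c C, [/\ 0 < c, c < 1, 0 < C &
  forall x, Z (X x) /\
    forall p, Z p -> forall n, enorm (X x - fword f x n p) <= C * c ^+ n].
Proof.
have [c [c0 c1 cP]] := contraction_ratio hf.
have [D D0 DP] := Z_diameter hf.
have [_ [p0 Zp0] _ _ _] := hf.
pose B := enorm (z - p0); have B0 : 0 <= B := enorm_ge0 _.
have ctr x n p q : U p -> U q ->
    enorm (fword f x n p - fword f x n q) <= c ^+ n * enorm (p - q).
  by move=> Up Uq; have := cP (mkseq x n) p q Up Uq; rewrite size_mkseq.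
have cn1 n : c ^+ n <= 1 by rewrite exprn_ile1// ltW.
have Zw x n p : Z p -> Z (fword f x n p) by move=> Zp; exact: (fseq_Z hf).
have uz x n : enorm (fword f x n z - z) <= 2 * B + D.
  have -> : fword f x n z - z = (fword f x n z - fword f x n p0) +
      ((fword f x n p0 - p0) + (p0 - z)) by rewrite !addrA !subrK.
  apply: (le_trans (enormD _ _)); have := enormD (fword f x n p0 - p0) (p0 - z).
  rewrite (enormB p0 z) -/B => h1; have := DP _ _ (Zw x n _ Zp0) Zp0 => h2.
  have := ctr x n z p0 hz (ZU Zp0); rewrite -/B => h3.
  have : c ^+ n * B <= B by rewrite -[leRHS]mul1r ler_wpM2r.
  lra.
have uN x n N : (N <= n)%N ->
    enorm (fword f x n z - fword f x N z) <= (2 * B + D) * c ^+ N.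
  move=> Nn; rewrite -(subnKC Nn) fword_addn mulrC.
  apply: (le_trans (ctr _ _ _ _ _ hz)); first exact: (fseq_U hf).
  by rewrite ler_wpM2l ?exprn_ge0 ?(ltW c0).
have cvgu x : cvgn (fun n => fword f x n z).
  apply: cauchy_cvg; apply: cauchy_exP => e e0.
  have [N NP] := @geometric_le c (2 * B + D) (e / 2) c0 c1 (divr_gt0 e0 (ltr0Sn _ 1)).
  exists (fword f x N z); exists N => // n Nn /=.
  rewrite -ball_normE/= distrC; apply: (le_lt_trans (norm_le_enorm _)).
  apply: (le_lt_trans (uN x n N Nn)); apply: (le_lt_trans (NP N (leqnn _))).
  by rewrite ltr_pdivrMr// mulr2n mulrDr mulr1 ltrDl.
have Xz x N : enorm (X x - fword f x N z) <= (2 * B + D) * c ^+ N.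
  apply/ler_addgt0Pr => e e0.
  have : nbhs (X x) [set q | enorm (q - X x) <= e].
    by apply/nbhs_enormP; exists e.
  move=> /(cvgu x)[M _ MP].
  have := MP (maxn M N) (leq_maxl _ _); rewrite /= => h1.
  have := uN x (maxn M N) N (leq_maxr _ _) => h2.
  rewrite -(subrK (fword f x (maxn M N) z) (X x)) -addrA.
  by apply: (le_trans (enormD _ _)); rewrite [leRHS]addrC lerD// enormB.
have Xp x N p : Z p -> enorm (X x - fword f x N p) <= (3 * B + 2 * D) * c ^+ N.
  move=> Zp; rewrite -(subrK (fword f x N z) (X x)) -addrA.
  apply: (le_trans (enormD _ _)); have := Xz x N => h1.
  have := ctr x N z p hz (ZU Zp) => h2.
  have : enorm (z - p) <= B + D.
    rewrite -(subrK p0 z) -addrA; apply: (le_trans (enormD _ _)).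
    by rewrite lerD// DP.
  move=> /(ler_wpM2l (exprn_ge0 N (ltW c0))); lra.
exists c, (3 * B + 2 * D + 1); split => //.
  by rewrite ltr_wpDl// addr_ge0// mulr_ge0// ltW.
move=> x; split.
  have Zcl : closed Z by apply: compact_closed => //; exact: norm_hausdorff.
  apply: Zcl => P /nbhs_enormP[e e0 eP].
  have [N NP] := @geometric_le c (3 * B + 2 * D) e c0 c1 e0.
  exists (fword f x N p0); split; first exact: Zw.
  by apply: eP; rewrite enormB (le_trans (Xp x N p0 Zp0))// NP.
move=> p Zp n; apply: (le_trans (Xp x n p Zp)).
by rewrite ler_wpM2r ?exprn_ge0 ?lerDl// ltW.
Qed.

Lemma coding_Z x : Z (X x).
Proof. by have [c [C [_ _ _ /(_ x)[]]]] := coding_approx. Qed.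

Lemma coding_U x : U (X x). Proof. exact/ZU/coding_Z. Qed.

(** Both sides are close to the image of one point of [Z] under the word of length n + N, with an
    error that tends to 0 as N grows. *)
Lemma coding_shift x n : X x = fword f x n (X (iter n sh x)).
Proof.
have [c [C [c0 c1 C0 CP]]] := coding_approx.
have [c' [c'0 c'1 c'P]] := contraction_ratio hf.
apply/subr0_eq/enorm_le_epsilon => e e0.
have [N NP] := @geometric_le c (C + C) e c0 c1 e0.
have [_ XP] := CP x; have [_ YP] := CP (iter n sh x).
have Zx := coding_Z x; have Zy := coding_Z (iter n sh x).
have := XP _ Zx (n + N)%N; rewrite fword_addn => h1.
have := YP _ Zx N => h2.
set q := fword f (iter n sh x) N (X x) in h1 h2.
have Zq : Z q by exact: (fseq_Z hf).
have h3 : enorm (fword f x n q - fword f x n (X (iter n sh x))) <= C * c ^+ N.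
  apply: le_trans h2; rewrite [leRHS]enormB.
  apply: (le_trans (c'P (mkseq x n) _ _ (ZU Zq) (ZU Zy))).
  by rewrite size_mkseq ler_piMl ?enorm_ge0// exprn_ile1// ltW.
rewrite -(subrK (fword f x n q) (X x)) -addrA.
apply: (le_trans (enormD _ _)); apply: le_trans (NP (N) (leqnn _)).
rewrite mulrDl lerD//; apply: (le_trans h1).
by rewrite ler_wpM2l ?(ltW C0)// exprD ler_piMl ?exprn_ge0 ?exprn_ile1// ltW.
Qed.

Lemma coding_agree : exists c D, [/\ 0 < c, c < 1, 0 < D &
  forall n x y, agree n x y -> enorm (X x - X y) <= D * c ^+ n].
Proof.
have [c [c0 c1 cP]] := contraction_ratio hf.
have [D D0 DP] := Z_diameter hf.
exists c, D; split => // n x y xy.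
rewrite (coding_shift x n) (coding_shift y n) -(agree_fword f xy).
apply: (le_trans (cP (mkseq x n) _ _ (coding_U _) (coding_U _))).
rewrite size_mkseq mulrC ler_wpM2r ?exprn_ge0 ?(ltW c0)//.
by apply: DP; exact: coding_Z.
Qed.

Definition cjac n x : 'M[R]_d := jacobian (fword f x n) (X (iter n sh x)).

Lemma cjac_unit n x : cjac n x \in unitmx.
Proof. by have [] := fseq_sdiff hf (mkseq x n) (coding_U (iter n sh x)). Qed.

Lemma cjacD n m x : cjac (n + m) x = cjac m (iter n sh x) *m cjac n x.
Proof.
rewrite /cjac [in LHS]fword_fseq mkseq_addn.
have -> := jacobian_fseq_cat hf (mkseq x n) (mkseq (iter n sh x) m)
  (coding_U (iter (n + m) sh x)).
have itD : iter (n + m) sh x = iter m sh (iter n sh x) by rewrite addnC iterD.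
have -> : fseq f (mkseq (iter n sh x) m) (X (iter (n + m) sh x)) = X (iter n sh x).
  by rewrite itD; exact: esym (coding_shift (iter n sh x) m).
by rewrite itD.
Qed.

Lemma cjac_bounds : exists b c, [/\ 0 < b, 0 < c, c < 1 & forall n x (i : 'I_d),
  b ^+ n <= alpha (cjac n x) i <= c ^+ n].
Proof.
have [c [c0 c1 cP]] := contraction_ratio hf.
have [b b0 bP] := fseq_lower_bound hf.
exists b, c; split => // n x i; apply/andP; split.
  apply: alpha_ge; first exact: cjac_unit.
  by move=> v; have := bP (mkseq x n) _ (coding_Z _) v; rewrite size_mkseq; exact.
apply: alpha_le; first exact: cjac_unit.
have [_ _ oU _ _] := hf.
apply: (contracting_jacobian (f := fword f x n) oU (coding_U (iter n sh x))).
  exact: (proj1 (fseq_sdiff hf (mkseq x n) (coding_U (iter n sh x)))).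
by move=> p q Up Uq; have := cP (mkseq x n) p q Up Uq; rewrite size_mkseq.
Qed.

(** The radius is uniform in [x] since there are finitely many words of length n and base points
    range over the compact set [Z]. *)
Lemma cjac_uniform n e : 0 < e -> exists2 r, 0 < r & forall x p q,
  enorm (p - X (iter n sh x)) <= r -> enorm (q - X (iter n sh x)) <= r ->
  enorm (fword f x n p - fword f x n q - (p - q) *m cjac n x) <= e * enorm (p - q).
Proof.
move=> e0; have [r r0 rP] : exists2 r : R, 0 < r & forall w : n.-tuple 'I_l.+1,
    forall u, Z u -> forall p q, enorm (p - u) <= r -> enorm (q - u) <= r ->
    enorm (fseq f w p - fseq f w q - (p - q) *m jacobian (fseq f w) u) <= e * enorm (p - q).
  apply: finite_min => [r s w r0 rs sP u Zu p q pu qu|w].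
    by apply: sP => //; [exact: le_trans rs|exact: le_trans rs].
  apply: sdiff_uniform => // u Zu.
  exact: (proj1 (fseq_sdiff hf w (ZU Zu))).
exists r => // x p q.
have sz : size (mkseq x n) == n by rewrite size_mkseq.
exact: (rP (Tuple sz) _ (coding_Z _)).
Qed.

(** The first n common letters give the same map, the further ones bring the two base points close
    together; then both Jacobians approximate this map near the second base point, hence are close
    to each other. *)
Lemma alpha_prod_cjac_uniform n e : 0 < e -> exists N, forall x y, agree N x y ->
  forall k, (k <= d)%N ->
  ln (alpha_prod (cjac n y) k) <= ln (alpha_prod (cjac n x) k) + e.
Proof.
move=> e0; have [b b0 bP] := fseq_lower_bound hf.
have bn0 : 0 < b ^+ n by rewrite exprn_gt0.
have d10 : 0 < d.+1%:R :> R by [].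
(* Chosen so that [k%:R * ((e' + e') / b ^+ n)], the loss in [ln_alpha_prod_perturb], is at most [e]
   for all [k <= d]. *)
pose e' := e * b ^+ n / d.+1%:R / 2.
have e'0 : 0 < e' by rewrite !divr_gt0// mulr_gt0.
have [r r0 rP] := cjac_uniform n e'0.
have [c [D [c0 c1 D0 DP]]] := coding_agree.
have r20 : 0 < r / 2 by rewrite divr_gt0.
have [N NP] := @geometric_le c D (r / 2) c0 c1 r20.
exists (n + N)%N => x y xy k kd.
have xyn : enorm (X (iter n sh x) - X (iter n sh y)) <= r / 2.
  by apply: le_trans (NP N (leqnn _)); apply: DP; exact: agree_shift.
have fE := agree_fword f (agree_le (leq_addr N n) xy).
set A := cjac n x; set B := cjac n y.
have AB v : enorm (v *m (B - A)) <= (e' + e') * enorm v.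
  have rr : r / 2 <= r by rewrite ler_pdivrMr// ler_pMr// ler1n.
  apply: (linear_approx_dist (f := fword f x n) (x := X (iter n sh y)) r20) => p pr.
    rewrite fE; apply: rP; first exact: le_trans rr.
    by rewrite subrr enorm0 ltW.
  apply: rP; last by apply: le_trans rr; rewrite enormB.
  rewrite -(subrK (X (iter n sh y)) p) -addrA; apply: (le_trans (enormD _ _)).
  by rewrite [leRHS]splitr lerD// enormB.
have bA v : b ^+ n * enorm v <= enorm (v *m A).
  by have := bP (mkseq x n) _ (coding_Z (iter n sh x)) v; rewrite size_mkseq.
have e'e' : 0 < e' + e' by rewrite addr_gt0.
have := ln_alpha_prod_perturb (cjac_unit n x) (cjac_unit n y) bn0 bA e'e' AB kd.
move=> /le_trans; apply; rewrite lerD2l /e' -splitr mulrAC mulfK ?gt_eqF//.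
apply: (@le_trans _ _ (d.+1%:R * (e / d.+1%:R))); last by rewrite mulrC divfK.
by rewrite ler_wpM2r ?ler_nat 1?leqW// ltW// divr_gt0.
Qed.

End coding_map.

(** * Birkhoff sums *)

Section bounded_random_variables.
Context {disp : measure_display} {T : measurableType disp} {R : realType}.
Variable P : probability T R.
Implicit Types (g h : T -> R) (S : T -> T) (A : set T).

(** The class of integrands used throughout: under a probability they are integrable with real
    integrals. Logarithms of word masses belong to it, as they take finitely many values and ln 0 =
    0. *)
Definition bmf g := measurable_fun setT g /\ exists B, forall x, `|g x| <= B.

Lemma bmf_integrable g : bmf g -> P.-integrable setT (EFin \o g).
Proof.
move=> [mg [B gB]]; apply: measurable_bounded_integrable => //.
  by rewrite /= probability_setT ltry.
exists B; split; first exact: num_real.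
by move=> x Bx y _ /=; apply: le_trans (ltW Bx); exact: gB.
Qed.

Lemma bmf_integralE g : bmf g ->
  (\int[P]_x (g x)%:E)%E = (\int[P]_x g x)%:E.
Proof.
move=> /bmf_integrable ig; rewrite /Rintegral fineK//.
exact: integrable_fin_num.
Qed.

Lemma bmf_cst c : bmf (fun=> c).
Proof. by split; [exact: measurable_cst | exists `|c|]. Qed.

Lemma bmfD g h : bmf g -> bmf h -> bmf (fun x => g x + h x).
Proof.
move=> [mg [B gB]] [mh [C hC]]; split; first exact: measurable_funD.
by exists (B + C) => x; apply: le_trans (ler_normD _ _) (lerD (gB x) (hC x)).
Qed.

Lemma bmfM g h : bmf g -> bmf h -> bmf (fun x => g x * h x).
Proof.
move=> [mg [B gB]] [mh [C hC]]; split; first exact: measurable_funM.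
by exists (B * C) => x; rewrite normrM ler_pM.
Qed.

Lemma bmfN g : bmf g -> bmf (fun x => - g x).
Proof.
move=> bg; have := bmfM (bmf_cst (-1)) bg; congr bmf.
by apply/funext => x; rewrite mulN1r.
Qed.

Lemma bmf_sum (I : Type) (s : seq I) (g : I -> T -> R) : (forall i, bmf (g i)) ->
  bmf (fun x => \sum_(i <- s) g i x).
Proof.
move=> bg; elim: s => [|i s IH].
  by have := bmf_cst 0; congr bmf; apply/funext => x; rewrite big_nil.
by have := bmfD (bg i) IH; congr bmf; apply/funext => x; rewrite big_cons.
Qed.

Lemma bmf_indic A : measurable A -> bmf (\1_A : T -> R).
Proof.
move=> mA; split; first exact: measurable_indic.
by exists 1 => x; rewrite indicE; case: (_ \in _); rewrite ?normr1 ?normr0.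
Qed.

Lemma bmf_comp g S : measurable_fun setT S -> bmf g -> bmf (g \o S).
Proof.
move=> mS [mg [B gB]]; split; first exact: measurableT_comp.
by exists B => x; exact: gB.
Qed.

Lemma expD g h : bmf g -> bmf h ->
  \int[P]_x (g x + h x) = \int[P]_x g x + \int[P]_x h x.
Proof. by move=> bg bh; rewrite RintegralD//; exact: bmf_integrable. Qed.

Lemma expZ c g : bmf g -> \int[P]_x (c * g x) = c * \int[P]_x g x.
Proof. by move=> bg; rewrite RintegralZl//; exact: bmf_integrable. Qed.

Lemma expN g : bmf g -> \int[P]_x (- g x) = - \int[P]_x g x.
Proof.
by move=> bg; rewrite -mulN1r -expZ//; apply: eq_Rintegral => x _; rewrite mulN1r.
Qed.

Lemma exp_cst c : \int[P]_x c = c.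
Proof. by rewrite Rintegral_cst//= probability_setT mulr1. Qed.

Lemma exp_le g h : bmf g -> bmf h -> (forall x, g x <= h x) ->
  \int[P]_x g x <= \int[P]_x h x.
Proof. by move=> bg bh gh; apply: le_Rintegral => //; exact: bmf_integrable. Qed.

Lemma exp_indic A : measurable A -> \int[P]_x (\1_A x : R) = fine (P A).
Proof.
move=> mA; rewrite /Rintegral integral_indic ?setIT//.
Qed.

Lemma exp_sum (I : Type) (s : seq I) (g : I -> T -> R) : (forall i, bmf (g i)) ->
  \int[P]_x (\sum_(i <- s) g i x) = \sum_(i <- s) \int[P]_x g i x.
Proof.
move=> bg; elim: s => [|i s IH].
  by under eq_Rintegral do rewrite big_nil; rewrite exp_cst big_nil.
under eq_Rintegral do rewrite big_cons.
by rewrite expD ?IH ?big_cons//; exact: bmf_sum.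
Qed.

Lemma exp_comp g S : measure_preserving P S -> bmf g ->
  \int[P]_x g (S x) = \int[P]_x g x.
Proof.
move=> [mS SP] bg; apply: EFin_inj.
rewrite -bmf_integralE//; last exact: (bmf_comp mS bg).
rewrite -bmf_integralE//.
have [mg _] := bg.
have := @integral_pushforward _ _ T T R S mS P setT (EFin \o g).
rewrite preimage_setT => <- //; first last.
- exact: bmf_integrable (bmf_comp mS bg).
- exact/measurable_EFinP.
apply: eq_measure_integral => A mA _; first [exact: (SP A mA) | exact: (esym (SP A mA))].
Qed.

Lemma measure_preserving_iter S n : measure_preserving P S ->
  measure_preserving P (iter n S).
Proof.
move=> [mS SP]; elim: n => [|n [mI IP]]; first by split => //; exact: measurable_id.
split; first exact: (measurableT_comp mS mI).
move=> A mA; rewrite -(SP A mA) -(IP (S @^-1` A))//.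
by rewrite -[X in measurable X]setTI; exact: mS.
Qed.


Lemma measurable_set_lt g c : measurable_fun setT g -> measurable [set x | g x < c].
Proof.
move=> mg; have -> : [set x | g x < c] = g @^-1` [set` `]-oo, c[].
  by apply/seteqP; split => x /=; rewrite in_itv.
by rewrite -[X in measurable X]setTI; apply: mg => //; exact: measurable_itv.
Qed.

Lemma measurable_set_le g c : measurable_fun setT g -> measurable [set x | c <= g x].
Proof.
move=> mg; have -> : [set x | c <= g x] = ~` [set x | g x < c].
  by apply/seteqP; split => x /=; rewrite leNgt => /negP.
exact/measurableC/measurable_set_lt.
Qed.

Definition bsum S g n x := \sum_(i < n) g (iter i S x).

Lemma bsumD S g m n x : bsum S g (m + n) x = bsum S g m x + bsum S g n (iter m S x).
Proof.
rewrite /bsum big_split_ord/=; congr (_ + _); apply: eq_bigr => i _.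
by rewrite addnC iterD.
Qed.

Lemma bmf_bsum S g n : measure_preserving P S -> bmf g -> bmf (bsum S g n).
Proof.
move=> SP bg; apply: bmf_sum => i.
by apply: bmf_comp bg; have [] := measure_preserving_iter i SP.
Qed.

Lemma exp_bsum S g n : measure_preserving P S -> bmf g ->
  \int[P]_x bsum S g n x = n%:R * \int[P]_x g x.
Proof.
move=> SP bg; rewrite exp_sum; last first.
  by move=> i; apply: bmf_comp bg; have [] := measure_preserving_iter i SP.
under eq_bigr do rewrite (exp_comp (measure_preserving_iter _ SP) bg).
by rewrite sumr_const card_ord mulr_natl.
Qed.

(* Outside the points whose time to drop below [e] exceeds [L], an orbit splits
   into blocks of length at most [L] on which the average of [h] is below [e]. *)
Lemma bsum_blocks S (g h : T -> R) (L : nat) (e B : R) : 0 < e ->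
  (forall x, `|h x| <= B) -> (forall x, h x <= g x) ->
  (forall x, h x <= e \/
     exists2 N, (0 < N <= L)%N & bsum S g N x <= e * N%:R) ->
  forall n x, bsum S h n x <= e * n%:R + L%:R * B.
Proof.
move=> e0 hB hg hL n; have [k] := ubnP n; elim: k n => // k IH n nk x.
have B0 : 0 <= B by apply: le_trans (hB x).
have [n0|n0] := posnP n.
  by rewrite n0 /bsum big_ord0 mulr0 add0r mulr_ge0.
have [he|[N /andP[N0 NL] gN]] := hL x.
  rewrite -[n in leLHS](@subnKC 1) // bsumD /= {1}/bsum big_ord1 /=.
  have := IH (n - 1)%N _ (S x); rewrite -ltnS subn1 prednK// => /(_ nk).
  rewrite -[in X in _ <= X -> _](ltn_predK n0) => IHn.
  rewrite -[n in leRHS](ltn_predK n0) -natr1.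
  lra.
(* A block that overruns the end leaves fewer than [L] terms, each at most [B]; this is the additive
   error of the statement. *)
have [Nn|nN] := leqP N n; last first.
  rewrite (@le_trans _ _ (n%:R * B))//.
    rewrite -[n in leRHS]card_ord -sum1_card natr_sum mulr_suml.
    apply: ler_sum => i _; rewrite mul1r; exact: le_trans (ler_norm _) (hB _).
  rewrite (@le_trans _ _ (L%:R * B))//.
    by rewrite ler_wpM2r// ler_nat (leq_trans _ NL)// ltnW.
  by rewrite lerDr mulr_ge0// ltW.
rewrite -[n in leLHS](subnKC Nn) bsumD.
have hN : bsum S h N x <= e * N%:R.
  by apply: le_trans gN; apply: ler_sum => i _; exact: hg.
have := IH (n - N)%N _ (iter N S x).
have nNk : (n - N < k)%N by rewrite -ltnS (leq_trans _ nk)// ltnS ltn_subrL N0.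
move=> /(_ nNk); rewrite natrB// mulrBr; lra.
Qed.

(** The Katznelson-Weiss argument: where the waiting time exceeds [L], replace g by the constant -B.
    The new function h lies below g and satisfies the block estimate at every point; integrating,
    using invariance and dividing by n gives that the integral of h is at most e, and h differs from
    g on a set of small measure. *)
Lemma half_birkhoff S g e : measure_preserving P S -> bmf g -> 0 < e ->
  P (\bigcup_N [set x | bsum S g N.+1 x < e * N.+1%:R]) = 1%E ->
  \int[P]_x g x <= e.
Proof.
move=> SP bg e0 PD; have [mg [B0 gB0]] := bg.
pose B := B0 + e; have gB x : `|g x| <= B by rewrite (le_trans (gB0 x))// lerDl ltW.
have B0p : 0 < B by rewrite ltr_wpDl// (le_trans _ (gB0 point)).
pose D N := [set x | bsum S g N.+1 x < e * N.+1%:R].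
have mD N : measurable (D N).
  by apply: measurable_set_lt; have [] := bmf_bsum N.+1 SP bg.
pose E L := \bigcup_(N in [set N | (N < L)%N]) D N.
have mE L : measurable (E L) by apply: bigcup_measurable.
have PE : (P \o E) @ \oo --> P (\bigcup_L E L).
  apply: nondecreasing_cvg_mu => //; first exact: bigcupT_measurable.
  move=> m n mn; apply/subsetPset => x [N /= Nm DN].
  by exists N => //=; exact: leq_trans mn.
have UE : \bigcup_L E L = \bigcup_N D N.
  apply/seteqP; split => [x [L _ [N _ DN]]|x [N _ DN]]; first by exists N.
  by exists N.+1 => //; exists N => /=.
rewrite UE PD in PE.
apply/ler_addgt0Pr => r r0.
(* Outside [E L] passing from g to h loses at most 2 B, so a complement of measure r / (2 B) costs
   at most r. *)
have [L LP] : exists L, 1 - r / (2 * B) <= fine (P (E L)).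
  have /fine_cvgP[_] : (P \o E) @ \oo --> 1%:E by exact: PE.
  have q0 : 0 < r / (2 * B) by rewrite divr_gt0// mulr_gt0.
  move=> /cvgrPdist_le /(_ _ q0)[L _ LP]; exists L.
  have := LP L (leqnn L); rewrite /= ler_norml => /andP[_]; lra.
pose h x := g x * \1_(E L) x + (- B) * \1_(~` E L) x.
have bh : bmf h.
  apply: bmfD; first by apply: bmfM => //; exact: bmf_indic.
  by apply: bmfM; [exact: bmf_cst|apply: bmf_indic; exact: measurableC].
have hE x : E L x -> h x = g x.
  move=> Ex; rewrite /h !indicE mem_set// memNset; last by move=> /(_ Ex).
  by rewrite mulr1 mulr0 addr0.
have hNE x : ~ E L x -> h x = - B.
  by move=> Ex; rewrite /h !indicE memNset// mem_set// mulr0 mulr1 add0r.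
have hB x : `|h x| <= B.
  have [Ex|Ex] := pselect (E L x); first by rewrite hE.
  by rewrite hNE// normrN gtr0_norm.
have hg x : h x <= g x.
  have [Ex|Ex] := pselect (E L x); first by rewrite hE.
  by rewrite hNE//; have := gB x; rewrite ler_norml => /andP[].
have hL x : h x <= e \/ exists2 N, (0 < N <= L)%N & bsum S g N x <= e * N%:R.
  have [[N /= NL DN]|Ex] := pselect (E L x).
    by right; exists N.+1; rewrite ?ltnS// ltW.
  by left; rewrite hNE// (@le_trans _ _ 0)// ?oppr_le0 ltW.
have key n : n%:R * (\int[P]_x h x - e) <= L%:R * B.
  have : \int[P]_x bsum S h n x <= \int[P]_x (e * n%:R + L%:R * B).
    apply: exp_le; [exact: bmf_bsum|exact: bmf_cst|].
    exact: bsum_blocks.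
  rewrite exp_bsum// exp_cst; lra.
have he : \int[P]_x h x <= e.
  rewrite leNgt; apply/negP => eh.
  have d0 : 0 < \int[P]_x h x - e by rewrite subr_gt0.
  pose N := (Num.truncn (L%:R * B / (\int[P]_x h x - e))).+1.
  have := key N; apply/negP; rewrite -ltNge -ltr_pdivrMr//.
  exact: truncnS_gt.
have : \int[P]_x g x <= \int[P]_x (h x + 2 * B * \1_(~` E L) x).
  apply: exp_le => //.
    by apply: bmfD => //; apply: bmfM; [exact: bmf_cst|apply: bmf_indic; exact: measurableC].
  move=> x; have [Ex|Ex] := pselect (E L x).
    by rewrite hE// indicE memNset ?mulr0 ?addr0//; move=> /(_ Ex).
  rewrite hNE// indicE mem_set// mulr1.
  by have := gB x; rewrite ler_norml => /andP[_]; lra.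
rewrite expD//; last first.
  by apply: bmfM; [exact: bmf_cst|apply: bmf_indic; exact: measurableC].
rewrite expZ; last by apply: bmf_indic; exact: measurableC.
rewrite exp_indic; last exact: measurableC.
rewrite probability_setC// fineB ?fin_num_measure// /= => /le_trans; apply.
rewrite lerD//; have : 2 * B * (1 - fine (P (E L))) <= 2 * B * (r / (2 * B)).
  by rewrite ler_pM2l ?mulr_gt0//; lra.
by rewrite [X in _ <= X -> _]mulrC divfK// gt_eqF// mulr_gt0.
Qed.

(* S^n0 need not be ergodic; but its invariant set of good points has positive
   measure, and its n0 preimages under S form an S-invariant set. *)
Lemma ergodic_blocks S n0 g e : (0 < n0)%N -> measure_preserving P S ->
  ergodic P S -> bmf g -> 0 < e -> e < \int[P]_x g x ->
  let B := [set x | exists j, (j < n0)%N /\ exists q : nat, forall N,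
    e * N%:R - q%:R <= bsum (iter n0 S) g N (iter j S x)] in
  measurable B /\ P B = 1%E.
Proof.
move=> n00 SP Serg bg e0 eg B; have [mg [K gK]] := bg.
pose T0 := iter n0 S; have TP : measure_preserving P T0 by exact: measure_preserving_iter.
(* The arbitrary constant [q] makes [A] exactly invariant under [T0]: dropping or adding one term
   changes the defect by at most [K + e]. *)
pose A := \bigcup_(q : nat) \bigcap_N [set x | e * N%:R - q%:R <= bsum T0 g N x].
have mA : measurable A.
  apply: bigcupT_measurable => q; apply: bigcapT_measurable => N.
  by apply: measurable_set_le; have [] := bmf_bsum N TP bg.
have bS N x : bsum T0 g N.+1 x = g x + bsum T0 g N (T0 x).
  by rewrite -[N.+1]add1n bsumD {1}/bsum big_ord1.
have [k kK] : exists k : nat, K + e <= k%:R.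
  by exists (Num.truncn (K + e)).+1; exact: ltW (truncnS_gt _).
have TA : T0 @^-1` A = A.
  apply/seteqP; split => x [q _ qP]; exists (q + k)%N => // N _ /=.
    case: N => [|N].
      by rewrite mulr0 sub0r /bsum big_ord0 oppr_le0.
    have := qP N I; rewrite /= bS natrD -natr1.
    have := gK x; rewrite ler_norml => /andP[]; lra.
  have := qP N.+1 I; rewrite /= bS natrD -natr1.
  have := gK x; rewrite ler_norml => /andP[]; lra.
(* If [A] were null, almost every orbit would have some sum below e N (outside [A] the constant q =
   0 fails), and [half_birkhoff] would bound the integral of g by e. *)
have PA : P A <> 0%E.
  move=> PA0; suff : \int[P]_x g x <= e by rewrite leNgt eg.
  apply: (half_birkhoff TP bg e0); apply/eqP; rewrite eq_le; apply/andP; split.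
    apply: probability_le1; apply: bigcupT_measurable => N.
    by apply: measurable_set_lt; have [] := bmf_bsum N.+1 TP bg.
  have <- : P (~` A) = 1%E by rewrite probability_setC// PA0 sube0.
  apply: le_measure; rewrite ?inE; [exact: measurableC| |].
    apply: bigcupT_measurable => N.
    by apply: measurable_set_lt; have [] := bmf_bsum N.+1 TP bg.
  move=> x /= Ax; apply: contrapT => Dx; apply: Ax; exists 0%N => // N _ /=.
  rewrite subr0; case: N => [|N]; first by rewrite mulr0 /bsum big_ord0.
  by rewrite leNgt; apply/negP => h; apply: Dx; exists N.
have BE : B = \bigcup_(j in [set j | (j < n0)%N]) (iter j S) @^-1` A.
  apply/seteqP; split => x.
    by move=> [j [jn [q qP]]]; exists j => //; exists q => // N _; exact: qP.
  by move=> [j /= jn [q _ qP]]; exists j; split => //; exists q => N; exact: qP.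
have mj j : measurable (iter j S @^-1` A).
  have [mS _] := measure_preserving_iter j SP.
  by rewrite -[X in measurable X]setTI; exact: mS.
have mB : measurable B by rewrite BE; apply: bigcup_measurable => j _; exact: mj.
split => //; have SB : S @^-1` B = B.
  rewrite BE; apply/seteqP; split => x.
    move=> [j /= jn Aj]; have [jn'|] := ltnP j.+1 n0.
      by exists j.+1 => //=; rewrite /= -iterS iterSr.
    move=> nj; have jE : j.+1 = n0 by apply/eqP; rewrite eqn_leq nj jn.
    by exists 0%N => //=; rewrite -TA /= /T0 -jE iterSr.
  move=> [[|j] /= jn Aj].
    exists n0.-1; first by rewrite /= prednK.
    rewrite /= -iterSr prednK// -/(T0 x).
    by have : (T0 @^-1` A) x by rewrite TA.
  by exists j => //=; [exact: ltnW | rewrite -iterSr].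
have [PB|//] := Serg B mB SB.
exfalso; apply: PA; apply/eqP; rewrite eq_le measure_ge0 andbT -PB.
apply: le_measure; rewrite ?inE// BE => x Ax.
by exists 0%N.
Qed.

End bounded_random_variables.

(** * Entropy *)

Section cylinders.
Variable l : nat.
Implicit Types (x y : Sigma l) (A : set (Sigma l)).
Local Notation T := (borelType (Sigma l)).

Lemma agree_sym n x y : agree n x y -> agree n y x.
Proof. by move=> xy i /xy. Qed.

Lemma agree_trans n x y (w : Sigma l) : agree n x y -> agree n y w -> agree n x w.
Proof. by move=> xy yw i im; rewrite xy// yw. Qed.

Lemma nbhs_agree x n : nbhs x [set y | agree n x y].
Proof.
elim: n => [|n IH]; first by apply: filterS filterT => y _ i.
have xn : nbhs x [set y : Sigma l | y n = x n].
  have /(_ x [set x n]) := @proj_continuous nat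
    (fun=> discrete_topology 'I_l.+1) n.
  by apply; exact: discrete_set1.
apply: filterS (filterI IH xn) => y [/= xy ynxn] i.
by rewrite ltnS leq_eqVlt => /predU1P[->|/xy].
Qed.

(** The sets that contain a cylinder around x form a filter converging to x in each coordinate,
    hence in the product topology. *)
Lemma nbhs_SigmaP x A : nbhs x A <-> exists n, forall y, agree n x y -> A y.
Proof.
split=> [xA|[n nA]]; last by apply: filterS (nbhs_agree x n).
pose F : set_system (Sigma l) := [set B | exists n, forall y, agree n x y -> B y].
have FF : Filter F.
  split; first by exists 0%N.
    move=> B C [n nB] [k kC]; exists (maxn n k) => y xy; split.
      exact/nB/(agree_le (leq_maxl _ _) xy).
    exact/kC/(agree_le (leq_maxr _ _) xy).
  by move=> B C BC [n nB]; exists n => y /nB /BC.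
suff : F --> x by move=> /(_ A xA).
apply/cvg_sup => i B.
rewrite (@nbhsE (initial_topology
  (fun g : (nat -> discrete_topology 'I_l.+1) => g i))) => -[C [oC Cx] CB].
have [D oD DC] := oC; exists i.+1 => y xy; apply: CB; rewrite -DC /=.
by move: Cx; rewrite -DC /= (xy i (ltnSn i)).
Qed.

Lemma open_SigmaP A :
  open A <-> forall x, A x -> exists n, forall y, agree n x y -> A y.
Proof.
rewrite openE; split=> [oA x Ax|oA x Ax]; first exact/nbhs_SigmaP/oA.
exact/nbhs_SigmaP/oA.
Qed.

Lemma open_measurable_Sigma A : open A -> (measurable : set (set T)) A.
Proof. exact: sub_sigma_algebra. Qed.

Lemma agree_measurable A : (forall x, A x -> exists n, forall y, agree n x y -> A y) ->
  (measurable : set (set T)) A.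
Proof. by move=> /(open_SigmaP A) /open_measurable_Sigma. Qed.

Definition determined n A := forall x y, agree n x y -> A x -> A y.

Lemma determined_measurable n A : determined n A -> (measurable : set (set T)) A.
Proof.
move=> dA; apply: agree_measurable => x Ax; exists n => y xy.
exact: dA Ax.
Qed.

(** Uniform continuity on the sequence space, expressed by common prefixes. *)
Definition unif_agree (R : realType) (g : Sigma l -> R) := forall e, 0 < e ->
  exists n, forall x y, agree n x y -> `|g x - g y| <= e.

Lemma unif_agree_measurable (R : realType) (g : Sigma l -> R) :
  unif_agree g -> measurable_fun setT (g : T -> R).
Proof.
move=> gu mD; apply: (measurability _ (RGenOInfty.measurableE R)) => //.
move=> _ [_ [a ->] <-]; rewrite setTI.
apply: agree_measurable => x /=; rewrite in_itv/= andbT => agx.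
have [n nP] := gu ((g x - a) / 2) (divr_gt0 (etrans (subr_gt0 _ _) agx) (ltr0Sn _ 1)).
exists n => y /nP; rewrite in_itv/= andbT ler_norml => /andP[_]; lra.
Qed.

Definition trunc p x : Sigma l := fun i => if (i < p)%N then x i else ord0.

Lemma trunc_agree p x : agree p x (trunc p x).
Proof. by move=> i ip; rewrite /trunc ip. Qed.

Lemma agree_truncE p x y : agree p x y -> trunc p x = trunc p y.
Proof.
by move=> xy; apply/funext => i; rewrite /trunc; case: ifP => // ip; rewrite xy.
Qed.

End cylinders.

(** * Subadditive sequences *)

Section fekete.
Variable R : realType.
Implicit Type u : nat -> R.

Definition subadditive u := forall m n, u (m + n)%N <= u m + u n.

Lemma subadditive_mul u m q r : subadditive u -> u (q * m + r)%N <= q%:R * u m + u r.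
Proof.
move=> us; elim: q => [|q IH]; first by rewrite mul0n mul0r !add0r.
rewrite mulSn -addnA; apply: (le_trans (us _ _)).
by rewrite -natr1 mulrDl mul1r; move: IH; lra.
Qed.

(** The limit is the infimum of u n / n over n >= 1, which the linear lower bound makes finite.
    Division of n by a near-optimal p leaves an error bounded by the constant [K]. *)
Lemma fekete u C : subadditive u -> (forall n, - C * n%:R <= u n) ->
  exists a : R, (fun n : nat => n%:R^-1 * u n) @ \oo --> a.
Proof.
move=> us uC; pose A := [set n.+1%:R^-1 * u n.+1 | n in setT].
have An0 : A !=set0 by exists (1%:R^-1 * u 1%N); exists 0%N.
have Alb : lbound A (- C).
  by move=> _ [n _ <-]; rewrite ler_pdivlMl// mulrC.
have hiA : has_inf A by split => //; exists (- C).
exists (inf A); apply/cvgrPdist_le => e e0.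
have e20 : 0 < e / 2 by rewrite divr_gt0.
have [_ [m _ <-] mA] := inf_adherent e20 hiA.
set p := m.+1 in mA; have p0 : 0 < p%:R :> R by [].
pose K := `|u p| + \sum_(r < p) `|u r|.
have K0 : 0 <= K by rewrite addr_ge0 ?sumr_ge0.
have key n : (0 < n)%N -> n%:R^-1 * u n <= p%:R^-1 * u p + K / n%:R.
  move=> n0; rewrite ler_pdivrMl ?ltr0n// mulrDr mulrCA.
  have -> : n%:R * (K / n%:R) = K by rewrite mulrC divfK// pnatr_eq0 -lt0n.
  rewrite [in leLHS](divn_eq n p); apply: (le_trans (subadditive_mul p _ _ us)).
  have nE : n%:R = (n %/ p)%:R * p%:R + (n %% p)%:R :> R by rewrite -natrM -natrD -divn_eq.
  have rp : (n %% p < p)%N by rewrite ltn_mod.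
  have h1 : u (n %% p)%N <= \sum_(r < p) `|u r|.
    rewrite (bigD1 (Ordinal rp))//= (le_trans (ler_norm _))// lerDl sumr_ge0//.
  have -> : n%:R * u p = p%:R * ((n %/ p)%:R * u p) + (n %% p)%:R * u p.
    by rewrite nE; ring.
  rewrite mulrDr mulKf ?gt_eqF//.
  have h2 : - (p%:R^-1 * ((n %% p)%:R * u p)) <= `|u p|.
    rewrite (le_trans (ler_norm _))// normrN mulrA normrM ger0_norm ?mulr_ge0 ?invr_ge0//.
    by rewrite ler_piMl// ler_pdivrMl// mulr1 ler_nat ltnW.
  by rewrite /K; lra.
have [N NK] : exists N : nat, 2 * K / e <= N%:R.
  by exists (Num.truncn (2 * K / e)).+1; exact: ltW (truncnS_gt _).
exists N.+1 => // n /= Nn; have n0 : (0 < n)%N by exact: leq_trans Nn.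
rewrite ler_norml; apply/andP; split.
  have h : K / n%:R <= e / 2.
    rewrite ler_pdivrMr ?ltr0n//.
    have : 2 * K / e <= n%:R by rewrite (le_trans NK)// ler_nat ltnW.
    by rewrite ler_pdivrMr//; lra.
  have := key n n0; move: mA; lra.
have : inf A <= n%:R^-1 * u n.
  by apply: ge_inf; [exists (- C) | exists n.-1 => //; rewrite prednK].
lra.
Qed.

End fekete.

(** * Entropy of finite labellings *)

Section label_entropy.
Context {disp : measure_display} {T : measurableType disp} {R : realType}.
Variable P : probability T R.
Implicit Types (L : finType).

(** Partitions are labellings in an arbitrary finite type, so that words and pairs of labels are
    labels again. *)
Definition mlabel L (lab : T -> L) := forall w, measurable (lab @^-1` [set w]).

Definition pmass L (lab : T -> L) (w : L) : R := fine (P (lab @^-1` [set w])).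

Lemma pmass_ge0 L (lab : T -> L) w : 0 <= pmass lab w.
Proof. by rewrite fine_ge0// measure_ge0. Qed.

Lemma label_expand L (lab : T -> L) (G : L -> R) x :
  G (lab x) = \sum_(w : L) G w * \1_(lab @^-1` [set w]) x.
Proof.
rewrite (bigD1 (lab x))//= indicE mem_set// mulr1 big1 ?addr0// => w wx.
rewrite indicE memNset ?mulr0// => /esym/eqP.
by rewrite eq_sym; apply/negP; rewrite eq_sym.
Qed.

Lemma bmf_label L (lab : T -> L) (G : L -> R) : mlabel lab -> bmf (fun x => G (lab x)).
Proof.
move=> ml; have -> : (fun x => G (lab x)) =
    (fun x => \sum_(w : L) G w * \1_(lab @^-1` [set w]) x).
  by apply/funext => x; rewrite (label_expand lab G x).
by apply: bmf_sum => w; apply: bmfM; [exact: bmf_cst|exact: bmf_indic].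
Qed.

Lemma exp_label L (lab : T -> L) (G : L -> R) : mlabel lab ->
  \int[P]_x G (lab x) = \sum_(w : L) G w * pmass lab w.
Proof.
move=> ml; under eq_Rintegral do rewrite (label_expand lab G).
rewrite exp_sum; last by move=> w; apply: bmfM; [exact: bmf_cst|exact: bmf_indic].
by apply: eq_bigr => w _; rewrite expZ ?exp_indic//; exact: bmf_indic.
Qed.

Lemma pmass_sum L (lab : T -> L) : mlabel lab -> \sum_(w : L) pmass lab w = 1.
Proof.
move=> ml; have := exp_label (fun=> 1) ml; rewrite exp_cst => ->.
by apply: eq_bigr => w _; rewrite mul1r.
Qed.

Lemma pmass_le1 L (lab : T -> L) w : mlabel lab -> pmass lab w <= 1.
Proof.
move=> ml; rewrite -(pmass_sum ml) (bigD1 w)//= lerDl sumr_ge0// => v _.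
exact: pmass_ge0.
Qed.

Definition lentropy L (lab : T -> L) : R := - \sum_(w : L) pmass lab w * ln (pmass lab w).

Lemma lentropyE L (lab : T -> L) : mlabel lab ->
  lentropy lab = - \int[P]_x ln (pmass lab (lab x)).
Proof.
move=> ml; rewrite (exp_label (fun w => ln (pmass lab w)) ml); congr (- _).
by apply: eq_bigr => w _; rewrite mulrC.
Qed.

Lemma lentropy_ge0 L (lab : T -> L) : mlabel lab -> 0 <= lentropy lab.
Proof.
move=> ml; rewrite oppr_ge0; apply: sumr_le0 => w _.
by rewrite mulr_ge0_le0 ?pmass_ge0 ?ln_le0// pmass_le1.
Qed.

(** From ln u <= u - 1 with u = q / p. The last hypothesis guards against the convention ln 0 = 0,
    which would falsify the bound where q vanishes and p does not. *)
Lemma gibbs L (lab : T -> L) (q : L -> R) : mlabel lab ->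
  (forall w, 0 <= q w) -> \sum_(w : L) q w <= 1 ->
  (forall w, 0 < pmass lab w -> 0 < q w) ->
  lentropy lab <= - \int[P]_x ln (q (lab x)).
Proof.
move=> ml q0 q1 qp; rewrite (exp_label (fun w => ln (q w)) ml) lerN2.
rewrite -subr_le0 -sumrB (@le_trans _ _ (\sum_(w : L) (q w - pmass lab w)))//.
  apply: ler_sum => w _; have := pmass_ge0 lab w; rewrite le_eqVlt => /predU1P[<-|p0].
    by rewrite mulr0 mul0r !subr0.
  rewrite mulrC -mulrBr -ln_div ?posrE ?qp//.
  rewrite (@le_trans _ _ (pmass lab w * (q w / pmass lab w - 1)))//.
    rewrite ler_pM2l//; have := @le_ln1Dx R (q w / pmass lab w - 1).
    have -> : 1 + (q w / pmass lab w - 1) = q w / pmass lab w by ring.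
    by apply; rewrite ltrBrDr addNr divr_gt0// qp.
  by rewrite mulrBr mulr1 mulrC divfK// gt_eqF.
by rewrite sumrB pmass_sum// subr_le0.
Qed.

Lemma lentropy_inj L L' (lab : T -> L) (phi : L -> L') : injective phi ->
  mlabel lab -> mlabel (phi \o lab) -> lentropy (phi \o lab) = lentropy lab.
Proof.
move=> phi_inj ml ml'; rewrite !lentropyE//; congr (- _).
apply: eq_Rintegral => x _; congr ln; rewrite /pmass; congr (fine (P _)).
by apply/seteqP; split => y /= => [/phi_inj|->].
Qed.

Lemma mlabel_pair L L' (lab : T -> L) (lab' : T -> L') :
  mlabel lab -> mlabel lab' -> mlabel (fun x => (lab x, lab' x)).
Proof.
move=> ml ml' [w w'].
have -> : (fun x => (lab x, lab' x)) @^-1` [set (w, w')] =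
    lab @^-1` [set w] `&` lab' @^-1` [set w'].
  by apply/seteqP; split => x /= [<- <-].
exact: measurableI.
Qed.

(** The Gibbs inequality with [q] the product of the two marginals. *)
Lemma lentropy_pair L L' (lab : T -> L) (lab' : T -> L') :
  mlabel lab -> mlabel lab' ->
  lentropy (fun x => (lab x, lab' x)) <= lentropy lab + lentropy lab'.
Proof.
move=> ml ml'; have mp := mlabel_pair ml ml'.
have sub w w' : (pmass (fun x => (lab x, lab' x)) (w, w') <= pmass lab w) &&
    (pmass (fun x => (lab x, lab' x)) (w, w') <= pmass lab' w').
  apply/andP; split; apply: fine_le; rewrite ?fin_num_measure//;
    apply: le_measure; rewrite ?inE//; by move=> x /= [].
pose q (v : L * L') := pmass lab v.1 * pmass lab' v.2.
have qpos v : 0 < pmass (fun x => (lab x, lab' x)) v -> 0 < pmass lab v.1 /\ 0 < pmass lab' v.2.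
  by case: v => w w' p0; have /andP[h1 h2] := sub w w'; split; exact: lt_le_trans p0 _.
apply: (le_trans (gibbs (q := q) mp _ _ _)).
- by move=> v; rewrite mulr_ge0 ?pmass_ge0.
- rewrite -(pair_bigA _ (fun w w' => pmass lab w * pmass lab' w'))/=.
  under eq_bigr do rewrite -mulr_sumr pmass_sum// mulr1.
  by rewrite pmass_sum.
- by move=> v /qpos[? ?]; rewrite mulr_gt0.
rewrite !lentropyE// -opprD lerN2.
rewrite -expD; [|exact: (bmf_label (fun w => ln (pmass lab w)))|
  exact: (bmf_label (fun w => ln (pmass lab' w)))].
rewrite (exp_label (fun v => ln (q v)) mp).
rewrite (exp_label (fun v : L * L' => ln (pmass lab v.1) + ln (pmass lab' v.2)) mp).
apply: ler_sum => v _; have := pmass_ge0 (fun x => (lab x, lab' x)) v.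
rewrite le_eqVlt => /predU1P[<-|]; first by rewrite !mulr0.
by move=> /qpos[? ?]; rewrite /q lnM ?posrE.
Qed.

End label_entropy.

Section real_probability.
Context {disp : measure_display} {T : measurableType disp} {R : realType}.
Variable P : probability T R.
Implicit Types A B : set T.

Definition pr A : R := fine (P A).

Lemma prE A : measurable A -> P A = (pr A)%:E.
Proof. by move=> mA; rewrite /pr fineK// fin_num_measure. Qed.

Lemma pr_ge0 A : 0 <= pr A. Proof. by rewrite fine_ge0// measure_ge0. Qed.

Lemma pr_le A B : measurable A -> measurable B -> A `<=` B -> pr A <= pr B.
Proof.
by move=> mA mB AB; rewrite -lee_fin -!prE//; apply: le_measure; rewrite ?inE.
Qed.

Lemma pr_setU A B : measurable A -> measurable B -> pr (A `|` B) <= pr A + pr B.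
Proof.
move=> mA mB; have mAB := measurableU _ _ mA mB.
rewrite -lee_fin EFinD -!prE//; exact: measureU2.
Qed.

Lemma pr_exists (L : finType) (A : L -> set T) : (forall i, measurable (A i)) ->
  measurable [set x | exists i, A i x] /\
  pr [set x | exists i, A i x] <= \sum_(i : L) pr (A i).
Proof.
move=> mA; rewrite -big_enum/=.
pose U (s : seq L) := [set x | exists2 i, i \in s & A i x].
have -> : [set x | exists i, A i x] = U (enum L).
  apply/seteqP; split => x [j]; last by move=> _ Aj; exists j.
  by move=> Aj; exists j; rewrite ?mem_enum.
elim: (enum L) => [|i s [mU IH]].
  have -> : U [::] = set0 by apply/seteqP; split => x // [].
  by rewrite big_nil /pr measure0.
have -> : U (i :: s) = A i `|` U s.
  apply/seteqP; split => x.
    by move=> [j]; rewrite inE => /predU1P[->|js] Aj; [left|right; exists j].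
  move=> [Ai|[j js Aj]]; first by exists i => //; rewrite inE eqxx.
  by exists j => //; rewrite inE js orbT.
split; first exact: measurableU.
rewrite big_cons; apply: (le_trans (pr_setU (mA i) mU)).
by rewrite lerD2l.
Qed.

End real_probability.

Section partition_entropy.
Context {disp : measure_display} {T : measurableType disp} {R : realType}.
Variables (P : probability T R) (S : T -> T) (k : nat) (xi : T -> 'I_k).
Hypotheses (SP : measure_preserving P S) (mxi : measurable_partition xi).

Definition itinerary n (x : T) : {ffun 'I_n -> 'I_k} := [ffun i : 'I_n => xi (iter i S x)].

Lemma itinerary_set n (w : {ffun 'I_n -> 'I_k}) :
  itinerary n @^-1` [set w] = [set x | forall i : 'I_n, xi (iter i S x) = w i].
Proof.
apply/seteqP; split => x /=; first by move=> <- i; rewrite ffunE.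
by move=> xw; apply/ffunP => i; rewrite ffunE xw.
Qed.

Lemma mlabel_itinerary n : mlabel (itinerary n).
Proof.
move=> w; have -> : itinerary n @^-1` [set w] =
    ~` [set x | exists i : 'I_n, xi (iter i S x) <> w i].
  rewrite itinerary_set; apply/seteqP; split => x /=.
    by move=> xw [j]; rewrite xw.
  by move=> /forallNP xw i; apply: contrapT; exact: xw.
apply: measurableC.
have [] // := @pr_exists _ _ _ P 'I_n (fun i => [set x | xi (iter i S x) <> w i]).
move=> i; have -> : [set x | xi (iter i S x) <> w i] =
    ~` (iter i S @^-1` (xi @^-1` [set w i])) by [].
apply: measurableC; have [mi _] := measure_preserving_iter i SP.
by rewrite -[X in measurable X]setTI; apply: mi => //; exact: mxi.
Qed.

Lemma partition_entropyE n : partition_entropy P S xi n = lentropy P (itinerary n).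
Proof.
by rewrite /partition_entropy /lentropy /pmass; under eq_bigr do rewrite -itinerary_set.
Qed.

Lemma partition_entropy_subadditive : subadditive (partition_entropy P S xi).
Proof.
move=> m n; rewrite !partition_entropyE.
pose phi (w : {ffun 'I_(m + n) -> 'I_k}) :=
  ([ffun i => w (lshift n i)] : {ffun 'I_m -> 'I_k},
   [ffun i => w (rshift m i)] : {ffun 'I_n -> 'I_k}).
have phi_inj : injective phi.
  move=> w w' [/ffunP e1 /ffunP e2]; apply/ffunP => i.
  rewrite -(splitK i); case: (fintype.split i) => j /=.
    by have := e1 j; rewrite !ffunE.
  by have := e2 j; rewrite !ffunE.
have phiE : phi \o itinerary (m + n) =
    fun x => (itinerary m x, itinerary n (iter m S x)).
  apply/funext => x; congr pair; apply/ffunP => i; rewrite !ffunE//.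
  by rewrite /= addnC iterD.
have [mS SPm] := measure_preserving_iter m SP.
have mln : mlabel (fun x => itinerary n (iter m S x)).
  move=> w; rewrite -[X in measurable X]setTI.
  exact: (mS measurableT _ (@mlabel_itinerary n w)).
have mlm := @mlabel_itinerary m.
rewrite -(lentropy_inj P phi_inj (@mlabel_itinerary (m + n))); last first.
  by rewrite phiE; exact: mlabel_pair.
rewrite phiE; apply: (le_trans (lentropy_pair P mlm mln)); rewrite lerD2l.
suff -> : lentropy P (fun x => itinerary n (iter m S x)) = lentropy P (itinerary n) by [].
rewrite /lentropy; congr (- _); apply: eq_bigr => w _.
have -> // : pmass P (fun x => itinerary n (iter m S x)) w = pmass P (itinerary n) w.
by rewrite /pmass -[in RHS](SPm _ (@mlabel_itinerary n w)).
Qed.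

Lemma partition_entropy_ge0 n : 0 <= partition_entropy P S xi n.
Proof. by rewrite partition_entropyE; apply: lentropy_ge0; exact: mlabel_itinerary. Qed.

Lemma entropy_wrt_cvg :
  (fun n : nat => n%:R^-1 * partition_entropy P S xi n) @ \oo --> entropy_wrt P S xi.
Proof.
have [|a ca] := @fekete R (partition_entropy P S xi) 0 partition_entropy_subadditive.
  by move=> n; rewrite oppr0 mul0r; exact: partition_entropy_ge0.
by rewrite /entropy_wrt (cvg_lim _ ca).
Qed.

Lemma entropy_wrt_ge0 : 0 <= entropy_wrt P S xi.
Proof.
have /cvgP c := entropy_wrt_cvg; apply: limr_ge => //; apply: nearW => n.
by rewrite mulr_ge0 ?invr_ge0// partition_entropy_ge0.
Qed.

Lemma entropy_wrt_le a b : (forall n, partition_entropy P S xi n <= a * n%:R + b) ->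
  entropy_wrt P S xi <= a.
Proof.
move=> ab; have inv0 : (fun n : nat => n%:R^-1 : R) @ \oo --> (0 : R).
  by apply/gtr0_cvgV0; [near=> n; rewrite ltr0n; near: n; exact: nbhs_infty_gt | exact: cvgr_idn].
have : (fun n : nat => a + b * n%:R^-1 : R) @ \oo --> a + b * 0.
  by apply: cvgD; [exact: cvg_cst|apply: cvgM; [exact: cvg_cst|]].
rewrite mulr0 addr0 => cb.
apply: (ler_cvg_to entropy_wrt_cvg cb); near=> n.
have n0 : 0 < n%:R :> R by rewrite ltr0n; near: n; exact: nbhs_infty_gt.
rewrite ler_pdivrMl// mulrDr mulrCA mulfV ?mulr1 ?gt_eqF//.
by rewrite mulrC ab.
Unshelve. all: end_near. Qed.

End partition_entropy.

(** * Approximating Borel sets and partitions by cylinders *)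

Section cylinder_approximation.
Variables (R : realType) (l : nat).
Local Notation T := (borelType (Sigma l)).
Variable m : probability T R.
Implicit Types A B : set T.

Definition symdiff A B : set T := (A `\` B) `|` (B `\` A).

Lemma measurable_symdiff A B : measurable A -> measurable B -> measurable (symdiff A B).
Proof. by move=> mA mB; apply: measurableU; exact: measurableD. Qed.

(** These sets form a sigma-algebra containing the open sets, hence include all Borel sets. An open
    set is the increasing union of the cylinders of length n that it contains. *)
Definition approximable A := measurable A /\ forall e, 0 < e ->
  exists p B, determined p B /\ pr m (symdiff A B) <= e.

Lemma pr_decreasing_limit (F : nat -> set T) e : (forall n, measurable (F n)) ->
  (forall n, F n.+1 `<=` F n) -> \bigcap_n F n = set0 -> 0 < e ->
  exists n, pr m (F n) <= e.
Proof.
move=> mF dF F0 e0.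
have : m \o F @ \oo --> m (\bigcap_n F n).
  apply: nonincreasing_cvg_mu => //; last by apply/nonincreasing_seqP => n; apply/subsetPset.
    by rewrite -ge0_fin_numE// fin_num_measure.
  exact: bigcapT_measurable.
rewrite F0 measure0 => /fine_cvgP[_] /cvgrPdist_le /(_ _ e0)[n _ nP].
by exists n; have := nP n (leqnn n); rewrite /= sub0r normrN; exact: le_trans (ler_norm _).
Qed.

Lemma approximable_open A : open A -> approximable A.
Proof.
move=> oA; split; first exact: open_measurable_Sigma.
move=> e e0; pose C n : set T := [set x : Sigma l | forall y, agree n x y -> A y].
have dC n : determined n (C n).
  move=> x y xy Cx w yw; apply: Cx; exact: agree_trans yw.
have CA n : C n `<=` A by move=> x; apply.
have mC n : measurable (C n) := determined_measurable (dC n).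
have mA : (measurable : set (set T)) A by exact: open_measurable_Sigma.
have [] := @pr_decreasing_limit (fun n => A `\` C n) e _ _ _ e0.
- by move=> n; exact: measurableD.
- move=> n x [Ax Cx]; split => // Cnx; apply: Cx => y xy; apply: Cnx.
  exact: agree_le xy.
- apply/seteqP; split => // x Fx.
  have [n nA] := proj1 (open_SigmaP A) oA x (proj1 (Fx 0%N I)).
  by have [_] := Fx n I; apply.
move=> n nP; exists n, (C n); split => //; apply: le_trans nP; apply: pr_le.
- by apply: measurable_symdiff.
- exact: measurableD.
- by move=> x [//|[Cx /(_ (CA n _ Cx))]].
Qed.

Lemma approximableC A : approximable A -> approximable (~` A).
Proof.
move=> [mA aA]; split; first exact: measurableC.
move=> e /aA[p [B [dB AB]]]; exists p, (~` B); split.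
  by move=> x y xy Bx By; apply: Bx; apply: dB By; exact: agree_sym.
rewrite (_ : symdiff _ _ = symdiff A B)// /symdiff.
by apply/seteqP; split => x [[? ?]|[? ?]]; [right|left|right|left]; split => //; apply: contrapT.
Qed.

Lemma approximableU A1 A2 : approximable A1 -> approximable A2 -> approximable (A1 `|` A2).
Proof.
move=> [mA1 a1] [mA2 a2]; split; first exact: measurableU.
move=> e e0; have e20 : 0 < e / 2 by rewrite divr_gt0.
have [p1 [B1 [d1 h1]]] := a1 _ e20; have [p2 [B2 [d2 h2]]] := a2 _ e20.
have mB1 := determined_measurable d1; have mB2 := determined_measurable d2.
exists (maxn p1 p2), (B1 `|` B2); split.
  move=> x y xy [B1x|B2x]; [left; apply: d1 B1x|right; apply: d2 B2x].
    exact: agree_le (leq_maxl _ _) xy.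
  exact: agree_le (leq_maxr _ _) xy.
apply: (@le_trans _ _ (pr m (symdiff A1 B1 `|` symdiff A2 B2))).
  apply: pr_le.
  - by apply: measurable_symdiff; exact: measurableU.
  - by apply: measurableU; exact: measurable_symdiff.
  - move=> x [[[A1x|A2x] nB]|[[B1x|B2x] nA]].
    + by left; left; split => // B1x; apply: nB; left.
    + by right; left; split => // B2x; apply: nB; right.
    + by left; right; split => // A1x; apply: nA; left.
    + by right; right; split => // A2x; apply: nA; right.
apply: (le_trans (pr_setU _ _ _)); [exact: measurable_symdiff|exact: measurable_symdiff|].
by rewrite [leRHS]splitr lerD.
Qed.

Lemma approximable_bigcup (F : nat -> set T) : (forall n, approximable (F n)) ->
  approximable (\bigcup_n F n).
Proof.
move=> aF; have mF n : measurable (F n) by have [] := aF n.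
pose G n : set T := [set x | exists2 i, (i < n)%N & F i x].
have GS n : G n.+1 = G n `|` F n.
  apply/seteqP; split => x.
    case=> i; rewrite ltnS leq_eqVlt => /predU1P[->|ni] Fi; first by right.
    by left; exists i.
  by move=> [[i ni Fi]|Fn]; [exists i => //; exact: leqW|exists n].
have aG n : approximable (G n).
  elim: n => [|n IH]; last by rewrite GS; exact: approximableU.
  rewrite (_ : G 0%N = set0); first exact/approximable_open/open0.
  by apply/seteqP; split => x // [].
have mG n : measurable (G n) by have [] := aG n.
have mU : measurable (\bigcup_n F n) by exact: bigcupT_measurable.
split => // e e0; have e20 : 0 < e / 2 by rewrite divr_gt0.
have [] := @pr_decreasing_limit (fun n => (\bigcup_n F n) `\` G n) (e / 2) _ _ _ e20.
- by move=> n; exact: measurableD.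
- by move=> n x [Ux Gx]; split => // Gnx; apply: Gx; rewrite GS; left.
- apply/seteqP; split => // x Hx; have [[i _ Fi] _] := Hx 0%N I.
  by have [_] := Hx i.+1 I; apply; exists i.
move=> n nP; have [_ /(_ _ e20)[p [B [dB GB]]]] := aG n.
have mB := determined_measurable dB.
exists p, B; split => //.
apply: (@le_trans _ _ (pr m (((\bigcup_n F n) `\` G n) `|` symdiff (G n) B))).
  apply: pr_le; first exact: measurable_symdiff.
    by apply: measurableU; [exact: measurableD|exact: measurable_symdiff].
  move=> x [[Ux nB]|[Bx nU]].
    by have [Gx|Gx] := pselect (G n x); [right; left|left].
  by right; right; split => // -[i ni Fi]; apply: nU; exists i.
apply: (le_trans (pr_setU _ _ _)); [exact: measurableD|exact: measurable_symdiff|].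
by rewrite [leRHS]splitr lerD.
Qed.

Lemma measurable_approximable A : measurable A -> approximable A.
Proof.
have : (<<s @open (Sigma l) >> `<=` approximable).
  apply: smallest_sub; last by move=> B oB; exact: approximable_open.
  split.
  - exact/approximable_open/open0.
  - by move=> B; rewrite setTD; exact: approximableC.
  - exact: approximable_bigcup.
by apply.
Qed.

(** Approximate each cell by a cylinder set [(pB i).2] and label x by an i whose set contains it, or
    by [ord0] if there is none. The new label can be wrong only on the union of the symmetric
    differences. *)
Lemma approximate_partition k (xi : T -> 'I_k.+1) e : measurable_partition xi -> 0 < e ->
  exists p (xi' : Sigma l -> 'I_k.+1),
    [/\ forall x y, agree p x y -> xi' x = xi' y,
       measurable [set x | xi x <> xi' x] & pr m [set x | xi x <> xi' x] <= e].
Proof.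
move=> mxi e0; pose e' := e / k.+1%:R; have e'0 : 0 < e' by rewrite divr_gt0.
have /choice[pB pBP] : forall i, exists pB : nat * set T, determined pB.1 pB.2 /\
    pr m (symdiff (xi @^-1` [set i]) pB.2) <= e'.
  by move=> i; have [_ /(_ _ e'0)[p [B ?]]] := measurable_approximable (mxi i); exists (p, B).
pose p := \max_i (pB i).1.
have d i : determined p (pB i).2.
  move=> x y xy; have [d _] := pBP i; apply: d; apply: agree_le xy.
  exact: (leq_bigmax i).
have mB i : measurable (pB i).2 := determined_measurable (d i).
pose xi' (x : Sigma l) : 'I_k.+1 := odflt ord0 [pick i | `[< (pB i).2 x >]].
have xi'P x y : agree p x y -> xi' x = xi' y.
  move=> xy; rewrite /xi'; congr odflt; apply: eq_pick => i /=.
  by apply/asbool_equiv_eq; split; apply: d => //; exact: agree_sym.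
have mxi' i : measurable ((xi' : T -> _) @^-1` [set i]).
  by apply: (@determined_measurable l p) => x y xy /= <-; rewrite (xi'P x y).
have [mE PE] := @pr_exists _ _ _ m 'I_k.+1 (fun i => symdiff (xi @^-1` [set i]) (pB i).2)
  (fun i => measurable_symdiff (mxi i) (mB i)).
have mD : measurable [set x | xi x <> xi' x].
  have [+ _] := @pr_exists _ _ _ m 'I_k.+1
    (fun i => xi @^-1` [set i] `\` (xi' : T -> _) @^-1` [set i])
    (fun i => measurableD (mxi i) (mxi' i)).
  congr measurable; apply/seteqP; split => x.
    by move=> [i [/= -> /nesym]].
  by move=> xx; exists (xi x); split => //= /esym.
exists p, xi'; split => //.
apply: (@le_trans _ _ (\sum_(i < k.+1) e')); last first.
  by rewrite sumr_const card_ord -mulr_natr divfK.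
apply: (le_trans _ (le_trans PE (ler_sum _ _))); last by move=> i _; have [] := pBP i.
apply: pr_le => // x /= xx; apply: contrapT => /forallNP H; apply: xx.
have HB i : (pB i).2 x <-> xi x = i.
  split=> [Bx|xE]; apply: contrapT => nx; apply: (H i); first by right.
  by left.
rewrite /xi'; case: pickP => [i /asboolP /HB //|/(_ (xi x))/asboolP []].
exact/HB.
Qed.

End cylinder_approximation.

(** * Finiteness of the entropy of the shift *)

Section finite_entropy.
Variables (R : realType) (l : nat).
Local Notation T := (borelType (Sigma l)).
Local Notation sh := (@left_shift l).
Local Notation shT := (@left_shift l : T -> T).
Variable m : probability T R.
Hypothesis hinv : measure_preserving m sh.

(** A bound independent of the partition, by a coding argument: up to rare errors the label at each
    time is read from p + 1 letters, so an itinerary of length n is described by n + p letters and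
    by corrections. A letter costs at most [ln l.+1%:R], the corrections on average [ln 2 + 1] per
    time. *)
Lemma entropy_wrt_bound k (xi : T -> 'I_k) : measurable_partition xi ->
  entropy_wrt m sh xi <= ln l.+1%:R + (ln 2 + 1).
Proof.
case: k xi => [xi|k xi mxi]; first by case: (xi point).
(* An error costs an extra [ln k.+1%:R], at most k, so error probability [k.+1%:R^-1] keeps the mean
   extra cost below 1. *)
have e0 : 0 < k.+1%:R^-1 :> R by rewrite invr_gt0.
have [p [xi' [xi'P mD PD]]] := approximate_partition m mxi e0.
set D := [set x | xi x <> xi' x] in mD PD.
apply: (entropy_wrt_le hinv mxi (b := p%:R * ln l.+1%:R)) => n.
rewrite partition_entropyE.
(* A noise kernel, sub-probability in [a]: half of the mass on the predicted label, the other half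
   spread evenly, so that every label is possible. *)
pose K (a b : 'I_k.+1) : R := if a == b then 2^-1 else (2 * k.+1%:R)^-1.
have K0 a b : 0 < K a b by rewrite /K; case: ifP => _; rewrite invr_gt0// mulr_gt0.
have K1 b : \sum_a K a b <= 1.
  rewrite (bigD1 b)//= {1}/K eqxx (@le_trans _ _ (2^-1 + \sum_(a < k.+1) (2 * k.+1%:R)^-1))//.
    rewrite lerD2l [leRHS](bigD1 b)//= ler_wpDl ?invr_ge0//.
    by rewrite le_eqVlt; apply/orP; left; apply/eqP/eq_bigr => a /negbTE ab; rewrite /K ab.
  rewrite sumr_const card_ord -[X in _ + X <= _]mulr_natr.
  have : k.+1%:R != 0 :> R by [].
  by move: k.+1%:R => t t0; rewrite le_eqVlt; apply/orP; left; apply/eqP; field.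
pose c : R := (l.+1%:R ^+ (n + p))^-1.
have c0 : 0 < c by rewrite invr_gt0 exprn_gt0.
pose W := {ffun 'I_(n + p) -> 'I_l.+1}.
pose ext (u : W) : Sigma l := fun j => if insub j is Some j' then u j' else ord0.
(* The law of the labels predicted from a uniformly chosen word of length n + p, perturbed by
   independent noise [K]; it is the comparison distribution in the Gibbs inequality. *)
pose q (w : {ffun 'I_n -> 'I_k.+1}) : R :=
  \sum_(u : W) c * \prod_(i < n) K (w i) (xi' (iter i sh (ext u))).
have q0 w : 0 < q w.
  rewrite /q (bigD1 [ffun=> ord0])//= ltr_pwDl//.
    by rewrite mulr_gt0//; apply: prodr_gt0 => i _.
  by apply: sumr_ge0 => u _; rewrite mulr_ge0 ?(ltW c0)//; apply: prodr_ge0 => i _; exact: ltW.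
have q1 : \sum_w q w <= 1.
  rewrite exchange_big/= (@le_trans _ _ (\sum_(u : W) c))//.
    apply: ler_sum => u _; rewrite -mulr_sumr ler_piMr ?(ltW c0)//.
    rewrite -(bigA_distr_bigA (fun (i : 'I_n) a => K a (xi' (iter i sh (ext u)))))/=.
    by apply: prodr_ile1 => i _; rewrite K1 andbT; apply: sumr_ge0 => a _; exact: ltW.
  rewrite sumr_const card_ffun !card_ord -[leLHS]mulr_natr natrX /c mulVf//.
have ml := mlabel_itinerary hinv mxi (n := n).
apply: (le_trans (gibbs ml (fun w => ltW (q0 w)) q1 (fun w _ => q0 w))).
pose E x : R := ln 2 + ln k.+1%:R * \1_D x.
have bE : bmf E.
  apply: bmfD; first exact: bmf_cst.
  by apply: bmfM; [exact: bmf_cst|exact: bmf_indic].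
have bq : bmf (fun x : T => ln (q (itinerary shT xi n x))).
  exact: (bmf_label (fun w => ln (q w)) ml).
rewrite -expN//.
(* Of the sum defining [q], only the term of the actual prefix of x is kept. *)
have step (x : T) : - ln (q (itinerary shT xi n x)) <=
    (n + p)%N%:R * ln l.+1%:R + bsum shT E n x.
  pose u : W := [ffun j : 'I_(n + p) => x j].
  have xu : agree (n + p) x (ext u).
    by move=> j jn; rewrite /ext insubT/= ffunE.
  have qc : c * \prod_(i < n) K (xi (iter i sh x)) (xi' (iter i sh x)) <= q (itinerary shT xi n x).
    rewrite /q (bigD1 u)//= ler_wpDr//.
      by apply: sumr_ge0 => v _; rewrite mulr_ge0 ?(ltW c0)//; apply: prodr_ge0 => i _; exact: ltW.
    rewrite ler_pM2l//; apply: ler_prod => i _; rewrite ltW//= ffunE.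
    have -> // : xi' (iter i sh x) = xi' (iter i sh (ext u)).
    apply: xi'P; apply: agree_shift; apply: agree_le xu.
    by rewrite leq_add2r ltnW.
  have p0 : 0 < \prod_(i < n) K (xi (iter i sh x)) (xi' (iter i sh x)).
    by apply: prodr_gt0 => i _.
  have := ln_le_pos (mulr_gt0 c0 p0) qc; rewrite lnM_pos//.
  rewrite (@ln_prod R n (fun i => K (xi (iter i sh x)) (xi' (iter i sh x))))//.
  rewrite /c lnV ?posrE ?exprn_gt0// lnXn//.
  have E1 : ln (l.+1%:R : R) *+ (n + p) = (n + p)%N%:R * ln l.+1%:R.
    by rewrite mulr_natl.
  rewrite E1.
  have E2 : bsum shT E n x = - \sum_(i < n) ln (K (xi (iter i sh x)) (xi' (iter i sh x))).
    rewrite -sumrN; apply: eq_bigr => i _; rewrite /E /K indicE.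
    case: eqP => [xx|xx].
      by rewrite memNset ?mulr0 ?addr0 ?lnV ?opprK ?posrE// => /(_ xx).
    by rewrite mem_set// mulr1 lnV ?posrE ?mulr_gt0// opprK lnM ?posrE.
  rewrite E2; lra.
have bs : bmf (fun x : T => (n + p)%N%:R * ln l.+1%:R + bsum shT E n x).
  by apply: bmfD; [exact: bmf_cst|exact: (bmf_bsum n hinv bE)].
apply: (le_trans (exp_le m (bmfN bq) bs step)).
rewrite expD ?exp_cst; [|exact: bmf_cst|exact: (bmf_bsum n hinv bE)].
rewrite exp_bsum// /E expD; [|exact: bmf_cst|by apply: bmfM; [exact: bmf_cst|exact: bmf_indic]].
rewrite exp_cst expZ; last exact: bmf_indic.
rewrite exp_indic// -/(pr m D).
have lnk : ln k.+1%:R * pr m D <= 1.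
  rewrite (@le_trans _ _ (k.+1%:R * k.+1%:R^-1))//; last by rewrite mulfV.
  apply: ler_pM => //; [by rewrite ln_ge0// ler1n | exact: pr_ge0|].
  have := @le_ln1Dx R k%:R; rewrite -natr1 addrC => /(_ _)/le_trans; apply.
    by rewrite (@lt_le_trans _ _ 0)// ltrN10.
  by rewrite ?lerDl ?lerDr.
have : n%:R * (ln 2 + ln k.+1%:R * pr m D) <= n%:R * (ln 2 + 1).
  by rewrite ler_wpM2l// lerD2l.
rewrite natrD; lra.
Qed.

Lemma entropy_finite : exists h, [/\ entropy m sh = h%:E, 0 <= h &
  forall k (xi : T -> 'I_k), measurable_partition xi -> entropy_wrt m sh xi <= h].
Proof.
pose A := [set h | exists k (xi : T -> 'I_k),
    measurable_partition xi /\ h = (entropy_wrt m sh xi)%:E].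
pose xi0 (x : T) : 'I_1 := ord0.
have mc : measurable_partition xi0.
  by move=> i; rewrite (_ : _ @^-1` _ = setT)//; apply/seteqP; split => x //= _; rewrite (ord1 i).
have A0 : A (entropy_wrt m sh xi0)%:E by exists 1%N, xi0.
have ub : (entropy m sh <= (ln l.+1%:R + (ln 2 + 1))%:E)%E.
  apply: ge_ereal_sup => _ [k [xi [mxi ->]]].
  by rewrite lee_fin; exact: entropy_wrt_bound.
have lb : (0 <= entropy m sh)%E.
  apply: le_trans (ereal_sup_ubound A0).
  by rewrite lee_fin; exact: entropy_wrt_ge0.
have fin : entropy m sh \is a fin_num.
  by rewrite ge0_fin_numE// (le_lt_trans ub)// ltry.
exists (fine (entropy m sh)); split; [by rewrite fineK|exact: fine_ge0|].
move=> k xi mxi; rewrite -lee_fin fineK//; apply: ereal_sup_ubound.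
by exists k, xi.
Qed.

End finite_entropy.

(** * Lyapunov dimension *)

Section lyapunov.
Variables (R : realType) (d l : nat) (hd : (0 < d)%N) (Z U : set 'rV[R]_d).
Variable f : 'I_l.+1 -> 'rV[R]_d -> 'rV[R]_d.
Hypothesis hf : C1_IFS Z U f.
Variable z : 'rV[R]_d.
Hypothesis hz : U z.
Local Notation T := (borelType (Sigma l)).
Local Notation sh := (@left_shift l).
Local Notation shT := (@left_shift l : T -> T).
Variable m : probability T R.
Hypothesis hinv : measure_preserving m sh.
Implicit Types (x y : Sigma l).

Local Notation J := (cjac f z).

Definition log_prod k n x : R := ln (alpha_prod (J n x) k).

Let Ju n x : J n x \in unitmx. Proof. exact: (cjac_unit hf hz). Qed.

Lemma log_prod_unif k n : (k <= d)%N -> unif_agree (log_prod k n).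
Proof.
move=> kd e e0; have [N NP] := alpha_prod_cjac_uniform hf hz n e0.
have H x y : agree N x y -> log_prod k n y <= log_prod k n x + e.
  by move=> xy; exact: (NP x y xy k kd).
exists N => x y xy; have := H x y xy; have := H y x (agree_sym xy).
move: (log_prod k n x) (log_prod k n y) => a b h1 h2.
by rewrite ler_norml; apply/andP; split; lra.
Qed.

Lemma log_prodS k n x : (k < d)%N ->
  log_prod k.+1 n x = log_prod k n x + ln (alpha (J n x) k).
Proof.
move=> kd; rewrite /log_prod /alpha_prod big_ord_recr/= lnM_pos//.
  exact: (alpha_prod_gt0 (Ju n x) (ltnW kd)).
exact: (alpha_gt0 (Ordinal kd) (Ju n x)).
Qed.

Lemma alpha_log_bounds : exists b c, [/\ c < 0 & forall n x i, (i < d)%N ->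
  b * n%:R <= ln (alpha (J n x) i) <= c * n%:R].
Proof.
have [b [c [b0 c0 c1 bc]]] := cjac_bounds hf hz.
exists (ln b), (ln c); split; first by rewrite ln_lt0// c0.
move=> n x i id; have /andP[h1 h2] := bc n x (Ordinal id).
have a0 : 0 < alpha (J n x) i := alpha_gt0 (Ordinal id) (Ju n x).
have bn0 : 0 < b ^+ n by rewrite exprn_gt0.
rewrite !mulr_natr -!lnXn//; apply/andP; split; first exact: (ln_le_pos bn0 h1).
exact: (ln_le_pos a0 h2).
Qed.

Lemma log_prodE k n x : (k <= d)%N -> log_prod k n x = \sum_(i < k) ln (alpha (J n x) i).
Proof.
move=> kd; apply: ln_prod => i ik.
exact: (alpha_gt0 (Ordinal (leq_trans ik kd)) (Ju n x)).
Qed.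

Lemma log_prod_bmf k n : (k <= d)%N -> bmf (log_prod k n : T -> R).
Proof.
move=> kd; split; first by apply: unif_agree_measurable; apply: log_prod_unif.
have [b [c [c0 bc]]] := alpha_log_bounds.
exists (\sum_(i < k) (`|b| + `|c|) * n%:R) => x; rewrite log_prodE//.
apply: (le_trans (ler_norm_sum _ _ _)); apply: ler_sum => i _.
have /andP[h1 h2] := bc n x i (leq_trans (ltn_ord i) kd).
move: (ln (alpha (J n x) i)) h1 h2 => a h1 h2.
rewrite mulrDl ler_norml; apply/andP; split.
  apply: le_trans h1; rewrite lerNl.
  have : - (b * n%:R) <= `|b| * n%:R by rewrite -mulNr ler_wpM2r// (le_trans (ler_norm _))// normrN.
  by have : 0 <= `|c| * n%:R by []; lra.
apply: (le_trans h2).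
have : c * n%:R <= `|c| * n%:R by rewrite ler_wpM2r// ler_norm.
by have : 0 <= `|b| * n%:R by []; lra.
Qed.

(** Horn's inequality along the cocycle and invariance of [m] make the integrals subadditive in
    n. *)
Lemma log_prod_cvg k : (k <= d)%N ->
  exists a : R, (fun n : nat => n%:R^-1 * \int[m]_x log_prod k n x) @ \oo --> a.
Proof.
move=> kd; have [b [c [c0 bc]]] := alpha_log_bounds.
apply: (@fekete R (fun n => \int[m]_x log_prod k n x) (- (k%:R * b))).
  move=> p n /=.
  have hp := measure_preserving_iter p hinv.
  have bn := log_prod_bmf n kd; have bp := log_prod_bmf p kd.
  have bc1 : bmf (fun x : T => log_prod k n (iter p shT x)) := bmf_comp (proj1 hp) bn.
  have E1 : \int[m]_x (log_prod k n (iter p shT x) + log_prod k p x) =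
      \int[m]_x log_prod k p x + \int[m]_x log_prod k n x.
    have E2 := exp_comp hp bn.
    apply: etrans (expD m bc1 bp) _.
    apply: etrans (addrC _ _) _.
    exact: (congr1 (fun a => _ + a) E2).
  rewrite -E1; apply: (exp_le m (log_prod_bmf (p + n) kd) (bmfD bc1 bp)) => x.
  have Jp := Ju p x; have Jn := Ju n (iter p sh x).
  have Pp := alpha_prod_gt0 Jp kd; have Pn := alpha_prod_gt0 Jn kd.
  have JE : J (p + n) x = J n (iter p sh x) *m J p x := cjacD hf hz p n x.
  have PE : alpha_prod (J (p + n) x) k <= alpha_prod (J n (iter p sh x)) k * alpha_prod (J p x) k.
    by rewrite JE; exact: (alpha_prodM Jn Jp kd).
  have := ln_le_pos (alpha_prod_gt0 (Ju (p + n) x) kd) PE.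
  rewrite (lnM_pos Pn Pp); exact.
move=> n; rewrite opprK -(exp_cst m (k%:R * b * n%:R)).
apply: exp_le; [exact: bmf_cst|exact: log_prod_bmf|].
move=> x; rewrite log_prodE//.
have -> : k%:R * b * n%:R = \sum_(i < k) b * n%:R.
  by rewrite sumr_const card_ord -mulrA mulr_natl.
by apply: ler_sum => i _; have /andP[] := bc n x i (leq_trans (ltn_ord i) kd).
Qed.

(** Single singular values are not submultiplicative in general, but the products [alpha_prod] are;
    writing a logarithm as a difference of two [log_prod] transfers measurability and convergence to
    phi^s. *)
Lemma log_svfE s n x : 0 <= s -> log_svf f z s n x =
  \sum_(i < d) svweight d s i * (log_prod i.+1 n x - log_prod i n x).
Proof.
move=> s0; rewrite /log_svf -/(cjac f z n x) (ln_singular_value_fun hd (Ju n x) s0).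
by apply: eq_bigr => i _; rewrite log_prodS// addrC addKr.
Qed.

Lemma log_svf_bmf s n : 0 <= s -> bmf (log_svf f z s n : T -> R).
Proof.
move=> s0; have -> : log_svf f z s n = fun x => \sum_(i < d)
    svweight d s i * (log_prod i.+1 n x - log_prod i n x).
  by apply/funext => x; rewrite log_svfE.
apply: bmf_sum => i; apply: bmfM; first exact: bmf_cst.
apply: bmfD; first exact: log_prod_bmf.
by apply: bmfN; apply: log_prod_bmf; exact: ltnW.
Qed.

Lemma log_svf_unif s n : 0 <= s -> unif_agree (log_svf f z s n).
Proof.
move=> s0 e e0; pose W := \sum_(i < d) svweight d s i * 2.
have W0 : 0 <= W by apply: sumr_ge0 => i _; rewrite mulr_ge0// svweight_ge0.
have W1 : 0 < W + 1 by rewrite ltr_wpDl.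
have e'0 : 0 < e / (W + 1) by rewrite divr_gt0.
have [N NP] : exists N, forall k, (k <= d)%N -> forall x y, agree N x y ->
    `|log_prod k n x - log_prod k n y| <= e / (W + 1).
  have : forall k : 'I_d.+1, exists N, forall x y, agree N x y ->
    `|log_prod k n x - log_prod k n y| <= e / (W + 1).
    by move=> k; apply: log_prod_unif => //; rewrite -ltnS.
  move=> /choice[N NP]; exists (\max_k N k) => k kd x y xy.
  apply: (NP (Ordinal (kd : (k < d.+1)%N))); apply: agree_le xy.
  exact: (leq_bigmax (Ordinal (kd : (k < d.+1)%N))).
exists N => x y xy; rewrite !log_svfE// -sumrB.
apply: (le_trans (ler_norm_sum _ _ _)).
apply: (@le_trans _ _ (\sum_(i < d) svweight d s i * 2 * (e / (W + 1)))).
  apply: ler_sum => i _; rewrite -mulrBr normrM (ger0_norm (svweight_ge0 _ _ _)).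
  rewrite -mulrA ler_wpM2l ?svweight_ge0//.
  have h1 := NP i.+1 (ltn_ord i) x y xy; have h2 := NP i (ltnW (ltn_ord i)) x y xy.
  move: (log_prod i.+1 n x) (log_prod i.+1 n y) (log_prod i n x) (log_prod i n y) h1 h2.
  move: (e / (W + 1)) => e' a1 b1 a0 b0.
  rewrite !ler_norml => /andP[? ?] /andP[? ?]; apply/andP; split; lra.
rewrite -mulr_suml -/W mulrA ler_pdivrMr// mulrC ler_wpM2l ?(ltW e0)//.
by rewrite lerDl.
Qed.

(** The numbers [chi i] are the Lyapunov exponents, obtained as differences of the growth rates of
    successive [alpha_prod]; contraction makes them uniformly negative. The growth of phi^s is
    thereby explicit in s. *)
Lemma svf_growth_spec : exists chi : nat -> R, exists2 c : R, c < 0 &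
  (forall i, (i < d)%N -> chi i <= c) /\
  forall s, 0 <= s ->
    (fun n : nat => n%:R^-1 * \int[m]_x log_svf f z s n x) @ \oo -->
    \sum_(i < d) svweight d s i * chi i.
Proof.
have [b [c [c0 bc]]] := alpha_log_bounds.
have [L LP] : exists L : nat -> R, forall k, (k <= d)%N ->
    (fun n : nat => n%:R^-1 * \int[m]_x log_prod k n x) @ \oo --> L k.
  have : forall k : nat, exists a : R, (k <= d)%N ->
    (fun n : nat => n%:R^-1 * \int[m]_x log_prod k n x) @ \oo --> a.
    move=> k; have [kd|] := leqP k d; last by exists 0.
    by have [a aP] := log_prod_cvg kd; exists a.
  by move=> /choice[L LP]; exists L.
exists (fun i => L i.+1 - L i), c => //; split.
  move=> i id.
  apply: (ler_cvg_to (cvgB (LP i.+1 id) (LP i (ltnW id))) (cvg_cst c)).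
  near=> n; rewrite /= -mulrBr.
  have n0 : 0 < n%:R :> R by rewrite ltr0n; near: n; exact: nbhs_infty_gt.
  rewrite ler_pdivrMl// lerBlDr -(exp_cst m (n%:R * c)) -expD; last 2 first.
  - exact: bmf_cst.
  - by apply: log_prod_bmf; exact: ltnW.
  apply: exp_le; [exact: log_prod_bmf| |].
    by apply: bmfD; [exact: bmf_cst|apply: log_prod_bmf; exact: ltnW].
  move=> x; rewrite log_prodS// addrC lerD2r mulrC.
  by have /andP[] := bc n x i id.
move=> s s0.
have -> : (fun n : nat => n%:R^-1 * \int[m]_x log_svf f z s n x) =
   (fun n : nat => \sum_(i < d) svweight d s i *
     (n%:R^-1 * \int[m]_x log_prod i.+1 n x - n%:R^-1 * \int[m]_x log_prod i n x)).
  apply/funext => n; under eq_Rintegral do rewrite log_svfE//.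
  have bi (i : 'I_d) : bmf (fun x : T => log_prod i.+1 n x - log_prod i n x).
    by apply: bmfD; [exact: log_prod_bmf|apply: bmfN; apply: log_prod_bmf; exact: ltnW].
  rewrite exp_sum; last by move=> i; apply: bmfM => //; exact: bmf_cst.
  rewrite mulr_sumr; apply: eq_bigr => i _; rewrite expZ// mulrCA -mulrBr.
  rewrite expD; [|exact: log_prod_bmf|by apply: bmfN; apply: log_prod_bmf; exact: ltnW].
  by rewrite expN//; apply: log_prod_bmf; exact: ltnW.
apply: cvg_big => [|i _]; [exact: add_continuous|apply: cvgM; first exact: cvg_cst].
by apply: cvgB; apply: LP => //; exact: ltnW.
Unshelve. all: end_near. Qed.

Lemma svf_growthE s a : 0 <= s ->
  (fun n : nat => n%:R^-1 * \int[m]_x log_svf f z s n x) @ \oo --> a ->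
  svf_growth f z m s = a%:E.
Proof.
move=> s0 ca; rewrite /svf_growth; apply: cvg_lim => //.
have -> : (fun n : nat => (n%:R^-1)%:E * \int[m]_x (log_svf f z s n x)%:E)%E =
  EFin \o (fun n : nat => n%:R^-1 * \int[m]_x log_svf f z s n x).
  by apply/funext => n; rewrite /= bmf_integralE//; exact: log_svf_bmf.
by apply: cvg_comp ca _.
Qed.

(** The intermediate value theorem yields a root, so [xget] does not return its default by accident.
    Above the root h + G is negative by strict decrease, and the entropy rate of a partition is at
    most h, so the sum of the two rates is negative as well. *)
Lemma lyapunov_dim_spec : 0 <= lyapunov_dim f z m /\
  forall xi, measurable_partition (xi : T -> 'I_l.+1) ->
  forall t, lyapunov_dim f z m < t -> exists2 gam, 0 < gam & \forall n \near \oo,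
    partition_entropy m shT xi n + \int[m]_x log_svf f z t n x <= - gam * n%:R.
Proof.
have [h [hE h0 hP]] := entropy_finite hinv.
have [chi [c c0 [chic chiP]]] := svf_growth_spec.
pose G s := \sum_(i < d) svweight d s i * chi i.
have Gle s t : 0 <= s -> s <= t -> G t <= G s + (t - s) * c.
  move=> s0 st; rewrite addrC -lerBlDr -sumrB.
  have -> : (t - s) * c = \sum_(i < d) (svweight d t i - svweight d s i) * c.
    by rewrite -mulr_suml sumrB !svweight_sum// (le_trans s0).
  apply: ler_sum => i _; rewrite -mulrBl ler_wpM2l ?chic//.
  by rewrite subr_ge0 svweight_nd.
have G0 : G 0 = 0.
  rewrite /G big1// => i _; suff -> : svweight d 0 i = 0 :> R by rewrite mul0r.
  apply/eqP; rewrite eq_le svweight_ge0 andbT -[leRHS](@svweight_sum R d 0 hd)//.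
  by rewrite (bigD1 i)//= lerDl sumr_ge0// => j _; exact: svweight_ge0.
have Gc : continuous G.
  move=> s; apply: cvg_big => [|i _]; [exact: add_continuous|apply: cvgM; last exact: cvg_cst].
  exact: continuous_svweight.
have [s0 Ls] : 0 <= lyapunov_dim f z m /\
    (entropy m sh + svf_growth f z m (lyapunov_dim f z m) = 0)%E.
  suff : exists s, 0 <= s /\ (entropy m sh + svf_growth f z m s = 0)%E.
    by move=> /(xgetPex 0).
  (* Since G t <= c t, the value of G has dropped to -h by this point. *)
  pose t := h / - c; have t0 : 0 <= t by rewrite divr_ge0// oppr_ge0 ltW.
  have Gt : G t <= - h.
    apply: (le_trans (Gle 0 t (lexx _) t0)); rewrite G0 add0r subr0 /t.
    by rewrite invrN mulrN mulNr divfK ?lt_eqF.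
  have [||s] := @IVT R G 0 t (- h) t0.
  - by apply: continuous_subspaceT => s; exact: Gc.
  - by rewrite ge_min le_max G0 Gt orbT oppr_le0 h0.
  rewrite in_itv/= => /andP[s0 _] Gs; exists s; split => //.
  by rewrite hE (svf_growthE s0 (chiP s s0)) -/(G s) Gs -EFinD subrr.
split => // xi mxi t st; have t0 : 0 <= t := le_trans s0 (ltW st).
move: Ls; rewrite hE (svf_growthE s0 (chiP _ s0)) -/(G _) -EFinD => -[Ls].
set s := lyapunov_dim f z m in s0 st Ls *.
have ht : h + G t < 0.
  have := Gle s t s0 (ltW st); have : (t - s) * c < 0 by rewrite nmulr_llt0 ?subr_gt0.
  by lra.
have cv := cvgD (entropy_wrt_cvg hinv mxi) (chiP t t0).
(* Half of the gap at t; the other half absorbs the error of convergence at finite n. *)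
exists (- (h + G t) / 2); first by rewrite divr_gt0// oppr_gt0.
have lim_lt : entropy_wrt m shT xi + G t < (h + G t) / 2.
  by have := hP _ _ mxi; lra.
have ev := cvgr_lt _ (cv _) _ lim_lt.
near=> n.
have n0 : 0 < n%:R :> R by rewrite ltr0n; near: n; exact: nbhs_infty_gt.
have : n%:R^-1 * partition_entropy m shT xi n + n%:R^-1 * \int[m]_x log_svf f z t n x
   < (h + G t) / 2 by near: n; exact: ev.
rewrite -mulrDr ltr_pdivrMl// => /ltW; lra.
Unshelve. all: end_near. Qed.

End lyapunov.

(** * Covers by words *)

Section word_sums.
Variables (R : realType) (l : nat).
Implicit Types (x y : Sigma l).
Local Notation T := (borelType (Sigma l)).
Local Notation sh := (@left_shift l).

Definition ext n (w : {ffun 'I_n -> 'I_l.+1}) : Sigma l :=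
  fun i => if insub i is Some j then w j else ord0.

Definition prefix_of n x : {ffun 'I_n -> 'I_l.+1} := [ffun i : 'I_n => x i].

Lemma ext_lt n (w : {ffun 'I_n -> 'I_l.+1}) (i : 'I_n) : ext w i = w i.
Proof. by rewrite /ext insubT//= => p; congr (w _); apply/val_inj. Qed.

Lemma ext_ge n (w : {ffun 'I_n -> 'I_l.+1}) i : (n <= i)%N -> ext w i = ord0.
Proof. by move=> ni; rewrite /ext insubF// ltnNge ni. Qed.

Lemma ext_prefix n x : agree n x (ext (prefix_of n x)).
Proof. by move=> i ni; rewrite (ext_lt _ (Ordinal ni)) ffunE. Qed.

Lemma cylinder_bmf n (F : T -> R) : (forall x y, agree n x y -> F x = F y) -> bmf F.
Proof.
move=> FF; have -> : F = fun x : T => F (ext (prefix_of n x)).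
  by apply/funext => x; exact/FF/ext_prefix.
apply: (bmf_label (lab := prefix_of n : T -> _) (fun w => F (ext w))) => w.
apply: (@determined_measurable l n) => x y xy /= <-.
by apply/ffunP => i; rewrite !ffunE xy.
Qed.

Definition wsum n (G : Sigma l -> R) : R := \sum_(w : {ffun 'I_n -> 'I_l.+1}) G (ext w).

Definition glue a b (u : {ffun 'I_a -> 'I_l.+1}) (v : {ffun 'I_b -> 'I_l.+1}) :
    {ffun 'I_(a + b) -> 'I_l.+1} :=
  [ffun i => match fintype.split i with inl j => u j | inr j => v j end].

Lemma glue_agree a b (u : {ffun 'I_a -> 'I_l.+1}) (v : {ffun 'I_b -> 'I_l.+1}) :
  agree a (ext u) (ext (glue u v)).
Proof.
move=> i ia; rewrite (ext_lt u (Ordinal ia)).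
rewrite (ext_lt (glue u v) (lshift b (Ordinal ia))) ffunE.
by rewrite (unsplitK (inl _)).
Qed.

Lemma glue_shift a b (u : {ffun 'I_a -> 'I_l.+1}) (v : {ffun 'I_b -> 'I_l.+1}) :
  iter a sh (ext (glue u v)) = ext v.
Proof.
apply/funext => i; rewrite iter_shiftE; have [ib|bi] := ltnP i b; last first.
  by rewrite !ext_ge// leq_add2l.
rewrite (ext_lt v (Ordinal ib)) (ext_lt (glue u v) (rshift a (Ordinal ib))) ffunE.
by rewrite (unsplitK (inr _)).
Qed.

Lemma wsum_split a b G : wsum (a + b) G =
  \sum_(u : {ffun 'I_a -> 'I_l.+1}) \sum_(v : {ffun 'I_b -> 'I_l.+1}) G (ext (glue u v)).
Proof.
rewrite pair_big/= /wsum (reindex (fun p : {ffun 'I_a -> 'I_l.+1} *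
  {ffun 'I_b -> 'I_l.+1} => glue p.1 p.2))//=.
exists (fun w => ([ffun i => w (lshift b i)], [ffun i => w (rshift a i)])) => [[u v] _|w _] /=.
  congr pair; apply/ffunP => i; rewrite !ffunE.
    by rewrite (unsplitK (inl _)).
  by rewrite (unsplitK (inr _)).
by apply/ffunP => i; rewrite ffunE; case: split_ordP => j ->; rewrite ffunE.
Qed.

Lemma wsum_block a b (F H : Sigma l -> R) : (forall x y, agree a x y -> F x = F y) ->
  wsum (a + b) (fun x => F x * H (iter a sh x)) = wsum a F * wsum b H.
Proof.
move=> Fa; rewrite wsum_split /wsum mulr_suml; apply: eq_bigr => u _.
rewrite mulr_sumr; apply: eq_bigr => v _.
by rewrite glue_shift (Fa _ _ (glue_agree u v)).
Qed.

Lemma wsum1 n : wsum n (fun=> 1) = (l.+1%:R ^+ n).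
Proof. by rewrite /wsum sumr_const card_ffun !card_ord -natrX. Qed.

Lemma agree_block n0 p0 N x y i : (i < N)%N -> agree (N * n0 + p0) x y ->
  agree (n0 + p0) (iter i (iter n0 sh) x) (iter i (iter n0 sh) y).
Proof.
move=> iN xy; have itE w : iter i (iter n0 sh) w = iter (i * n0) sh w by rewrite iterM.
rewrite !itE; apply: agree_shift; apply: agree_le xy.
by rewrite addnA leq_add2r -mulSnr leq_mul2r iN orbT.
Qed.

(** Applied to word masses: their sum over one block is 1, so products of block masses sum to 1 over
    N blocks, whatever the dependence between blocks. The [p0] trailing letters are free and
    contribute one factor [l.+1] each. *)
Lemma wsum_prod n0 p0 N (F : Sigma l -> R) : (forall x y, agree n0 x y -> F x = F y) ->
  wsum n0 F = 1 ->
  wsum (N * n0 + p0) (fun x => \prod_(i < N) F (iter i (iter n0 sh) x)) = l.+1%:R ^+ p0.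
Proof.
move=> Fn0 F1; elim: N => [|N IH].
  by rewrite -wsum1; apply: eq_bigr => w _; rewrite big_ord0.
rewrite mulSn -addnA.
transitivity (wsum n0 F * wsum (N * n0 + p0) (fun x => \prod_(i < N) F (iter i (iter n0 sh) x)));
  last by rewrite F1 mul1r.
rewrite -(wsum_block _ _ Fn0).
apply: eq_bigr => w _; rewrite big_ord_recl/=; congr (_ * _).
by apply: eq_bigr => i _; rewrite -iterSr.
Qed.

End word_sums.

Lemma prod_iter (R : realType) (T : Type) (S : T -> T) (F : T -> R) N x :
  \prod_(i < N.+1) F (iter i S x) = F x * \prod_(i < N) F (iter i S (S x)).
Proof.
by rewrite big_ord_recl; congr (_ * _); apply: eq_bigr => i _; rewrite -iterSr.
Qed.

Section covers.
Variables (R : realType) (d l : nat) (Z U : set 'rV[R]_d).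
Variable f : 'I_l.+1 -> 'rV[R]_d -> 'rV[R]_d.
Hypothesis hf : C1_IFS Z U f.
Variable z : 'rV[R]_d.
Hypothesis hz : U z.
Implicit Types (x y : Sigma l).
Local Notation sh := (@left_shift l).
Local Notation X := (coding f z).
Local Notation J := (cjac f z).

(** One label type ['I_K] serves all sets [S i], so that labels of successive blocks can be combined
    in a product type. *)
Lemma linear_cover_family (A : 'M[R]_d) (k : 'I_d) (r : R) (I : Type)
    (S : I -> set 'rV[R]_d) :
  A \in unitmx -> 0 < r ->
  (forall i p q, S i p -> S i q -> enorm (p - q) <= r) ->
  exists (K : nat) (kappa : I -> 'rV[R]_d -> 'I_K),
    K%:R <= 4 ^+ d * alpha_prod A k / alpha A k ^+ k /\
    forall i p q, S i p -> S i q -> kappa i p = kappa i q ->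
      enorm ((p - q) *m A) <= d%:R * alpha A k * r.
Proof.
move=> Au r0 Sr; set M := 4 ^+ d * _ / _.
have M0 : 0 <= M.
  apply: mulr_ge0; last by rewrite invr_ge0 exprn_ge0// alpha_ge0.
  by apply: mulr_ge0; [exact: exprn_ge0|exact: alpha_prod_ge0].
have /choice[kappa kP] : forall i, exists kap : 'rV[R]_d -> 'I_(Num.truncn M),
    forall p q, S i p -> S i q -> kap p = kap q ->
      enorm ((p - q) *m A) <= d%:R * alpha A k * r.
  move=> i.
  have [L [kap [LM kapP]]] := linear_cover k Au r0 (Sr i).
  have LK : (#|L| <= Num.truncn M)%N by rewrite (truncn_ge_nat _ M0).
  exists (fun p => widen_ord LK (enum_rank (kap p))) => p q Sp Sq e.
  apply: (kapP _ _ Sp Sq); apply: enum_rank_inj.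
  by apply: val_inj; exact: (congr1 val e).
exists (Num.truncn M), kappa; split; last exact: kP.
by rewrite truncn_le.
Qed.

Variables (n0 p0 : nat) (k : 'I_d).
Let T0 := iter n0 sh.
Let tau : Sigma l -> Sigma l := trunc (n0 + p0).

(* The code is truncated so that the data of a block depend on finitely many
   letters only; the truncated code satisfies the same estimates. *)
Definition cover_number x : R :=
  4 ^+ d * alpha_prod (J n0 (tau x)) k / alpha (J n0 (tau x)) k ^+ k.

(** In [d.+1] the part d is the linear cover and the extra 1 is the deviation of the map from its
    differential, whose relative size [e] is at most [alpha]. *)
Definition cover_scale x : R := d.+1%:R * alpha (J n0 (tau x)) k.

Let Ju n x : J n x \in unitmx. Proof. exact: (cjac_unit hf hz). Qed.

Lemma cover_scale_gt0 x : 0 < cover_scale x.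
Proof.
rewrite /cover_scale.
have a0 : 0 < alpha (J n0 (tau x)) k := alpha_gt0 k (Ju n0 (tau x)).
move: (alpha (J n0 (tau x)) k) a0 => a a0.
by rewrite mulr_gt0.
Qed.

Lemma cover_number_gt0 x : 0 < cover_number x.
Proof.
rewrite /cover_number.
have a0 : 0 < alpha (J n0 (tau x)) k := alpha_gt0 k (Ju n0 (tau x)).
have P0 : 0 < alpha_prod (J n0 (tau x)) k.
  exact: (alpha_prod_gt0 (Ju n0 (tau x)) (ltnW (ltn_ord k))).
move: (alpha (J n0 (tau x)) k) (alpha_prod (J n0 (tau x)) k) a0 P0 => a p a0 P0.
by rewrite divr_gt0 ?mulr_gt0 ?exprn_gt0.
Qed.

Lemma cover_number_cyl x y : agree (n0 + p0) x y -> cover_number x = cover_number y.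
Proof. by move=> /agree_truncE xy; rewrite /cover_number /tau xy. Qed.

Lemma cover_scale_cyl x y : agree (n0 + p0) x y -> cover_scale x = cover_scale y.
Proof. by move=> /agree_truncE xy; rewrite /cover_scale /tau xy. Qed.

Variables (D e r0 : R).
Hypothesis XD : forall x y, enorm (X x - X y) <= D.
Hypothesis D0 : 0 < D.
Hypothesis ea : forall x, e <= alpha (J n0 x) k.
Hypothesis Xr0 : forall x y, agree p0 x y -> enorm (X x - X y) <= r0.
Hypothesis lin : forall x p q,
  enorm (p - X (T0 x)) <= r0 -> enorm (q - X (T0 x)) <= r0 ->
  enorm (fword f x n0 p - fword f x n0 q - (p - q) *m J n0 x) <= e * enorm (p - q).

Definition scales N x : R := D * \prod_(i < N) cover_scale (iter i T0 x).

Lemma scales_gt0 N x : 0 < scales N x.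
Proof. by apply: mulr_gt0 D0 _; apply: prodr_gt0 => i _; exact: cover_scale_gt0. Qed.

Lemma scalesS N x : scales N.+1 x = cover_scale x * scales N (T0 x).
Proof.
rewrite /scales.
rewrite prod_iter; exact: mulrCA.
Qed.

(* A set of codes agreeing on N blocks is cut one block at a time, starting
   from the last one: on the pieces of the later blocks the map of the first
   block is nearly affine. *)
Lemma cylinder_cover N x : exists (L : finType) (kappa : Sigma l -> L),
  #|L|%:R <= \prod_(i < N) cover_number (iter i T0 x) /\
  forall y y', agree (N * n0 + p0) x y -> agree (N * n0 + p0) x y' ->
    kappa y = kappa y' -> enorm (X y - X y') <= scales N x.
Proof.
elim: N x => [|N IH] x.
  exists unit, (fun=> tt); rewrite card_unit /scales !big_ord0 mulr1.
  by split => // y y' _ _ _; exact: XD.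
have [L [kap [LM kapP]]] := IH (T0 x).
have xT y : agree (N.+1 * n0 + p0) x y -> agree (N * n0 + p0) (T0 x) (T0 y).
  by move=> xy; apply: agree_shift; rewrite addnA -mulSn.
pose S (j : L) : set 'rV[R]_d := [set p | exists y, [/\ agree (N.+1 * n0 + p0) x y,
  kap (T0 y) = j & p = X (T0 y)]].
have Sr j p q : S j p -> S j q -> enorm (p - q) <= scales N (T0 x).
  move=> [y [xy yj ->]] [y' [xy' yj' ->]].
  by apply: kapP; [exact: xT|exact: xT|rewrite yj yj'].
have [K [mu [KM muP]]] := linear_cover_family k (Ju n0 (tau x)) (scales_gt0 N (T0 x)) Sr.
exists (L * 'I_K)%type, (fun y => (kap (T0 y), mu (kap (T0 y)) (X (T0 y)))); split.
  rewrite card_prod card_ord natrM mulrC prod_iter.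
  exact: (ler_pM (ler0n _ _) (ler0n _ _) KM LM).
move=> y y' xy xy' [kyy' muyy'].
(* Codes of the cylinder share [n0 + p0] letters with [tau x]: the first [n0] give the same map, the
   next [p0] put the images of the shifted codes within [r0] of [X (T0 (tau x))], where [lin]
   applies. *)
have xxt := @trunc_agree l (n0 + p0) x.
have le0 : (n0 + p0 <= N.+1 * n0 + p0)%N by rewrite leq_add2r mulSn leq_addr.
have ty u : agree (N.+1 * n0 + p0) x u -> agree (n0 + p0) (tau x) u.
  move=> /(agree_le le0) xu; exact: agree_trans (agree_sym xxt) xu.
have near u : agree (N.+1 * n0 + p0) x u -> enorm (X (T0 u) - X (T0 (tau x))) <= r0.
  move=> /ty xu; apply: Xr0; apply: agree_shift; exact: agree_sym.
have XE u : agree (N.+1 * n0 + p0) x u -> X u = fword f (tau x) n0 (X (T0 u)).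
  move=> /ty xu; rewrite (coding_shift hf hz u n0).
  by rewrite (agree_fword f (agree_le (leq_addr p0 n0) xu)).
rewrite (XE _ xy) (XE _ xy') scalesS.
have Sy : S (kap (T0 y)) (X (T0 y)) by exists y.
have Sy' : S (kap (T0 y)) (X (T0 y')) by exists y'.
have h1 := lin (near _ xy) (near _ xy').
have h2 : enorm ((X (T0 y) - X (T0 y')) *m J n0 (tau x)) <=
    d%:R * alpha (J n0 (tau x)) k * scales N (T0 x).
  by apply: (muP (kap (T0 y))) => //; rewrite muyy' kyy'.
have h3 := Sr _ _ _ Sy Sy'.
have h4 := ea (tau x).
have h0 := alpha_ge0 (J n0 (tau x)) k.
rewrite /cover_scale; move: (alpha (J n0 (tau x)) k) h0 h2 h4 => a h0 h2 h4.
move: (fword f (tau x) n0 (X (T0 y))) (fword f (tau x) n0 (X (T0 y'))) h1 => u v h1.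
rewrite -(subrK ((X (T0 y) - X (T0 y')) *m J n0 (tau x)) (u - v)).
apply: (le_trans (enormD _ _)).
have h5 : e * enorm (X (T0 y) - X (T0 y')) <= a * scales N (T0 x).
  apply: (le_trans (ler_wpM2r (enorm_ge0 _) h4)).
  exact: ler_wpM2l h3.
apply: (le_trans (lerD (le_trans h1 h5) h2)).
by rewrite -[d.+1%:R]natr1; move: (scales N (T0 x)) => r; lra.
Qed.

End covers.

(** * Local dimension *)

Section almost_everywhere.
Context {disp : measure_display} {T : measurableType disp} {R : realType}.
Variable P : probability T R.

Lemma ae_prob1 (A : set T) : measurable A -> P A = 1%E -> {ae P, forall x, A x}.
Proof.
move=> mA PA; exists (~` A); split; first exact: measurableC.
  by rewrite probability_setC// PA subee.
by move=> x /=.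
Qed.

Lemma borel_cantelli (V : nat -> set T) C : (forall N, measurable (V N)) ->
  (forall N, pr P (V N) <= C / 2 ^+ N) ->
  {ae P, forall x, exists N0, forall N, (N0 <= N)%N -> ~ V N x}.
Proof.
move=> mV VC; exists (lim_sup_set V); split.
- by apply: bigcapT_measurable => N; exact: bigcup_measurable.
- apply: lim_sup_set_cvg0 => //.
  have cC : series (geometric C 2^-1) @ \oo --> C * (1 - 2^-1)^-1.
    by apply: cvg_geometric_series; rewrite ger0_norm ?invf_lt1 ?ltr1n.
  apply: (@le_lt_trans _ _ (C * (1 - 2^-1)^-1)%:E); last exact: ltry.
  rewrite -(cvg_lim _ cC)// -EFin_lim; last by apply/cvgP; exact: cC.
  apply: lee_lim; first exact: is_cvg_nneseries.
    by apply/cvgP; apply: cvg_EFin cC; exact: nearW.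
  apply: nearW => n; rewrite /= /series/= -sumEFin; apply: lee_sum => i _.
  by rewrite prE// lee_fin exprVn.
- move=> x /= /forallNP xV N _.
  by have /existsNP[i /not_implyP[Ni /contrapT Vi]] := xV N; exists i.
Qed.

End almost_everywhere.

Section union_bound.
Context {disp : measure_display} {T : measurableType disp} {R : realType}.
Variable P : probability T R.

(** A union bound for outer measure, stated through measurable supersets; the sets of bad codes
    below are estimated in this form. *)
Lemma pr_cover (L : finType) (B : L -> set T) (E : set T) (c : L -> R) :
  (forall i, exists V, [/\ measurable V, pr P V <= c i & B i `<=` V]) ->
  E `<=` [set x | exists i, B i x] ->
  exists V, [/\ measurable V, pr P V <= \sum_i c i & E `<=` V].
Proof.
move=> /choice[V VP] EB; exists [set x | exists i, V i x].
have [mV prV] := pr_exists P (fun i => let: And3 h _ _ := VP i in h).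
split => //; first by apply: (le_trans prV); apply: ler_sum => i _; case: (VP i).
by move=> x /EB[i Bi]; exists i; case: (VP i) => _ _; apply.
Qed.

End union_bound.

(** * From covers by words to the mass of small balls *)

Section local_dimension.
Variables (R : realType) (d l : nat).
Local Notation T := (borelType (Sigma l)).
Local Notation sh := (@left_shift l).
Local Notation shT := (@left_shift l : T -> T).
Variable m : probability T R.
Hypothesis hinv : measure_preserving m sh.
Hypothesis herg : ergodic m sh.
Implicit Types (x y : Sigma l).

Let xi (x : T) : 'I_l.+1 := x 0%N.

Lemma mpartition_letter : measurable_partition (xi : T -> 'I_l.+1).
Proof.
move=> i; apply: (@determined_measurable l 1) => x y xy /= <-.
by rewrite /xi xy.
Qed.

Variables (n0 p0 : nat).
Hypothesis n00 : (0 < n0)%N.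
Let T0 := iter n0 sh.
Let word : T -> {ffun 'I_n0 -> 'I_l.+1} := itinerary shT xi n0.

Definition word_mass x : R := pmass m word (word x).

Lemma word_cyl x y : agree n0 x y -> word x = word y.
Proof. by move=> xy; apply/ffunP => i; rewrite !ffunE /xi !iter_shiftE addn0 xy. Qed.

Lemma word_mass_cyl x y : agree n0 x y -> word_mass x = word_mass y.
Proof. by move=> xy; rewrite /word_mass (word_cyl xy). Qed.

Lemma word_ext w : word (ext w) = w.
Proof. by apply/ffunP => i; rewrite ffunE /xi iter_shiftE addn0 ext_lt. Qed.

Lemma mlabel_word : mlabel word.
Proof. exact: (mlabel_itinerary hinv mpartition_letter (n := n0)). Qed.

Lemma wsum_word_mass : wsum n0 word_mass = 1.
Proof.
rewrite -(pmass_sum m mlabel_word) /wsum.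
by apply: eq_bigr => w _; rewrite /word_mass word_ext.
Qed.

Lemma word_mass_ge0 x : 0 <= word_mass x. Proof. exact: pmass_ge0. Qed.

(** Finitely many words of mass zero cover a null set. Along the remaining orbits [ln] of a word
    mass is a true logarithm and not the default ln 0 = 0. *)
Lemma ae_word_mass_gt0 : {ae m, forall x, forall i, 0 < word_mass (iter i sh x)}.
Proof.
have [V [mV V0 VP]] : exists V : set T, [/\ measurable V,
    pr m V <= \sum_(w : {ffun 'I_n0 -> 'I_l.+1}) 0 &
    [set x | word_mass x = 0] `<=` V].
  apply: (@pr_cover _ _ _ m _ (fun w => [set x | word x = w /\ pmass m word w = 0])).
    move=> w; have [w0|w0] := eqVneq (pmass m word w) 0.
      exists (word @^-1` [set w]); split; [exact: mlabel_word| |by move=> x []].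
      by rewrite -w0.
    exists set0; split => //; first by rewrite /pr measure0.
    by move=> x [_] /eqP; rewrite (negbTE w0).
  by move=> x x0; exists (word x).
apply: ae_foralln => i; have [mi iP] := measure_preserving_iter i hinv.
exists (iter i shT @^-1` V); split.
- by rewrite -[X in measurable X]setTI; exact: mi.
- transitivity (m V); first exact: iP.
  rewrite (prE _ mV); congr EFin; apply/eqP; rewrite eq_le pr_ge0 andbT.
  by rewrite sumr_const mul0rn in V0.
- move=> x /= /negP; rewrite -leNgt => h; apply: VP => /=.
  by apply/eqP; rewrite eq_le h word_mass_ge0.
Qed.

Variable X : Sigma l -> 'rV[R]_d.
Hypothesis X_measurable : forall x r, measurable ([set y | enorm (X y - X x) <= r] : set T).
Hypothesis X_contract : forall j x y, agree j x y ->
  enorm (X x - X y) <= enorm (X (iter j sh x) - X (iter j sh y)).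

Variables (M rho : Sigma l -> R) (D rmin t : R).
Hypotheses (M0 : forall x, 0 < M x) (D0 : 0 < D) (rmin0 : 0 < rmin) (t0 : 0 < t).
Hypothesis rhoP : forall x, rmin <= rho x <= 2^-1.
Hypothesis Mcyl : forall x y, agree (n0 + p0) x y -> M x = M y.
Hypothesis rhocyl : forall x y, agree (n0 + p0) x y -> rho x = rho y.

Local Notation scale N x := (D * \prod_(i < N) rho (iter i T0 x)).

Hypothesis cover : forall N x, exists (L : finType) (kappa : Sigma l -> L),
  #|L|%:R <= \prod_(i < N) M (iter i T0 x) /\
  forall y y', agree (N * n0 + p0) x y -> agree (N * n0 + p0) x y' ->
    kappa y = kappa y' -> enorm (X y - X y') <= scale N x.

(** The weight of a concatenation of N blocks, shared equally among the pieces that the cover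
    allows. *)
Let Q N x := \prod_(i < N) word_mass (iter i T0 x) / \prod_(i < N) M (iter i T0 x).

Let prod_cyl (F : Sigma l -> R) N x y : (forall x y, agree (n0 + p0) x y -> F x = F y) ->
  agree (N * n0 + p0) x y ->
  \prod_(i < N) F (iter i T0 x) = \prod_(i < N) F (iter i T0 y).
Proof.
by move=> Fc xy; apply: eq_bigr => i _; apply/Fc/(agree_block (ltn_ord i) xy).
Qed.

(** The shift by [j] is there because [ergodic_blocks] controls sums along [T0] only from some
    [iter j sh x] with j < n0. The ball is still centred at the image of x: the first j maps are
    contractions and do not enlarge pieces. *)
Let bad j N : set T := [set x |
  pr m [set y | enorm (X y - X x) <= scale N (iter j sh x)] < Q N (iter j sh x) / 2 ^+ N].

Let prodM_gt0 N x : 0 < \prod_(i < N) M (iter i T0 x).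
Proof. by apply: prodr_gt0 => i _. Qed.

(** In each piece that contains a bad code u, all bad codes of the cylinder lie in the ball about
    the image of u, and this ball has small mass because u is bad. The number of pieces cancels the
    denominator of [Q]. *)
Lemma bad_word j N x0 : exists V : set T, [/\ measurable V,
  pr m V <= \prod_(i < N) word_mass (iter i T0 (iter j sh x0)) / 2 ^+ N &
  [set x | bad j N x /\ agree (j + (N * n0 + p0)) x0 x] `<=` V].
Proof.
set x' := iter j sh x0; have [L [kap [LM kapP]]] := cover N x'.
have mass_cyl x y : agree (n0 + p0) x y -> word_mass x = word_mass y.
  by move=> /(agree_le (leq_addr _ _)); exact: word_mass_cyl.
pose c := Q N x' / 2 ^+ N.
have c0 : 0 <= c.
  rewrite divr_ge0 ?exprn_ge0// divr_ge0 ?(ltW (prodM_gt0 _ _))//.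
  by apply: prodr_ge0 => i _; exact: word_mass_ge0.
have [V [mV Vc BV]] : exists V : set T, [/\ measurable V, pr m V <= \sum_(j : L) c &
    [set x | bad j N x /\ agree (j + (N * n0 + p0)) x0 x] `<=` V].
  apply: (@pr_cover _ _ _ m _ (fun a => [set x |
    [/\ bad j N x, agree (j + (N * n0 + p0)) x0 x & kap (iter j sh x) = a]])); last first.
    by move=> x [bx xx]; exists (kap (iter j sh x)).
  move=> a; have [[u [bu xu ku]]|none] := pselect (exists u,
      [/\ bad j N u, agree (j + (N * n0 + p0)) x0 u & kap (iter j sh u) = a]); last first.
    exists set0; split => //; first by rewrite /pr measure0.
    by move=> x xP; apply: none; exists x.
  have su := agree_shift xu.
  exists [set y | enorm (X y - X u) <= scale N x']; split => //.
    move: bu; rewrite /bad /= /c /Q (prod_cyl Mcyl su) (prod_cyl mass_cyl su).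
    by rewrite (prod_cyl rhocyl su) => /ltW.
  move=> x [_ xx kx] /=; apply: (le_trans (X_contract (j := j) _)).
    apply: agree_trans (agree_le (leq_addr _ _) (agree_sym xx)) _.
    exact: (agree_le (leq_addr _ _) xu).
  by apply: kapP; [exact: agree_shift xx|exact: su|rewrite kx ku].
exists V; split => //; apply: (le_trans Vc); rewrite sumr_const -[leLHS]mulr_natl /c /Q.
rewrite mulrA; apply: ler_wpM2r; first by rewrite invr_ge0 exprn_ge0.
rewrite mulrCA -[leRHS]mulr1; apply: ler_wpM2l.
  by apply: prodr_ge0 => i _; exact: word_mass_ge0.
by rewrite ler_pdivrMr ?mul1r.
Qed.

(** Summation over all words: the N blocks contribute 1 by [wsum_prod], the j leading and p0
    trailing letters the constant power of [l.+1]. *)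
Lemma bad_cover j N : exists V : set T, [/\ measurable V,
  pr m V <= l.+1%:R ^+ (j + p0) / 2 ^+ N & bad j N `<=` V].
Proof.
have [V [mV Vc BV]] := pr_cover (fun w : {ffun 'I_(j + (N * n0 + p0)) -> 'I_l.+1} =>
  bad_word j N (ext w)) (E := bad j N) (fun x bx => ex_intro _
    (prefix_of _ x) (conj bx (agree_sym (@ext_prefix _ (j + (N * n0 + p0)) x)))).
exists V; split => //; apply: (le_trans Vc); rewrite -mulr_suml; apply: ler_wpM2r.
  by rewrite invr_ge0 exprn_ge0.
have E := wsum_block (N * n0 + p0) (fun x => \prod_(i < N) word_mass (iter i T0 x))
  (fun (x y : Sigma l) (_ : agree j x y) => erefl (1 : R)).
have {}E : \sum_(w : {ffun 'I_(j + (N * n0 + p0)) -> 'I_l.+1})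
    \prod_(i < N) word_mass (iter i T0 (iter j sh (ext w))) = l.+1%:R ^+ (j + p0).
  rewrite exprD -(wsum_prod p0 N word_mass_cyl wsum_word_mass) -wsum1 -E.
  by apply: eq_bigr => w _; rewrite mul1r.
by rewrite E.
Qed.

Lemma ae_not_bad : {ae m, forall x, forall j, exists N0, forall N, (N0 <= N)%N ->
  ~ bad j N x}.
Proof.
apply: ae_foralln => j; have /choice[V VP] := bad_cover j.
have := @borel_cantelli _ _ _ m V (l.+1%:R ^+ (j + p0))
  (fun N => let: And3 h _ _ := VP N in h) (fun N => let: And3 _ h _ := VP N in h).
apply: filterS => x [N0 N0P]; exists N0 => N /N0P Vx bx; apply: Vx.
by case: (VP N) => _ _; apply.
Qed.

(** The contribution of one block to the logarithm of [Q] divided by the t-th power of the scale. *)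
Let F x : R := ln (word_mass x) - ln (M x) - t * ln (rho x).

Let bmf_F : bmf (F : T -> R).
Proof.
apply: (@cylinder_bmf R l (n0 + p0)) => x y xy; rewrite /F (Mcyl xy) (rhocyl xy).
by rewrite (word_mass_cyl (agree_le (leq_addr _ _) xy)).
Qed.

Let rho0 x : 0 < rho x.
Proof. by have /andP[h _] := rhoP x; exact: lt_le_trans h. Qed.

Let scale_gt0 N x : 0 < scale N x.
Proof. by apply: mulr_gt0 => //; apply: prodr_gt0 => i _; exact: rho0. Qed.

Let scaleS N x : rmin * scale N x <= scale N.+1 x.
Proof.
rewrite big_ord_recr/= [leRHS]mulrA [leRHS]mulrC; apply: ler_wpM2r; first exact/ltW/scale_gt0.
by have /andP[] := rhoP (iter N T0 x).
Qed.

Let scale_le N x : scale N x <= D * 2^-1 ^+ N.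
Proof.
apply: ler_wpM2l; first exact: ltW.
rewrite -[N in leRHS]card_ord -prodr_const; apply: ler_prod => i _.
by rewrite ltW//=; have /andP[] := rhoP (iter i T0 x).
Qed.

Let ln_Q N x : (forall i, 0 < word_mass (iter i sh x)) ->
  0 < Q N x /\ ln (Q N x) = bsum (iter n0 shT) F N x + t * (ln (scale N x) - ln D).
Proof.
move=> mu0; have mu0' i : 0 < word_mass (iter i T0 x).
  have -> : iter i T0 x = iter (i * n0) sh x by rewrite iterM.
  exact: mu0.
have pmu : 0 < \prod_(i < N) word_mass (iter i T0 x) by apply: prodr_gt0.
have prho : 0 < \prod_(i < N) rho (iter i T0 x) by apply: prodr_gt0 => i _; exact: rho0.
have pM := prodM_gt0 N x.
split; first exact: divr_gt0.
rewrite /Q ln_div ?posrE// (lnM_pos D0 prho).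
have lnp (G : Sigma l -> R) : (forall i, 0 < G (iter i T0 x)) ->
    ln (\prod_(i < N) G (iter i T0 x)) = \sum_(i < N) ln (G (iter i T0 x)).
  by move=> G0; apply: (@ln_prod _ N (fun i => G (iter i T0 x))) => i _; exact: G0.
rewrite (lnp _ mu0') (lnp M) ?(lnp rho)//.
rewrite /bsum /F !sumrB -mulr_sumr.
lra.
Qed.

Lemma local_dimension_bound : 2 < \int[m]_x F x ->
  exists2 c, 0 < c & {ae m, forall x, exists n1 : nat, forall n, (n1 <= n)%N ->
    c * (2^-1 ^+ n) `^ t <= pr m [set y | enorm (X y - X x) <= 2^-1 ^+ n]}.
Proof.
(* The sums of [F] are at least 2 N - q: one N pays for the factor 2^-N, since ln 2 <= 1, the other
   for q once N >= q. *)
move=> F2; have [] := ergodic_blocks n00 hinv herg bmf_F (ltr0Sn R 1) F2.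
move=> mB /(ae_prob1 mB) aeB.
(* The constant is (rmin / D)^t: the stopping scale is at least rmin times the radius, and scales
   carry the initial factor D. *)
exists (expR (t * (ln rmin - ln D))); first exact: expR_gt0.
apply: filterS3 aeB ae_not_bad ae_word_mass_gt0.
move=> x /= [j [jn0 [q qP]]] /(_ j)[N0 N0P] mu0.
set x' := iter j sh x in qP.
have mu0' i : 0 < word_mass (iter i sh x') by rewrite /x' -iterD.
pose K := maxn N0 q.
have half0 : 0 < 2^-1 :> R by rewrite invr_gt0.
have half1 : 2^-1 < 1 :> R by rewrite invf_lt1// ltr1n.
have sK0 : 0 < scale K x' / 2 by rewrite divr_gt0// scale_gt0.
(* The radius must be below the scale at [K], so that the stopping index exceeds both [N0] and
   [q]. *)
have [n1 n1P] := @geometric_le R 2^-1 1 _ half0 half1 sK0.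
exists n1 => n n1n; set e := 2^-1 ^+ n.
have e0 : 0 < e by rewrite exprn_gt0.
have eK : e < scale K x'.
  have := n1P n n1n; rewrite mul1r -/e; have := scale_gt0 K x'.
  by move: (scale K x') => s; lra.
move: e e0 eK => e e0 eK.
have [i0 i0P] : exists i, scale (K + i) x' <= e.
  have [N NP] := @geometric_le R 2^-1 D e half0 half1 e0.
  by exists N; apply: (le_trans (scale_le _ _)); apply: NP; rewrite leq_addl.
(* The first index after [K] at which the scale is at most e; the preceding scale exceeds e, hence
   this one exceeds rmin e. *)
have [i ie imin] := ex_minnP (ex_intro (fun i => scale (K + i) x' <= e) i0 i0P).
case: i ie imin => [|i] ie imin; first by move: ie; rewrite addn0 leNgt eK.
have ei : e < scale (K + i) x'.
  by rewrite ltNge; apply/negP => /imin; rewrite ltnn.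
pose N := (K + i.+1)%N.
have NK : (K <= N)%N by rewrite leq_addr.
have /N0P : (N0 <= N)%N by rewrite (leq_trans _ NK)// leq_maxl.
rewrite /bad /= => /negP; rewrite -leNgt -/x' => hN.
have qN : q%:R <= N%:R :> R by rewrite ler_nat (leq_trans _ NK)// leq_maxr.
have [Q0 lnQ] := ln_Q N mu0'.
have QN0 : 0 < Q N x' / 2 ^+ N by rewrite divr_gt0// exprn_gt0.
have h1 : expR (t * (ln rmin - ln D)) * e `^ t <= Q N x' / 2 ^+ N.
  rewrite /powR gt_eqF// -expRD -[leRHS]lnK ?posrE// ler_expR.
  rewrite ln_div ?posrE ?exprn_gt0// lnXn// lnQ.
  have h2 : ln rmin + ln e <= ln (scale N x').
    rewrite -lnM_pos//; apply: ln_le_pos; first exact: mulr_gt0.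
    rewrite /N addnS; apply: le_trans (scaleS _ _).
    by apply: ler_wpM2l; [exact: ltW|exact: ltW].
  have h3 := qP N.
  have h4 : ln (2 : R) <= 1 by rewrite (le_trans (@le_ln1Dx R 1 _))//; lra.
  have h5 := ler_wpM2l (ler0n R N) h4.
  have h6 := ler_wpM2l (ltW t0) h2.
  rewrite -[ln 2 *+ N]mulr_natl; move: h3 h5 h6.
  move: (bsum _ _ _ _) (ln (scale N x')) (ln D) (ln rmin) (ln e) => a b c g h.
  rewrite !(mulrDr, mulrBr, mulr1, mulrN).
  move: (t * b) (t * c) (t * g) (t * h) (N%:R * ln 2) => tb tc tg th u.
  lra.
apply: (le_trans h1); apply: (le_trans hN); apply: pr_le => // y /=.
by move=> /le_trans; apply; exact: ie.
Qed.

End local_dimension.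

(** * Choice of the blocks above the Lyapunov dimension *)

Section lower_bound.
Variables (R : realType) (d l : nat) (hd : (0 < d)%N) (Z U : set 'rV[R]_d).
Variable f : 'I_l.+1 -> 'rV[R]_d -> 'rV[R]_d.
Hypothesis hf : C1_IFS Z U f.
Variable z : 'rV[R]_d.
Hypothesis hz : U z.
Local Notation T := (borelType (Sigma l)).
Local Notation sh := (@left_shift l).
Local Notation shT := (@left_shift l : T -> T).
Local Notation X := (coding f z).
Variable m : probability T R.
Hypothesis hinv : measure_preserving m sh.
Hypothesis herg : ergodic m sh.
Implicit Types (x y : Sigma l).

Lemma coding_ball_measurable p r :
  measurable ([set y | enorm (X y - p) <= r] : set T).
Proof.
have mg : measurable_fun setT ((fun y => - enorm (X y - p)) : T -> R).
  apply: unif_agree_measurable => e e0.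
  have [c [D [c0 c1 D0 XD]]] := coding_agree hf hz.
  have [N NP] := geometric_le D c0 c1 e0.
  exists N => x y xy; have h := le_trans (XD _ _ _ xy) (NP N (leqnn N)).
  have h1 : enorm (X x - p) <= enorm (X x - X y) + enorm (X y - p).
    by apply: le_trans (enormD _ _); rewrite addrA subrK.
  have h2 : enorm (X y - p) <= enorm (X x - X y) + enorm (X x - p).
    by rewrite (enormB (X x)); apply: le_trans (enormD _ _); rewrite addrA subrK.
  by rewrite ler_norml; apply/andP; split; lra.
have := measurable_set_le (- r) mg; congr (measurable _).
by apply/seteqP; split => y /=; rewrite lerN2.
Qed.

Lemma coding_contract j x y : agree j x y ->
  enorm (X x - X y) <= enorm (X (iter j sh x) - X (iter j sh y)).
Proof.
move=> xy; rewrite (coding_shift hf hz x j) (coding_shift hf hz y j) -(agree_fword f xy).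
have [c [c0 c1 cP]] := contraction_ratio hf.
rewrite fword_fseq; apply: (le_trans (cP _ _ _ (coding_U hf hz _) (coding_U hf hz _))).
by rewrite ler_piMl ?enorm_ge0// exprn_ile1// ltW.
Qed.

(** The constant terms do not depend on [n0], so long blocks make them negligible. *)
Lemma cover_log_le (k : 'I_d) t n0 p0 x : 0 <= t -> k = minn (Num.truncn t) d.-1 :> nat ->
  ln (cover_number f z n0 p0 k x) + t * ln (cover_scale f z n0 p0 k x) <=
  d%:R * ln 4 + t * ln d.+1%:R + log_svf f z t n0 (trunc (n0 + p0) x).
Proof.
move=> t0 kE; rewrite /cover_number /cover_scale.
have -> : log_svf f z t n0 (trunc (n0 + p0) x) =
  ln (singular_value_fun t (cjac f z n0 (trunc (n0 + p0) x))) by [].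
move: (cjac _ _ _ _) (cjac_unit hf hz n0 (trunc (n0 + p0) x)) => A Au.
rewrite (ln_singular_value_fun hd Au t0).
have h := cover_exponent_le hd Au t0 kE.
have a0 := alpha_gt0 k Au.
have P0 := alpha_prod_gt0 Au (ltnW (ltn_ord k)).
move: (\sum_(i < d) _) (alpha A k) (alpha_prod A k) a0 P0 h => S a p a0 p0' h.
rewrite ln_div ?posrE ?mulr_gt0 ?exprn_gt0// !lnM_pos ?exprn_gt0// !lnXn//.
rewrite -[ln 4 *+ _]mulr_natl -[ln a *+ _]mulr_natl.
by move: h; rewrite mulrBl mulrDr; lra.
Qed.

Lemma coding_local_dimension t : lyapunov_dim f z m < t ->
  exists2 c, 0 < c & {ae m, forall x, exists n1 : nat, forall n, (n1 <= n)%N ->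
    c * (2^-1 ^+ n) `^ t <= pr m [set y | enorm (X y - X x) <= 2^-1 ^+ n]}.
Proof.
have lin1 (u v w : R) : w + 4 <= - (u + v) -> 2 < - u + - v + - (w + 1) by lra.
have lin2 (u v w r s : R) : v + w <= r + 1 + s ->
  u + - s + - (r + 1) <= u - v - w by lra.
move=> st; have [L0 Lspec] := lyapunov_dim_spec hd hf hz hinv.
have t0 : 0 < t := le_lt_trans L0 st.
have [gam gam0 [N2 _ N2P]] := Lspec _ (@mpartition_letter l) t st.
have kd : (minn (Num.truncn t) d.-1 < d)%N by rewrite (leq_ltn_trans (geq_minr _ _))// ltn_predL.
pose k : 'I_d := Ordinal kd.
have [b [c [b0 c0 c1 bc]]] := cjac_bounds hf hz.
have [c' [D [c'0 c'1 D0 XD]]] := coding_agree hf hz.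
have half0 : 0 < 2^-1 :> R by rewrite invr_gt0.
(* Blocks so long that the scale of every block is at most 1/2. *)
have [N1 N1P] := geometric_le d.+1%:R c0 c1 half0.
pose C : R := d%:R * ln 4 + t * ln d.+1%:R.
(* The gain [gam * n0] must beat [C + 4]: 1 for truncating codes, and the remaining 3 exceeds the
   margin 2 of [local_dimension_bound]. *)
pose N3 := (Num.truncn ((C + 4) / gam)).+1.
pose n0 := maxn (maxn N1 N2) N3.
have n00 : (0 < n0)%N by rewrite leq_max orbT.
have gn0 : C + 4 <= gam * n0%:R.
  rewrite mulrC -ler_pdivrMr//; apply: ltW; apply: (lt_le_trans (truncnS_gt _)).
  by rewrite ler_nat leq_max leqnn orbT.
have bn0 : 0 < b ^+ n0 by rewrite exprn_gt0.
(* The linearisation error is the lower bound [b ^+ n0] of all singular values, so it is absorbed by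
   the scale of the block. *)
have [r0 r00 lin] := cjac_uniform hf hz n0 bn0.
have [P1 P1P] := geometric_le D c'0 c'1 r00.
have [P2 P2P] := log_svf_unif hd hf hz n0 (ltW t0) (@ltr01 R).
(* [P1] letters bring images within [r0], the radius of linearisation; [P2] letters fix [log_svf] up
   to 1, which allows truncated codes in the cover. *)
pose p0 := maxn P1 P2.
have cov N x : exists (L : finType) (kappa : Sigma l -> L),
    #|L|%:R <= \prod_(i < N) cover_number f z n0 p0 k (iter i (iter n0 sh) x) /\
    forall y y', agree (N * n0 + p0) x y -> agree (N * n0 + p0) x y' ->
      kappa y = kappa y' -> enorm (X y - X y') <=
        D * \prod_(i < N) cover_scale f z n0 p0 k (iter i (iter n0 sh) x).
  have XD0 x1 y1 : enorm (X x1 - X y1) <= D.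
    by have := XD 0%N x1 y1; rewrite expr0 mulr1; apply.
  have ba x1 : b ^+ n0 <= alpha (cjac f z n0 x1) k by have /andP[] := bc n0 x1 k.
  have Xr x1 y1 : agree p0 x1 y1 -> enorm (X x1 - X y1) <= r0.
    move=> xy; apply: (le_trans (XD _ _ _ xy)); apply: P1P; exact: leq_maxl.
  exact: (@cylinder_cover R d l Z U f hf z hz n0 p0 k D (b ^+ n0) r0 XD0 D0 ba Xr lin N x).
have M0 x := cover_number_gt0 hf hz n0 p0 k x.
have Mcyl x y := @cover_number_cyl R d l f z n0 p0 k x y.
have rcyl x y := @cover_scale_cyl R d l f z n0 p0 k x y.
have rP x : d.+1%:R * b ^+ n0 <= cover_scale f z n0 p0 k x <= 2^-1.
  rewrite /cover_scale; have := bc n0 (trunc (n0 + p0) x) k.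
  move: (alpha _ _) => a /andP[ba ac]; apply/andP; split; first exact: ler_wpM2l.
  apply: le_trans (N1P n0 _); last by rewrite /n0 !leq_max leqnn.
  exact: ler_wpM2l.
have logle x : ln (cover_number f z n0 p0 k x) + t * ln (cover_scale f z n0 p0 k x) <=
    C + 1 + log_svf f z t n0 x.
  have h1 := cover_log_le (k := k) n0 p0 x (ltW t0) erefl.
  have h2 := P2P _ _ (agree_le (leq_trans (leq_maxr P1 P2) (leq_addl n0 p0))
    (@trunc_agree l (n0 + p0) x)).
  apply: (le_trans h1); rewrite -[leRHS]addrA lerD2l -lerBlDr.
  by apply: (le_trans (ler_norm _)); rewrite distrC.
move: (cover_number f z n0 p0 k) (cover_scale f z n0 p0 k) cov M0 Mcyl rcyl rP logle
  => M rho cov M0 Mcyl rcyl rP logle.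
have rm0 : 0 < d.+1%:R * b ^+ n0 by rewrite mulr_gt0.
apply: (@local_dimension_bound R d l m hinv herg n0 p0 n00 X
  (fun x => coding_ball_measurable (X x)) coding_contract M rho D _ t M0 D0 rm0 t0
  rP Mcyl rcyl cov).
have ml := @mlabel_word R l m hinv n0.
pose mass x : R := ln (word_mass m n0 x).
have bmass : bmf (mass : T -> R).
  exact: (bmf_label (fun w => ln (pmass m _ w)) ml).
have bsvf := log_svf_bmf hd hf hz n0 (ltW t0).
have massE : \int[m]_x mass x = - partition_entropy m shT (fun x : T => x 0%N) n0.
  by rewrite partition_entropyE lentropyE ?opprK.
have n0N2 : (N2 <= n0)%N by rewrite /n0 leq_max leq_max leqnn orbT.
have hH := N2P n0 n0N2.
apply: (@lt_le_trans _ _ (\int[m]_x (mass x + - (log_svf f z t n0 x) + - (C + 1)))).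
  have bN := bmfN bsvf; have bD := bmfD bmass bN.
  rewrite (expD m bD (bmf_cst _)) (expD m bmass bN) (expN m bsvf) (exp_cst m) massE.
  apply: lin1; apply: (le_trans gn0); rewrite lerNr -mulNr; exact: hH.
apply: (exp_le m).
- exact: (bmfD (bmfD bmass (bmfN bsvf)) (bmf_cst _)).
- apply: (@cylinder_bmf R l (n0 + p0)) => x y xy; rewrite (Mcyl _ _ xy) (rcyl _ _ xy).
  by rewrite (word_mass_cyl m (agree_le (leq_addr _ _) xy)).
- by move=> x; apply: lin2; exact: logle.
Qed.

End lower_bound.

(** A radius between consecutive powers of 1/2 costs a factor 2^t. This and c are bounded on the
    logarithmic scale, and the passage from t to t' absorbs them because ln r tends to minus
    infinity. *)
Lemma limf_esup_ln_ratio_le (R : realType) (beta : R -> R) (c t t' : R) (n1 : nat) :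
  0 < c -> 0 <= t -> t < t' -> {homo beta : r s / r <= s} ->
  (forall n, (n1 <= n)%N -> c * (2^-1 ^+ n) `^ t <= beta (2^-1 ^+ n)) ->
  (limf_esup (fun r : R => (ln (beta r) / ln r)%:E) 0^'+ <= t'%:E)%E.
Proof.
move=> c0 t0 tt' beta_nd betaP.
have half0 : 0 < 2^-1 :> R by rewrite invr_gt0.
have half1 : 2^-1 < 1 :> R by rewrite invf_lt1// ltr1n.
have tt0 : 0 < t' - t by rewrite subr_gt0.
(* By monotonicity ln (beta r) >= t ln r - K; below [r1] one has (t' - t) ln r < -K, so the bound
   improves to t' ln r. *)
pose K := t * ln 2 - ln c; pose r1 := expR (- (K / (t' - t))).
have r10 : 0 < r1 := expR_gt0 _.
have n10 : 0 < 2^-1 ^+ n1 :> R by rewrite exprn_gt0.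
apply: ge_ereal_inf.
exists (ereal_sup ((fun r : R => (ln (beta r) / ln r)%:E) @`
    [set r | [/\ 0 < r, r < r1, r < 1 & r < 2^-1 ^+ n1]])).
  exists [set r | [/\ 0 < r, r < r1, r < 1 & r < 2^-1 ^+ n1]] => //.
  near=> r; split; near: r; [exact: nbhs_right_gt|exact: nbhs_right_lt..].
apply: ge_ereal_sup => _ [r [r0 rr1 rlt1 rn1] <-]; rewrite lee_fin.
have [i0 i0P] : exists i, 2^-1 ^+ (n1 + i) <= r.
  have [N NP] := @geometric_le R 2^-1 1 r half0 half1 r0.
  by exists N; have := NP (n1 + N)%N (leq_addl _ _); rewrite mul1r.
have [i ie imin] := ex_minnP (ex_intro (fun i => 2^-1 ^+ (n1 + i) <= r) i0 i0P).
case: i ie imin => [|i] ie imin; first by move: ie; rewrite addn0 leNgt rn1.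
have ri : r < 2^-1 ^+ (n1 + i).
  by rewrite ltNge; apply/negP => /imin; rewrite ltnn.
have lnr : ln r < 0 by rewrite ln_lt0// r0.
rewrite ler_ndivrMr//.
have e0 : 0 < 2^-1 ^+ (n1 + i.+1) :> R by rewrite exprn_gt0.
have h1 := le_trans (betaP (n1 + i.+1)%N (leq_addr _ _)) (beta_nd _ _ ie).
have h2 : 0 < c * (2^-1 ^+ (n1 + i.+1)) `^ t by rewrite mulr_gt0// powR_gt0.
have h3 := ln_le_pos h2 h1.
apply: le_trans h3; rewrite lnM_pos ?powR_gt0// ln_powR.
have h4 : ln r - ln 2 <= ln (2^-1 ^+ (n1 + i.+1) : R).
  rewrite -ln_div ?posrE//; apply: ln_le_pos; first exact: divr_gt0.
  by rewrite addnS exprSr ler_pM2r// ltW.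
have h5 : ln r < - (K / (t' - t)) by rewrite -[ltRHS]expRK ltr_ln ?posrE.
have h6 := ler_wpM2l t0 h4.
have h7 : ln r * (t' - t) < - K by rewrite -ltr_pdivlMr// mulNr.
move: h6 h7; rewrite /K mulrBr mulrBr [ln r * _]mulrC [ln r * _]mulrC.
move: (ln r) (ln 2) (ln _) (ln c) => a b e g; lra.
Unshelve. all: by end_near. Qed.

(** * Measurability of ball masses and the conclusion *)

Section ball_masses.
Variables (R : realType) (d l : nat) (Z U : set 'rV[R]_d).
Variable f : 'I_l.+1 -> 'rV[R]_d -> 'rV[R]_d.
Hypothesis hf : C1_IFS Z U f.
Variable z : 'rV[R]_d.
Hypothesis hz : U z.
Local Notation T := (borelType (Sigma l)).
Local Notation X := (coding f z).
Variable m : probability T R.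

Lemma coding_measurable : measurable_fun setT (X : T -> borelType 'rV[R]_d).
Proof.
apply: (@measurability _ _ T (borelType 'rV[R]_d) _ _ (@open 'rV[R]_d)) => //.
move=> _ [A oA <-]; rewrite setTI; apply: agree_measurable => x /= Ax.
have /nbhs_enormP[e e0 eP] : nbhs (X x) A by exact: open_nbhs_nbhs.
have [c [D [c0 c1 D0 XD]]] := coding_agree hf hz.
have [N NP] := geometric_le D c0 c1 e0.
exists N => y xy; apply: eP; apply: le_trans (NP N (leqnn N)).
exact/XD/agree_sym.
Qed.

Local Notation beta p r := (pr m [set y | enorm (X y - p) <= r]).

(** The closed balls of radius r + 1/(n+1) about p decrease to the one of radius r, and they contain
    the balls of radius r about all q within 1/(n+1) of p. *)
Lemma ball_mass_usc p r a : beta p r < a -> exists2 e, 0 < e &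
  forall q, enorm (q - p) <= e -> beta q r < a.
Proof.
move=> pa; pose F n : set T := [set y | enorm (X y - p) <= r + n.+1%:R^-1] `\`
  [set y | enorm (X y - p) <= r].
have mB q s := coding_ball_measurable hf hz q s.
have mF n : measurable (F n) by exact: measurableD.
have half : 0 < (a - beta p r) / 2 by rewrite divr_gt0// subr_gt0.
have [|| n nP] := @pr_decreasing_limit _ _ m F _ mF _ _ half.
- move=> n y [h1 h2]; split => //=; apply: (le_trans h1).
  by rewrite lerD2l lef_pV2 ?posrE// ler_nat.
- apply/seteqP; split => // y Fy; have [_ /negP] := Fy 0%N I; rewrite -ltNge => h.
  have h0 : 0 < enorm (X y - p) - r by rewrite subr_gt0.
  have [n _ nP] := near_infty_natSinv_lt (PosNum h0).
  have [/= h1 _] := Fy n I.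
  have h3 : n.+1%:R^-1 < enorm (X y - p) - r := nP n (leqnn n).
  by move: h1 h3; move: (enorm _) (n.+1%:R^-1) => u v; lra.
exists n.+1%:R^-1; first by rewrite invr_gt0.
move=> q qp; apply: (@le_lt_trans _ _ (beta p r + pr m (F n))); last first.
  by move: nP half; lra.
apply: le_trans (pr_setU m (mB p r) (mF n)); apply: pr_le => //.
  exact: measurableU.
move=> y /= yq; have [h|h] := pselect (enorm (X y - p) <= r); [by left|right].
split => //=; apply: le_trans (lerD yq qp); apply: le_trans (enormD _ _).
by rewrite addrA subrK.
Qed.

Lemma ball_mass_measurable r a :
  measurable ([set p | a <= beta p r] : set (borelType 'rV[R]_d)).
Proof.
have -> : [set p | a <= beta p r] = ~` [set p | beta p r < a].
  by apply/seteqP; split => p /=; rewrite leNgt => /negP.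
apply: measurableC; apply: sub_sigma_algebra; rewrite openE => p /= pa.
by have [e e0 eP] := ball_mass_usc pa; apply/nbhs_enormP; exists e.
Qed.

End ball_masses.

Theorem theorem1p2 (R : realType) (d l : nat) (hd : (0 < d)%N)
  (Z U : set 'rV[R]_d) (f : 'I_l.+1 -> 'rV[R]_d -> 'rV[R]_d)
  (hf : C1_IFS Z U f) (z : 'rV[R]_d) (hz : U z)
  (m : probability (borelType (Sigma l)) R)
  (hinv : measure_preserving m (@left_shift l))
  (herg : ergodic m (@left_shift l)) :
  (upper_packing_dim
     (pushforward m (coding f z : borelType (Sigma l) -> borelType 'rV[R]_d))
   <= (lyapunov_dim f z m)%:E)%E.
Proof.
have [s0 _] := lyapunov_dim_spec hd hf hz hinv.
apply/lee_addgt0Pr => e e0; rewrite -EFinD; set s := lyapunov_dim f z m in s0 *.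
(* Half of [e] lifts the exponent strictly above the Lyapunov dimension, the other half turns the
   mass bound into a bound for the local dimension. *)
have se : s < s + e / 2 by rewrite ltrDl divr_gt0.
have [c c0 cP] := coding_local_dimension hd hf hz hinv herg se.
set t := s + e / 2 in se cP.
(* Negligibility for the push-forward calls for a Borel set of points of R^d. The complement of the
   union of the [E n1] is one, and its preimage under the coding map is null by [cP]. *)
pose E n1 : set (borelType 'rV[R]_d) := \bigcap_(n in [set n | (n1 <= n)%N])
  [set p | c * (2^-1 ^+ n) `^ t <=
    pr m [set y | enorm (coding f z y - p) <= 2^-1 ^+ n]].
have mE n1 : measurable (E n1).
  by apply: bigcap_measurable => [|n _]; [exists n1 => /=|exact: (ball_mass_measurable hf hz)].
have mU : measurable (~` \bigcup_n1 E n1) by apply/measurableC/bigcup_measurable.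
have mX := coding_measurable hf hz.
apply: ereal_inf_lbound => /=; exists (~` \bigcup_n1 E n1); split => //.
  rewrite /pushforward; apply: measure_negligible.
    by rewrite -[X in measurable X]setTI; exact: mX.
  apply: negligibleS cP => y /= yE [n1 n1P]; apply: yE; exists n1 => // n n1n.
move=> p /= pn [n1 _ n1P]; apply: pn => _.
apply: (@limf_esup_ln_ratio_le _ _ c t _ n1) => //.
- by rewrite addr_ge0// ltW// divr_gt0.
- by rewrite /t ltrD2l ltr_pdivrMr// ltr_pMr// ltr1n.
- move=> r r' rr'; apply: pr_le => [||y /= /le_trans]; last exact.
  exact: (coding_ball_measurable hf hz).
exact: (coding_ball_measurable hf hz).
Qed.
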